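(* Let $e=\min\{i\ge 2 : \ell \mid \frac{q^i-1}{q-1}\}$ and $d=\nu_\ell\big(\frac{q^e-1}{q-1}\big)$. Consider the series of $KG$-modules $$L=L(0)\supseteq L(1)\supseteq L(2)\supseteq\cdots .$$ (a) If $d\le \ell$, then this series (repeated terms deleted) is a composition series of $L$ provided $\lfloor n/e\rfloor\le d\ell$. (b) If $d=\ell+1$, then this series (repeated terms deleted) is a composition series of $L$ provided $\lfloor n/e\rfloor\le \ell^2$. (c) If $d>\ell+1$, then this series (repeated terms deleted) is a composition series of $L$ provided $\lfloor n/e\rfloor<\ell^2+\ell$.
   Context: Let $n\ge 2$ and $G=\mathrm{GL}_n(q)$, the general linear group over the finite field $F_q$ of characteristic $p$. Let $\ell\ne p$ be a prime, and let $R$ be a local principal ideal domain of characteristic $0$ with maximal ideal $\ell R$, containing a primitive $p$-th root of unity; $K=R/\ell R$. Modules are left modules. $\nu_\ell$ denotes the $\ell$-adic valuation of integers. $B$ is the group of upper triangular matrices in $G$; $S_n$ is viewed as the subgroup of permutation matrices of $G$; $\widehat{S}=\sum_{s\in S}s\in RG$ for $S\subseteq G$. Put $\varepsilon=\sum_{\sigma\in S_n}\mathrm{sg}(\sigma)\,\sigma\widehat{B}\in RG$, where $\mathrm{sg}$ is the sign. The Steinberg lattice is the left ideal $I=RG\cdot\varepsilon$, and $L=I/\ell I$, a $KG$-module. Let $f:I\times I\to R$ be the restriction to $I$ of the $R$-bilinear form on $RG$ given by $(g,h)\mapsto\delta_{g,h}$ for $g,h\in G$, scaled by $1/|B|$ (it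 takes values in $R$). For $c\ge 0$ put $I(c)=\{x\in I : f(x,I)\subseteq \ell^cR\}$ and $L(c)=(I(c)+\ell I)/\ell I$. *)

(* Defs.v *)
From HB Require Import structures.
From mathcomp Require Import all_boot all_fingroup all_algebra.
From mathcomp Require Import boolp classical_sets generic_quotient.

Set Implicit Arguments.
Unset Strict Implicit.
Unset Printing Implicit Defensive.

Import GRing.Theory.
Local Open Scope ring_scope.
Local Open Scope quotient_scope.

(* An alias of [{ffun gT -> R}], whose library ring structure is the pointwise
   product; here the product is convolution. *)
Definition galg (R : pzRingType) (gT : finGroupType) := {ffun gT -> R}.

Section GroupAlgebra.
Variables (R : pzRingType) (gT : finGroupType).
Local Notation A := (galg R gT).

HB.instance Definition _ := GRing.Zmodule.on A.

Definition gmul (a b : A) : A :=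
  [ffun g => \sum_(h : gT) a h * b (h^-1 * g)%g].

Definition gbasis (g : gT) : A := [ffun h => (h == g)%:R].

Fact gmulA : associative gmul.
Proof.
move=> a b c; apply/ffunP => g; rewrite !ffunE.
under eq_bigr => h _ do rewrite ffunE big_distrr /=.
rewrite exchange_big /=.
under [RHS]eq_bigr => k _ do rewrite ffunE big_distrl /=.
rewrite [RHS]exchange_big /= [LHS]exchange_big /=.
apply: eq_bigr => h _.
rewrite (reindex_inj (mulgI h^-1%g)) /=.
apply: eq_bigr => k _.
by rewrite mulrA invMg invgK -!mulgA mulKVg.
Qed.

Fact gmul1l : left_id (gbasis 1%g) gmul.
Proof.
move=> a; apply/ffunP => g; rewrite !ffunE (bigD1 1%g) //= ffunE eqxx mul1r.
rewrite invg1 mul1g big1 ?addr0 // => h /negPf h1.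
by rewrite ffunE h1 mul0r.
Qed.

Fact gmul1r : right_id (gbasis 1%g) gmul.
Proof.
move=> a; apply/ffunP => g; rewrite !ffunE (bigD1 g) //= ffunE mulVg eqxx mulr1.
rewrite big1 ?addr0 // => h /negPf hg.
by rewrite ffunE -eq_mulVg1 hg mulr0.
Qed.

Fact gmulDl : left_distributive gmul +%R.
Proof.
move=> a b c; apply/ffunP => g; rewrite !ffunE -big_split /=.
by apply: eq_bigr => h _; rewrite ffunE mulrDl.
Qed.

Fact gmulDr : right_distributive gmul +%R.
Proof.
move=> a b c; apply/ffunP => g; rewrite !ffunE -big_split /=.
by apply: eq_bigr => h _; rewrite ffunE mulrDr.
Qed.

HB.instance Definition _ :=
  GRing.Zmodule_isPzRing.Build A gmulA gmul1l gmul1r gmulDl gmulDr.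

Definition ghat (S : {set gT}) : A := \sum_(s in S) gbasis s.

(* The bilinear form for which the group elements are orthonormal. *)
Definition gform (a b : A) : R := \sum_(g : gT) a g * b g.

End GroupAlgebra.

Definition multiples (V : zmodType) (l : nat) : {pred V} :=
  fun x => `[< exists y : V, x = y *+ l >].
Arguments multiples : clear implicits.

Section Multiples.
Variables (V : zmodType) (l : nat).

Lemma multiplesP (x : V) :
  reflect (exists y : V, x = y *+ l) (x \in multiples V l).
Proof. exact: asboolP. Qed.

Fact multiples_zmod_closed : zmod_closed (multiples V l).
Proof.
split; first by apply/multiplesP; exists 0; rewrite mul0rn.
move=> _ _ /multiplesP[x ->] /multiplesP[y ->].
by apply/multiplesP; exists (x - y); rewrite mulrnBl.
Qed.

HB.instance Definition _ :=
  GRing.isZmodClosed.Build V (multiples V l) multiples_zmod_closed.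

Definition modl := {ideal_quot (multiples V l)}.

HB.instance Definition _ := GRing.Zmodule.on modl.
HB.instance Definition _ := Quotient.on modl.

Definition to_modl (x : V) : modl := \pi_modl x.

Lemma modlP (x y : V) :
  reflect (exists z : V, x - y = z *+ l) (to_modl x == to_modl y).
Proof. by rewrite /to_modl -Quotient.idealrBE; apply: multiplesP. Qed.

Lemma to_modl_surj (v : modl) : {x : V | v = to_modl x}.
Proof. by exists (repr v); rewrite /to_modl reprK. Qed.

Fact to_modl_is_zmod_morphism : zmod_morphism to_modl.
Proof. by move=> x y; rewrite /to_modl raddfB. Qed.

HB.instance Definition _ :=
  GRing.isZmodMorphism.Build V modl to_modl to_modl_is_zmod_morphism.

End Multiples.

Arguments modl : clear implicits.
Arguments to_modl {V} l x.

Section ModRing.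
Variables (R : comPzRingType) (l : nat).
Local Notation K := (modl R l).

Definition modl_mul (x y : K) : K := to_modl l (repr x * repr y).

Fact to_modl_mul (x y : R) :
  modl_mul (to_modl l x) (to_modl l y) = to_modl l (x * y).
Proof.
rewrite /modl_mul; apply/eqP/modlP.
have /eqP/modlP[u hu] := reprK (to_modl l x).
have /eqP/modlP[v hv] := reprK (to_modl l y).
exists (u * repr (to_modl l y) + x * v).
by rewrite mulrnDl -mulrnAl -mulrnAr -hu -hv mulrBl mulrBr addrA addrNK.
Qed.

Fact modl_mulA : associative modl_mul.
Proof.
move=> x y z; have [a ->] := to_modl_surj x; have [b ->] := to_modl_surj y.
have [c ->] := to_modl_surj z.
by rewrite (to_modl_mul b) (to_modl_mul a b) !to_modl_mul mulrA.
Qed.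

Fact modl_mulC : commutative modl_mul.
Proof. by move=> x y; rewrite /modl_mul mulrC. Qed.

Fact modl_mul1 : left_id (to_modl l 1) modl_mul.
Proof.
by move=> x; have [a ->] := to_modl_surj x; rewrite to_modl_mul mul1r.
Qed.

Fact modl_mulDl : left_distributive modl_mul +%R.
Proof.
move=> x y z; have [a ->] := to_modl_surj x; have [b ->] := to_modl_surj y.
have [c ->] := to_modl_surj z.
by rewrite -raddfD (to_modl_mul a) (to_modl_mul b) to_modl_mul mulrDl raddfD.
Qed.

HB.instance Definition _ := GRing.Zmodule_isComPzRing.Build K
  modl_mulA modl_mulC modl_mul1 modl_mulDl.

Fact to_modl_is_monoid_morphism : monoid_morphism (to_modl l : R -> K).
Proof. by split=> // x y; rewrite -to_modl_mul. Qed.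

HB.instance Definition _ :=
  GRing.isMonoidMorphism.Build R K (to_modl l) to_modl_is_monoid_morphism.

End ModRing.

Section ModModule.
Variables (R : comPzRingType) (gT : finGroupType) (l : nat).
Variable M : lmodType (galg R gT).
Local Notation K := (modl R l).
Local Notation L := (modl M l).

Definition gred (a : galg R gT) : galg K gT := [ffun g => to_modl l (a g)].

Definition glift (a : galg K gT) : galg R gT := [ffun g => repr (a g)].

(* The action of [KG] on [L] induced from that of [RG] on [M]; it does not
   depend on the representatives chosen, by [to_modl_scale]. *)
Definition modl_scale (a : galg K gT) (v : L) : L :=
  to_modl l (glift a *: repr v).

Fact to_modl_scale a v :
  modl_scale (gred a) (to_modl l v) = to_modl l (a *: v).
Proof.
rewrite /modl_scale; apply/eqP/modlP.
have /eqP/modlP[u hu] := reprK (to_modl l v).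
have hb g : exists c : R, glift (gred a) g - a g = c *+ l.
  by rewrite !ffunE; apply/modlP; rewrite /to_modl reprK.
have [b {}hb] := choice hb.
pose c : galg R gT := [ffun g => b g].
have hc : glift (gred a) - a = c *+ l.
  have hn : forall (k : nat) g, (c *+ k) g = b g *+ k.
    by elim=> [|k IHk] g; rewrite ?mulr0n ?mulrS ffunE // IHk ffunE.
  by apply/ffunP => g; rewrite hn -hb !ffunE.
exists (c *: repr (to_modl l v) + a *: u).
rewrite mulrnDl (scalerMnr a) -hu (scalerMnl c) -hc.
by rewrite scalerBl scalerBr addrA addrNK.
Qed.

Fact gredK a : gred (glift a) = a.
Proof. by apply/ffunP => g; rewrite !ffunE /to_modl reprK. Qed.

Fact gredD : {morph gred : a b / a + b}.
Proof. by move=> a b; apply/ffunP => g; rewrite !ffunE raddfD. Qed.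

Fact gredM : {morph gred : a b / a * b}.
Proof.
move=> a b; apply/ffunP => g; rewrite !ffunE raddf_sum.
by apply: eq_bigr => h _; rewrite !ffunE; apply: rmorphM.
Qed.

Fact gred1 : gred 1 = 1.
Proof.
apply/ffunP => g; rewrite !ffunE; case: (g == 1%g).
  exact: rmorph1.
exact: raddf0.
Qed.

Fact modl_scaleA a b v : modl_scale a (modl_scale b v) = modl_scale (a * b) v.
Proof.
have [x ->] := to_modl_surj v; rewrite -[a]gredK -[b]gredK -gredM.
by rewrite (to_modl_scale (glift b) x) !to_modl_scale scalerA.
Qed.

Fact modl_scale1 : left_id 1 modl_scale.
Proof.
move=> v; have [x ->] := to_modl_surj v.
by rewrite -gred1 to_modl_scale scale1r.
Qed.

Fact modl_scaleDr : right_distributive modl_scale +%R.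
Proof.
move=> a v w; have [x ->] := to_modl_surj v; have [y ->] := to_modl_surj w.
by rewrite -[a]gredK -raddfD !to_modl_scale scalerDr raddfD.
Qed.

Fact modl_scaleDl v : {morph modl_scale^~ v : a b / a + b}.
Proof.
move=> a b; have [x ->] := to_modl_surj v; rewrite -[a]gredK -[b]gredK -gredD.
by rewrite !to_modl_scale scalerDl raddfD.
Qed.

HB.instance Definition _ := GRing.Zmodule_isLmodule.Build (galg K gT) L
  modl_scaleA modl_scale1 modl_scaleDr modl_scaleDl.

End ModModule.

Local Open Scope classical_set_scope.

Section Submodules.
Variables (A : pzRingType) (V : lmodType A).

Definition is_submodule (X : set V) : Prop := submod_closed [in X].

Definition is_maximal_submodule (X Y : set V) : Prop :=
  [/\ is_submodule X, X `<` Y &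
      forall Z, is_submodule Z -> X `<=` Z -> Z `<=` Y -> Z = X \/ Z = Y].

Definition is_composition_series (m : nat) (M : nat -> set V) : Prop :=
  [/\ M 0%N = setT, M m = [set 0] &
      forall i, (i < m)%N -> is_maximal_submodule (M i.+1) (M i)].

(* [D] is a descending chain, so it is determined, once its repeated terms are
   deleted, by its set of terms. *)
Definition composition_series_up_to_repetition (D : nat -> set V) : Prop :=
  (forall c, D c.+1 `<=` D c) /\
  exists (m : nat) (M : nat -> set V),
    is_composition_series m M /\ [set M i | i in `I_m.+1] = range D.

End Submodules.

Definition is_pid (R : idomainType) : Prop :=
  forall J : set R^o, is_submodule J ->
    exists a : R, J = [set r * a | r in setT].

Definition local_with_maximal_ideal (R : idomainType) (m : set R) : Prop :=
  forall J : set R^o, is_maximal_submodule J setT <-> J = m.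

Definition left_ideal (A : pzRingType) (x : A) : {pred A^o} :=
  fun y => `[< exists a : A, y = a * x >].

Section LeftIdeal.
Variables (A : pzRingType) (x : A).

Fact left_ideal_submod_closed : submod_closed (left_ideal x).
Proof.
split; first by apply/asboolP; exists 0; rewrite mul0r.
move=> a _ _ /asboolP[b ->] /asboolP[c ->].
by apply/asboolP; exists (a * b + c); rewrite mulrDl -mulrA.
Qed.

HB.instance Definition _ :=
  GRing.isSubmodClosed.Build A A^o (left_ideal x) left_ideal_submod_closed.

Record left_ideal_type := LeftIdeal {
  left_ideal_val :> A^o;
  _ : left_ideal_val \in left_ideal x }.

HB.instance Definition _ := [isSub for left_ideal_val].
HB.instance Definition _ := [Choice of left_ideal_type by <:].
HB.instance Definition _ := [SubChoice_isSubLmodule of left_ideal_type by <:].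

End LeftIdeal.

(* [{'GL_n[F]}] consists of the invertible matrices of size [n.-1.+1], which is
   [n] only for [n > 0]. *)
Section Steinberg.
Variables (n : nat) (F : finFieldType).
Local Notation G := {'GL_n[F]}.

Definition borel : {set G} := [set g : G | is_trig_mx (GLval g)^T].

Definition perm_GL (s : 'S_n.-1.+1) : G :=
  FinRing.unit 'M[F]_n.-1.+1 (unitmx_perm F s).

Variable R : idomainType.

Definition steinberg_elt : galg R G :=
  \sum_(s : 'S_n.-1.+1) (-1) ^+ s * (gbasis R (perm_GL s) * ghat R borel).

Definition steinberg := left_ideal_type steinberg_elt.

(* [|B|] need not be a unit of [R], so the scaled form is defined with values
   in the field of fractions. *)
Definition steinberg_form (x y : steinberg) : {fraction R} :=
  tofrac (gform (left_ideal_val x) (left_ideal_val y)) / #|borel|%:R.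

Definition jantzen (l c : nat) : set steinberg :=
  [set x | forall y, exists r : R, steinberg_form x y = tofrac (l%:R ^+ c * r)].

Definition steinberg_mod (l : nat) := modl steinberg l.

Definition jantzen_mod (l c : nat) : set (steinberg_mod l) :=
  [set to_modl l (x + y *+ l) | x in jantzen l c & y in setT].

End Steinberg.

Arguments borel : clear implicits.
Arguments steinberg : clear implicits.
Arguments steinberg_mod : clear implicits.
Arguments jantzen : clear implicits.
Arguments jantzen_mod : clear implicits.

(* Main.v *)
From HB Require Import structures.
Require Import Defs.
From mathcomp Require Import all_boot all_fingroup all_algebra all_field.
From mathcomp Require Import boolp classical_sets.
From mathcomp Require Import zify ring.

Set Implicit Arguments.
Unset Strict Implicit.
Unset Printing Implicit Defensive.

Import GRing.Theory.

(** Let [U] be the unitriangular group and [eps] the generator of the Steinberg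
    lattice.  The translates of [eps] are modular symbols: alternating sums of the
    flags of a frame.  They satisfy the relation [frame_relation] between the
    frames obtained by substituting one vector for each vector of a frame, and
    this relation straightens every frame, so that the translates of [eps] by [U]
    span the lattice ([left_ideal_span]).

    The ring contains the values of the characters of [U], and [q] is a unit, so
    every nonzero subquotient of the reduced lattice contains an eigenvector of [U]; moving
    it by elements of the group, one may take its character to be given by a
    matrix [B] on the superdiagonal ([weight_exists]).  The corresponding
    eigenvectors in the lattice form a single line, spanned by [E B], the character
    sum applied to [eps] ([char_vec]).  Hence a submodule of the reduction is controlled by the
    set of those [E B] that it contains ([char_vec_separates]).

    The form of [E B] and [eps], divided by the order of the Borel subgroup, is the
    number [gram_num B]: the sum of [q] to the number of noninversions over the
    permutations having a descent wherever [B] does not vanish.  This is the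
    q-multinomial coefficient of the composition of [n] cut out by the zeros of
    [B], and the image of [E B] lies in the [c]-th term of the filtration exactly when
    [l ^ c] divides it ([char_vec_jantzen]).  So a step of the filtration is trivial or
    simple as soon as any two [E B], [E C] whose numbers have the same valuation
    generate each other.

    Permutation matrices that exchange two adjacent intervals of coordinates send
    [E B] to a unit multiple of another [E B'] under the projection to the
    character [B'] ([char_vec_relabel], which rests on the vanishing statement
    [block_sum_vanish]).  By adjointness the coefficient of the way back is a
    quotient of Gram numbers, a unit if they have the same valuation.  One may
    thus exchange adjacent parts of a composition, and split a part into two when
    this does not change the valuation.

    The rest is arithmetic.  The valuation of the q-factorial of [m] is
    [d * (m %/ e) + logn l (m %/ e)`!].  When [n %/ e < l ^ 2 + l], all parts split
    without loss into parts [1], [e], [e * l] and [e * l ^ 2], and the three bounds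
    of the theorem ensure that the multiplicities of these parts can be read off
    from the valuation ([weights_inj]).  Two compositions with the
    same valuation therefore become equal up to order ([link_of_val]), which
    proves [linked_of_val] and the theorem. *)

(** * Permutations with prescribed descents *)

Section Count.
Variable q : nat.

Definition descends (J : nat -> bool) n (s : 'S_n) : bool :=
  [forall i : 'I_n, forall j : 'I_n, ((j == i.+1 :> nat) && J i) ==> (s j < s i)].
Definition noninversions n (s : 'S_n) : nat :=
  \sum_(i : 'I_n) \sum_(j : 'I_n) ((i < j) && (s i < s j)).
Definition descent_enum J n := \sum_(s : 'S_n | descends J s) q ^ noninversions s.

(** The sum of [q ^ noninversions] over the permutations of [n.+1] points with
    last value [k] and with the descents required by [J] ([last_enum_perm]).
    Deleting the last point leaves a permutation of [n] points; this removes [k]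
    noninversions, and if [j] is the new last value then a descent was present
    exactly when [k <= j], because the values above [k] are lowered by one. *)
Fixpoint last_enum (J : nat -> bool) (n k : nat) : nat :=
  if n is m.+1 then q ^ k * \sum_(0 <= j < m.+1 | J m ==> (k <= j)) last_enum J m j
  else 1.

(** A permutation is determined by its last value and by the pattern of its other
    values, so a sum over permutations with a given last value is a sum over
    permutations of one point less. *)
Lemma perm_split n (k : 'I_n.+1) (P : pred 'S_n.+1) (f : 'S_n.+1 -> nat) :
  \sum_(s : 'S_n.+1 | P s && (s ord_max == k)) f s =
  \sum_(s : 'S_n | P (lift_perm ord_max k s)) f (lift_perm ord_max k s).
Proof.
rewrite (reindex (lift_perm ord_max k)) /=.
  by apply: eq_bigl => s; rewrite lift_perm_id eqxx andbT.
pose ulsf i (s : 'S_n.+1) (j : 'I_n) := odflt j (unlift (s i) (s (lift i j))).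
have ulsfK i (s : 'S_n.+1) j : lift (s i) (ulsf i s j) = s (lift i j).
  rewrite /ulsf; have := neq_lift i j.
  by rewrite -(can_eq (permK s)) => /unlift_some[] ? ? ->.
have inj_ulsf: injective (ulsf ord_max _).
  move=> s; apply: can_inj (ulsf (s ord_max) s^-1%g) _ => k'.
  by rewrite {1}/ulsf ulsfK !permK liftK.
exists (fun s => perm (inj_ulsf s)) => [s _ | s].
  by apply/permP=> k'; rewrite permE /ulsf lift_perm_lift lift_perm_id liftK.
rewrite inE => /andP[_ /eqP si0]; apply/permP=> i.
case: (unliftP ord_max i) => [k'|] ->; rewrite ?lift_perm_id //.
by rewrite lift_perm_lift -si0 permE ulsfK.
Qed.

Lemma sum_lt n k : k <= n -> \sum_(i < n) (i < k) = k.
Proof.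
elim: n k => [|n IH] k kn; first by rewrite big_ord0; lia.
rewrite big_ord_recr /=; case: ltnP => nk.
  have -> : k = n.+1 by lia.
  under eq_bigr => i _ do rewrite (ltn_trans (ltn_ord i)) //.
  by rewrite sum_nat_const card_ord muln1 addn1.
by rewrite addn0 IH.
Qed.

Lemma sum_lift n (f : 'I_n.+1 -> nat) :
  \sum_i f i = \sum_(i < n) f (lift ord_max i) + f ord_max.
Proof.
rewrite big_ord_recr /=; congr (_ + _); apply: eq_bigr => i _; congr f.
by apply: val_inj; exact: (esym (lift_max i)).
Qed.

Lemma noninversions_lift n (k : 'I_n.+1) (s : 'S_n) :
  noninversions (lift_perm ord_max k s) = noninversions s + k.
Proof.
rewrite /noninversions sum_lift [X in _ + X]big1 ?addn0 => [|j _]; last first.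
  by rewrite [_ < j]ltnNge -ltnS ltn_ord.
under eq_bigr => i _ do rewrite sum_lift !lift_perm_lift lift_perm_id.
rewrite big_split /=; congr (_ + _).
  apply: eq_bigr => i _; apply: eq_bigr => j _.
  have := ltn_ord i; have := ltn_ord j.
  rewrite ?lift_perm_lift /= /bump => jn iN; congr (nat_of_bool (_ && _)); lia.
rewrite -[RHS](@sum_lt n k); last by rewrite -ltnS.
rewrite [RHS](reindex_inj (@perm_inj _ s)) /=; apply: eq_bigr => i _.
by have := ltn_ord i; rewrite /= /bump => iN; congr nat_of_bool; lia.
Qed.

Lemma descends_lift_perm J n (k : 'I_n.+2) (s : 'S_n.+1) :
  descends J (lift_perm ord_max k s) = descends J s && (J n ==> (k <= s ord_max)).
Proof.
apply/forallP/andP => [H|[/forallP H1 H2] i].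
  split.
    apply/forallP=> i; apply/forallP=> j; apply/implyP=> ij.
    move/forallP: (H (lift ord_max i)) => /(_ (lift ord_max j)).
    rewrite !lift_perm_lift !lift_max ij /= /bump; lia.
  apply/implyP=> Jn; move/forallP: (H (lift ord_max ord_max)) => /(_ ord_max).
  rewrite lift_perm_lift lift_perm_id lift_max /= Jn eqxx /= /bump; lia.
apply/forallP => j; apply/implyP => /andP[/eqP ij Ji].
case: (unliftP ord_max i) ij Ji => [i'|] ->; last first.
  by move=> ij; have := ltn_ord j; rewrite ij ltnn.
case: (unliftP ord_max j) => [j'|] ->.
  rewrite !lift_max => ij Ji; rewrite !lift_perm_lift.
  by have /forallP/(_ j') := H1 i'; rewrite ij eqxx Ji /= /bump; lia.
rewrite !lift_max /= => -[ni] Ji; rewrite lift_perm_lift lift_perm_id /=.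
have -> : i' = ord_max by apply: val_inj.
have Jn : J n by rewrite ni.
by move: H2; rewrite Jn /= /bump; lia.
Qed.

Lemma last_enum_perm J n (k : 'I_n.+1) :
  \sum_(s : 'S_n.+1 | descends J s && (s ord_max == k)) q ^ noninversions s = last_enum J n k.
Proof.
elim: n k => [|n IH] k.
  have k0 : k = ord0 by apply: val_inj; case: k => -[].
  rewrite (perm_split k (@descends J 1)) (bigD1 1%g) /=; last first.
    apply/forallP=> i; apply/forallP=> j; apply/implyP=> /andP[/eqP ij _].
    by have := ltn_ord j; rewrite ij.
  rewrite noninversions_lift k0 addn0 /noninversions big_ord0 big1 // => s /andP[_ /eqP []].
  by apply/permP=> -[].
rewrite (perm_split k (@descends J n.+2)) [RHS]/=.
transitivity (\sum_(s : 'S_n.+1 | descends J s &&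
  (J n ==> (k <= s ord_max))) q ^ k * q ^ noninversions s).
  apply: eq_big => [s|s _]; first exact: descends_lift_perm.
  by rewrite (noninversions_lift k s) expnD mulnC.
rewrite -big_distrr /=; congr (_ * _).
rewrite big_mkord.
rewrite (partition_big (fun s : 'S_n.+1 => s ord_max) (fun j : 'I_n.+1 => J n ==> (k <= j))) /=.
  apply: eq_bigr => j Jj; rewrite -IH; apply: eq_bigl => s.
  by case: eqP => [->|_]; rewrite ?andbF // !andbT Jj andbT.
by move=> s /andP[].
Qed.

Definition total_enum J m := if m is m'.+1 then \sum_(0 <= j < m'.+1) last_enum J m' j else 1.

Lemma descent_enumE J n : descent_enum J n = total_enum J n.
Proof.
case: n => [|n] /=.
  rewrite /descent_enum (bigD1 1%g) /=; last by apply/forallP=> -[].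
  by rewrite /noninversions big_ord0 big1 // => s /andP[_ /eqP []]; apply/permP=> -[].
rewrite big_mkord /descent_enum.
rewrite (partition_big (fun s : 'S_n.+1 => s ord_max) predT) //=.
by apply: eq_bigr => j _; rewrite last_enum_perm.
Qed.

Lemma eq_last_enum J J' n k : (forall i, i < n -> J i = J' i) ->
  last_enum J n k = last_enum J' n k.
Proof.
elim: n k => //= n IH k JJ; rewrite JJ //; congr (_ * _); apply: eq_bigr => j _.
by apply: IH => i ni; apply: JJ; apply: ltnW.
Qed.

Lemma eq_total_enum J J' n : (forall i, i.+1 < n -> J i = J' i) ->
  total_enum J n = total_enum J' n.
Proof. by case: n => //= n JJ; apply: eq_bigr => j _; apply: eq_last_enum. Qed.

(** The Gaussian binomial coefficient, through the form of the Pascal rule that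
    iterates to the sum [qbin_hockey] met in [last_enum]. *)
Fixpoint qbin (n r : nat) : nat :=
  match n, r with
  | _, 0 => 1
  | 0, _.+1 => 0
  | n'.+1, r'.+1 => qbin n' r' + q ^ r'.+1 * qbin n' r'.+1
  end.

Definition qint n := \sum_(0 <= i < n) q ^ i.
Definition qfact n := \prod_(0 <= i < n) qint i.+1.

Lemma qbin0 n : qbin n 0 = 1. Proof. by case: n. Qed.

Lemma qbinS n r : qbin n.+1 r.+1 = qbin n r + q ^ r.+1 * qbin n r.+1.
Proof. by []. Qed.

Lemma qbin_hockey r N : \sum_(0 <= j < N.+1) q ^ (r.+1 * j) * qbin (N - j) r = qbin N.+1 r.+1.
Proof.
elim: N => [|N IH]; first by rewrite big_nat1 muln0 mul1n subn0 /= muln0 addn0.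
rewrite big_nat_recl // muln0 mul1n subn0 [RHS]/= -[qbin N r + _]/(qbin N.+1 r.+1) -IH.
congr (_ + _); rewrite big_distrr /=; apply: eq_bigr => j _.
by rewrite mulnS expnD subSS mulnA.
Qed.

Lemma qbin_hockey_from r N k : k <= N.+1 ->
  \sum_(0 <= j < N.+1 | k <= j) q ^ (r.+1 * j) * qbin (N - j) r =
  q ^ (r.+1 * k) * qbin (N.+1 - k) r.+1.
Proof.
move=> kN; have [->|kN'] := eqVneq k N.+1.
  rewrite subnn muln0 big_nat_cond big1 // => j /andP[/andP[_ jN] Nj]; lia.
have {kN'}kN : k <= N by lia.
rewrite subSn // -qbin_hockey big_distrr /=.
rewrite (big_cat_nat (n := k)) //=; last exact: leqW.
rewrite big_nat_cond big1 ?add0n => [|j /andP[/andP[_ jk] kj]]; last by lia.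
rewrite -{1}[k]add0n big_addn -subSn //.
rewrite big_mkcond; apply: eq_bigr => j _; rewrite leq_addl.
by rewrite mulnA -expnD -mulnDr [k + j]addnC subnDA subnAC.
Qed.

(** Inside a run of required descents, each unfolding of [last_enum] is a sum of
    the kind [qbin_hockey_from], so the whole run contributes one Gaussian
    binomial coefficient. *)
Lemma last_enum_block J m r : (forall i, i.+1 = m -> J i = false) ->
  (forall i, i.+1 < r -> J (m + i) = true) ->
  forall i k, i < r -> k <= m + i ->
  last_enum J (m + i) k = total_enum J m * (q ^ (i.+1 * k) * qbin (m + i - k) i).
Proof.
move=> Jm Jr; elim=> [|i IH] k ir kmi.
  rewrite addn0 qbin0 muln1 mul1n in kmi *.
  case: m Jm Jr kmi => [|m] Jm _ kmi /=; first by move: kmi; rewrite leqn0 => /eqP ->.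
  by rewrite Jm // mulnC /=; congr (_ * _).
rewrite addnS /= Jr //=.
have E j : 0 <= j < (m + i).+1 ->
  last_enum J (m + i) j = total_enum J m * (q ^ (i.+1 * j) * qbin (m + i - j) i).
  by move=> /andP[_ jm]; apply: IH => //; apply: ltnW.
rewrite big_nat_cond.
under eq_bigr => j /andP[jm _] do rewrite (E j jm).
rewrite -big_nat_cond -big_distrr /= qbin_hockey_from -?addnS //.
by rewrite mulnCA mulnA -!mulnA; congr (_ * _); rewrite mulnA -expnD -mulSn.
Qed.

Lemma total_enum_block J m r : (forall i, i.+1 = m -> J i = false) ->
  (forall i, i.+1 < r -> J (m + i) = true) -> 0 < r ->
  total_enum J (m + r) = total_enum J m * qbin (m + r) r.
Proof.
case: r => // r Jm Jr _; rewrite addnS -qbin_hockey [LHS]/= big_distrr /=.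
rewrite big_nat_cond [RHS]big_nat_cond; apply: eq_bigr => j /andP[/andP[_ jm] _].
by rewrite (last_enum_block Jm Jr).
Qed.

Lemma qintD a b : qint (a + b) = qint a + q ^ a * qint b.
Proof.
rewrite /qint (big_cat_nat (n := a)) ?leq_addr //=; congr (_ + _).
rewrite -[in LHS](add0n a) big_addn addnC addnK big_distrr /=.
by apply: eq_bigr => i _; rewrite addnC expnD.
Qed.

Lemma qfactS n : qfact n.+1 = qint n.+1 * qfact n.
Proof. by rewrite /qfact big_nat_recr //= mulnC. Qed.

Lemma qbin_small n r : n < r -> qbin n r = 0.
Proof.
elim: n r => [|n IH] [|r] //= nr; rewrite !IH ?muln0 //; exact: ltnW.
Qed.

Lemma qbinn n : qbin n n = 1.
Proof. by elim: n => //= n ->; rewrite qbin_small // muln0. Qed.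

Lemma qbin_fact m r : qbin (m + r) r * (qfact r * qfact m) = qfact (m + r).
Proof.
have [k] := ubnP (m + r); elim: k m r => // k IH [|m] [|r] lek.
- by rewrite qbin0 mul1n /qfact big_nil.
- by rewrite add0n qbinn mul1n {2}/qfact big_nil muln1.
- by rewrite qbin0 addn0 mul1n {1}/qfact big_nil mul1n.
rewrite addnS qbinS [in RHS]qfactS.
have -> : qint (m.+1 + r).+1 = qint r.+1 + q ^ r.+1 * qint m.+1.
  by rewrite -qintD; congr qint; lia.
rewrite mulnDl mulnDl; congr (_ + _).
  rewrite -(IH m.+1 r); last by lia.
  by rewrite [qfact r.+1]qfactS; ring.
have -> : m.+1 + r = m + r.+1 by lia.
rewrite -(IH m r.+1); last by lia.
by rewrite [qfact m.+1]qfactS; ring.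
Qed.

(** The descent pattern of a composition [al]: descents are required inside each
    part, and nothing is required between consecutive parts. *)
Fixpoint comp_desc (al : seq nat) (i : nat) : bool :=
  if al is x :: be then (if i < x then i.+1 < x else comp_desc be (i - x)) else false.

Lemma comp_desc_cat al be i :
  comp_desc (al ++ be) i = if i < sumn al then comp_desc al i else comp_desc be (i - sumn al).
Proof.
elim: al i => [|x al IH] i /=; first by rewrite subn0.
case: ltnP => ix; first by rewrite (leq_trans ix) // leq_addr.
by rewrite IH subnDA; congr (if _ then _ else _); lia.
Qed.

Lemma comp_desc_last al i : sumn al <= i.+1 -> comp_desc al i = false.
Proof.
elim: al i => //= x al IH i H; case: ltnP => ix; first by lia.
by apply: IH; lia.
Qed.

(** The enumerator is a q-multinomial coefficient: the last part contributes a
    Gaussian binomial coefficient by [total_enum_block], and the earlier parts are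
    treated by induction. *)
Lemma total_enum_composition al : all (leq 1) al ->
  total_enum (comp_desc al) (sumn al) * \prod_(x <- al) qfact x = qfact (sumn al).
Proof.
elim/last_ind: al => [|al r IH]; first by rewrite big_nil /qfact /= big_nil.
rewrite all_rcons => /andP[r0 al0]; rewrite sumn_rcons big_rcons /=.
rewrite total_enum_block //.
- rewrite -(qbin_fact (sumn al) r) -(IH al0) (eq_total_enum (J' := comp_desc al)).
    by rewrite [RHS]mulnCA [RHS]mulnC; ring.
  by move=> i ia; rewrite -cats1 comp_desc_cat (ltn_trans _ ia).
- by move=> i ia; rewrite -cats1 comp_desc_cat -ia ltnSn comp_desc_last // ia.
by move=> i ir; rewrite -cats1 comp_desc_cat ltnNge leq_addr /= addKn ir (ltn_trans _ ir).
Qed.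

Lemma descent_enum_composition al : all (leq 1) al ->
  descent_enum (comp_desc al) (sumn al) * \prod_(x <- al) qfact x = qfact (sumn al).
Proof. by move=> al0; rewrite descent_enumE total_enum_composition. Qed.

Lemma comp_desc_surj n (J : nat -> bool) : exists al,
  [/\ all (leq 1) al, sumn al = n & forall i, i.+1 < n -> comp_desc al i = J i].
Proof.
elim: n => [|n [al [al0 an aJ]]]; first by exists [::].
case: n an aJ => [|n] an aJ; first by exists [:: 1].
case Jn : (J n); last first.
  exists (rcons al 1); rewrite all_rcons al0 sumn_rcons an addn1; split=> // i.
  move=> ilt; rewrite -cats1 comp_desc_cat an; case: (ltnP i n.+1) => ilt'; last by lia.
  have [E|ne] := eqVneq i n; first by rewrite E Jn comp_desc_last // an.
  by apply: aJ; lia.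
case/lastP: al al0 an aJ => [|al r]; first by [].
rewrite all_rcons sumn_rcons => /andP[r0 al0] an aJ.
exists (rcons al r.+1); rewrite all_rcons al0 sumn_rcons addnS an; split=> // i ilt.
have [E|ne] := eqVneq i n.
  rewrite E Jn -cats1 comp_desc_cat; case: ltnP => H; first by lia.
  by rewrite /=; case: ltnP => H'; lia.
rewrite -aJ; last by lia.
rewrite -!cats1 !comp_desc_cat; case: ltnP => // H /=.
have h1 : i - sumn al < r by lia.
have h2 : i - sumn al < r.+1 by lia.
rewrite h1 h2; lia.
Qed.

End Count.

(** * Valuations of q-factorials *)

Lemma qint1 Q : qint Q 1 = 1.
Proof. by rewrite /qint big_nat1. Qed.

Lemma qint0 Q : qint Q 0 = 0.
Proof. by rewrite /qint big_nil. Qed.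

Lemma qint_recr Q m : qint Q m.+1 = qint Q m + Q ^ m.
Proof. by rewrite /qint big_nat_recr. Qed.

Lemma qint_gt0 Q m : 0 < m -> 0 < qint Q m.
Proof. by case: m => // m _; rewrite /qint big_nat_recl. Qed.

Lemma qintE q m : 1 < q -> (q ^ m - 1) %/ (q - 1) = qint q m.
Proof.
move=> q_gt1; have E : (q - 1) * qint q m = q ^ m - 1.
  elim: m => [|m IH]; first by rewrite qint0 muln0.
  rewrite qint_recr mulnDr IH expnS mulnBl mul1n.
  have : 0 < q ^ m by rewrite expn_gt0 ltnW.
  have : q ^ m <= q * q ^ m by rewrite leq_pmull // ltnW.
  lia.
by rewrite -E mulKn // subn_gt0.
Qed.

Lemma qintM Q a b : qint Q (a * b) = qint Q a * qint (Q ^ a) b.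
Proof.
elim: b => [|b IH]; first by rewrite muln0 !qint0 muln0.
rewrite mulnS addnC qintD IH qint_recr mulnDr -expnM; congr (_ + _).
by rewrite mulnC.
Qed.

(** The parts that remain after all splittings without carry are [1], [e], [e * l]
    and [e * l ^ 2]; the q-factorials of the last three have valuations [d],
    [d * l + 1] and [d * l ^ 2 + l + 1].  The bounds on [N = n %/ e] are what makes
    the multiplicities [a], [b], [c] of these parts recoverable from the total
    valuation ([weights_inj]). *)
Section Weights.
Variables d l N : nat.
Hypothesis l1 : 1 < l.
Hypothesis d0 : 0 < d.
Hypothesis hN : (d <= l /\ N <= d * l) \/ (d = l.+1 /\ N <= l ^ 2) \/
  (l.+1 < d /\ N < l ^ 2 + l).

Lemma quotient_bound : N < l ^ 2 + l.
Proof.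
have : 0 < l by exact: ltnW.
case: hN => [[dl Nd] | [[_ Nl]|[_ //]]] l0; last by lia.
have : d * l <= l ^ 2 by rewrite -mulnn leq_mul2r dl orbT.
lia.
Qed.

(** A part [e * l ^ 2] on one side only: since [b <= l], equal valuations force
    [S < T] and [d <= l.+1], hence [l ^ 2 < N], against the bound valid for such
    [d]. *)
Lemma no_collision_mixed S T b : S <= N -> T <= N -> l ^ 2 <= S -> b <= l ->
   d * S + l.+1 = d * T + b -> False.
Proof.
move=> SN TN lS bl E.
have ST : S < T.
  rewrite ltnNge; apply/negP => TS.
  have H : d * T <= d * S by rewrite leq_mul2l TS orbT.
  lia.
have [N1 N2] : l ^ 2 < N /\ d <= l.+1.
  split; first by lia.
  have : d * S.+1 <= d * T by rewrite leq_mul2l ST orbT.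
  rewrite mulnS; lia.
case: hN => [[dl Nd] | [[_ Nl]|[dl _]]]; [|lia|lia].
have : d * l <= l ^ 2 by rewrite -mulnn leq_mul2r dl orbT.
lia.
Qed.

(** If [c < b] then equal valuations force [S < T] and [d <= b <= l], so only the
    first bound is possible, and it fails because [d * l <= l * b <= S < N]. *)
Lemma collision_le S T b c : S <= N -> T <= N -> l * b <= S -> l * c <= T ->
   b <= l -> c <= l -> d * S + b = d * T + c -> b <= c.
Proof.
move=> SN TN bS cT bl cl E; rewrite leqNgt; apply/negP=> cb.
have ST : S < T.
  rewrite ltnNge; apply/negP => TS.
  have H : d * T <= d * S by rewrite leq_mul2l TS orbT.
  lia.
have : d * S.+1 <= d * T by rewrite leq_mul2l ST orbT.
rewrite mulnS => H.
have db : d <= b by lia.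
case: hN => [[dl Nd] | [[dl _]|[dl _]]]; [|lia|lia].
have : l * d <= l * b by rewrite leq_mul2l db orbT.
rewrite mulnC; lia.
Qed.

(** Writing [S] for [a + l * b + l ^ 2 * c], the valuation is
    [d * S + b + (l + 1) * c], and [S <= N < l ^ 2 + l] bounds [b] by [l] and [c]
    by [1]. *)
Lemma weights_inj a b c a' b' c' :
  a + l * b + l ^ 2 * c <= N -> a' + l * b' + l ^ 2 * c' <= N ->
  d * a + (d * l + 1) * b + (d * l ^ 2 + l.+1) * c =
  d * a' + (d * l + 1) * b' + (d * l ^ 2 + l.+1) * c' ->
  [/\ a = a', b = b' & c = c'].
Proof.
have rw x y z : d * x + (d * l + 1) * y + (d * l ^ 2 + l.+1) * z =
  d * (x + l * y + l ^ 2 * z) + y + l.+1 * z by ring.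
have NB := quotient_bound.
have l0 : 0 < l by exact: ltnW.
have small x y z : x + l * y + l ^ 2 * z <= N -> [/\ y <= l, z <= 1 & z = 1 -> y = 0].
  move=> H; have ll : l <= l ^ 2 by rewrite -mulnn leq_pmulr.
  split.
  - rewrite leqNgt; apply/negP => ly; have : l * l.+1 <= l * y by rewrite leq_mul2l ly orbT.
    rewrite mulnS mulnn; lia.
  - rewrite leqNgt; apply/negP => zy;
    have : l ^ 2 * 2 <= l ^ 2 * z by rewrite leq_mul2l zy orbT.
    lia.
  move=> z1; case: y H => // y H; move: H; rewrite z1 muln1 mulnS; lia.
rewrite !rw => S1 S2 V.
have [bl c1 cb] := small _ _ _ S1; have [bl' c1' cb'] := small _ _ _ S2.
have cc : c = c'.
  case: c c1 cb S1 V => [|[|//]] _ cb S1 V; case: c' c1' cb' S2 V => [|[|//]] _ cb' S2 V //.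
    have lS : l ^ 2 <= a' + l * b' + l ^ 2 * 1 by rewrite muln1 leq_addl.
    case: (no_collision_mixed S2 S1 lS bl).
    by move: V; rewrite (cb' erefl) !muln0 !muln1 !addn0.
  have lS : l ^ 2 <= a + l * b + l ^ 2 * 1 by rewrite muln1 leq_addl.
  case: (no_collision_mixed S1 S2 lS bl').
  by move: V; rewrite (cb erefl) !muln0 !muln1 !addn0.
rewrite -cc in S2 V cb' *; have {}V :
  d * (a + l * b + l ^ 2 * c) + b = d * (a' + l * b' + l ^ 2 * c) + b'.
  by apply/eqP; rewrite -(eqn_add2r (l.+1 * c)) V.
have bb : b = b'.
  apply/eqP; rewrite eqn_leq; apply/andP; split.
    by apply: (collision_le S1 S2 _ _ bl bl' V); rewrite addnAC leq_addl.
  by apply: (collision_le S2 S1 _ _ bl' bl (esym V)); rewrite addnAC leq_addl.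
split=> //; move: V; rewrite bb => /eqP; rewrite eqn_add2r eqn_pmul2l // => /eqP; lia.
Qed.
End Weights.

Section Valuation.
Variables (q l : nat).
Hypotheses (l_prime : prime l) (lq : ~~ (l %| q)) (q_gt1 : 1 < q).

Lemma qint_mod1 Q m : Q = 1 %[mod l] -> qint Q m = m %[mod l].
Proof.
move=> Q1; elim: m => [|m IH]; first by rewrite qint0.
by rewrite qint_recr -addn1 -modnDm IH -modnXm Q1 modnXm exp1n modnDm.
Qed.

Lemma pow_expand s m : exists c, (1 + l * s) ^ m = 1 + m * l * s + l ^ 2 * c.
Proof.
elim: m => [|m [c IH]]; first by exists 0; rewrite muln0.
exists (m * s ^ 2 + c + l * s * c); rewrite expnS IH; ring.
Qed.

Lemma qint_expand s m : exists c, qint (1 + l * s) m = m + l * s * 'C(m, 2) + l ^ 2 * c.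
Proof.
elim: m => [|m [c IH]]; first by exists 0; rewrite qint0 bin0n !muln0.
have [c' E] := pow_expand s m; exists (c + c'); rewrite qint_recr IH E binS bin1; ring.
Qed.

(** The base of the lifting-the-exponent lemma.  For [l = 2] the congruence modulo
    [4] excludes such cases as [Q = 3], where [qint Q 2 = 4] but [logn 2 2 = 1]. *)
Definition lifting_base Q := (Q = 1 %[mod l]) /\ (l = 2 -> Q = 1 %[mod 4]).

Lemma logn_qint_prime Q : lifting_base Q -> logn l (qint Q l) = 1.
Proof.
have l1 := prime_gt1 l_prime.
case=> Q1 Q4; suff [c ->] : exists c, qint Q l = l * (1 + l * c).
  rewrite lognM ?(prime_gt0 l_prime) ?addn_gt0 // logn_prime // eqxx lognE l_prime /=.
  by rewrite dvdn_addl ?dvdn_mulr // dvdn1 (gtn_eqF l1).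
have Q0 : 0 < Q.
  by case: Q Q1 {Q4} => // /esym; rewrite mod0n modn_small.
have [s Qs] : exists s, Q = 1 + l * s.
  exists (Q %/ l); rewrite {1}(divn_eq Q l) Q1 modn_small // addnC mulnC //.
have [c E] := qint_expand s l; rewrite -Qs in E.
have [l2|l2] := eqVneq l 2.
  have [t st] : exists t, s = 2 * t.
    have := Q4 l2; rewrite Qs l2 => /eqP; rewrite -[in X in _ == X](addn0 1) eqn_modDl mod0n.
    by rewrite -/(dvdn _ _) -[4]/(2 * 2) dvdn_pmul2l // => /dvdnP[t ->]; exists t;
      rewrite mulnC.
  exists (t + c); rewrite E st l2 binn; ring.
have /dvdnP[b bE] : l %| 'C(l, 2) by apply: prime_dvd_bin => //=; lia.
exists (s * b + c); rewrite E bE; ring.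
Qed.

Lemma lifting_baseX Q m : lifting_base Q -> lifting_base (Q ^ m).
Proof.
case=> Q1 Q4; split=> [|l2]; first by rewrite -modnXm Q1 modnXm exp1n.
by rewrite -modnXm Q4 // modnXm exp1n.
Qed.

(** Lifting the exponent: [qint Q (l * j) = qint Q l * qint (Q ^ l) j], where the
    first factor has valuation [1] and [Q ^ l] is again a base, so induction
    applies. *)
Lemma logn_qint_base Q k : lifting_base Q -> 0 < k -> logn l (qint Q k) = logn l k.
Proof.
have l1 := prime_gt1 l_prime.
have [m] := ubnP k; elim: m k Q => // m IH k Q km Qok k0.
have [/dvdnP[j kj]|lk] := boolP (l %| k); last first.
  have lk' : ~~ (l %| qint Q k) by rewrite /dvdn qint_mod1 //; case: Qok.
  by rewrite [LHS]lognE [RHS]lognE (negPf lk) (negPf lk') !andbF.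
have j0 : 0 < j by move: k0; rewrite kj muln_gt0 => /andP[].
rewrite kj mulnC qintM !lognM ?qint_gt0 ?(prime_gt0 l_prime) // logn_qint_prime // [logn l l]logn_prime // eqxx.
rewrite IH //; last exact: lifting_baseX.
by rewrite -ltnS; apply: leq_trans km; rewrite ltnS kj ltn_Pmulr.
Qed.

Variable e : nat.
Hypotheses (e2 : 1 < e) (le : l %| qint q e).
Hypothesis emin : forall i, 1 < i -> l %| qint q i -> e <= i.
Let d := logn l (qint q e).

Lemma coprime_pow m : coprime l (q ^ m).
Proof. by rewrite coprimeXr // prime_coprime. Qed.

(** [qint q (a + r) = qint q a + q ^ a * qint q r], and [l] is prime to [q], so
    the remainder modulo [e] decides; the minimality of [e] excludes remainders
    above [1], and [qint q 1 = 1]. *)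
Lemma qint_dvdE i : (l %| qint q i) = (e %| i).
Proof.
have lk k : l %| qint q (e * k) by rewrite qintM dvdn_mulr.
apply/idP/dvdnP => [|[k ->]]; last by rewrite mulnC.
rewrite {1}(divn_eq i e) qintD mulnC dvdn_addr // Gauss_dvdr ?coprime_pow //.
have := ltn_pmod i (ltnW e2); case: (i %% e) (divn_eq i e) => [|[|r]] E re lr.
- by exists (i %/ e); rewrite {1}E addn0.
- by move: lr; rewrite qint1 dvdn1 (gtn_eqF (prime_gt1 l_prime)).
by have := emin (isT : 1 < r.+2) lr; rewrite leqNgt re.
Qed.

(** For [l = 2], [q] is odd, so [2] divides [1 + q] and [e = 2]; the square of an
    odd number is [1] modulo [4]. *)
Lemma lifting_base_expe : lifting_base (q ^ e).
Proof.
have E m : q ^ m = 1 + (q - 1) * qint q m.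
  elim: m => [|m IH]; first by rewrite qint0 muln0.
  rewrite expnS qint_recr mulnDr addnA -IH; have := ltnW q_gt1; case: (q) => // q' _.
  rewrite subSS subn0; ring.
split=> [|l2].
  by rewrite E -modnDmr; have /eqP -> : l %| (q - 1) * qint q e by rewrite dvdn_mull.
have qodd : q %% 2 = 1 by move: lq; rewrite l2 dvdn2 modn2; case: (odd q).
have e_2 : e = 2.
  have : e <= 2 by apply: emin => //; rewrite l2 qint_recr qint1 expn1 dvdn2 /=; lia.
  lia.
rewrite e_2; have [j ->] : exists j, q = 1 + 2 * j.
  by exists (q %/ 2); rewrite {1}(divn_eq q 2) qodd addnC mulnC.
by rewrite (_ : (1 + 2 * j) ^ 2 = (j + j ^ 2) * 4 + 1) ?modnMDl //; ring.
Qed.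

Lemma logn_qint i : 0 < i ->
  logn l (qint q i) = if e %| i then d + logn l (i %/ e) else 0.
Proof.
move=> i0; case: ifP => [/dvdnP[k ik]|ei]; last first.
  by rewrite lognE l_prime qint_gt0 //= qint_dvdE ei.
have k0 : 0 < k by move: i0; rewrite ik muln_gt0 => /andP[].
rewrite ik mulnK; last exact: ltnW.
by rewrite mulnC qintM lognM ?qint_gt0 ?(ltnW e2) // (logn_qint_base lifting_base_expe k0).
Qed.

(** The common shape of the Legendre formula for [m`!] (with [b = l] and [D = 1])
    and of its analogue for q-factorials (with [b = e] and [D = d]). *)
Lemma logn_prod (g : nat -> nat) b D m : 1 < b -> (forall i, 0 < g i.+1) ->
  (forall i, 0 < i -> logn l (g i) = if b %| i then D + logn l (i %/ b) else 0) ->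
  logn l (\prod_(0 <= i < m) g i.+1) = D * (m %/ b) + logn l (m %/ b)`!.
Proof.
move=> b1 g0 gE; elim: m => [|m IH].
  by rewrite big_nil div0n muln0 !logn1.
rewrite big_nat_recr //= lognM //; last first.
  by rewrite prodn_gt0.
rewrite IH gE //.
have [bm|bm] := boolP (b %| m.+1).
  have -> : m %/ b = (m.+1 %/ b).-1.
    case/dvdnP: bm => -[//|k] mk; rewrite mk mulnK; last exact: ltnW.
    have -> : m = k * b + b.-1 by rewrite mulSn in mk; lia.
    by rewrite divnMDl ?(ltnW b1) // divn_small ?addn0 // prednK // ltnW.
  have : 0 < m.+1 %/ b by rewrite divn_gt0 ?(ltnW b1) // dvdn_leq.
  case: (m.+1 %/ b) => // k _; rewrite factS lognM ?fact_gt0 //= mulnS; lia.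
have -> : m.+1 %/ b = m %/ b; last by rewrite addn0.
rewrite divnS ?(ltnW b1) //; by rewrite (negPf bm).
Qed.

Definition qfact_val m := logn l (qfact q m).

Lemma qfact_valE m : qfact_val m = d * (m %/ e) + logn l (m %/ e)`!.
Proof.
rewrite /qfact_val /qfact; apply: logn_prod => //; first by move=> i; exact: qint_gt0.
exact: logn_qint.
Qed.

Lemma logn_fact_l m : logn l m`! = m %/ l + logn l (m %/ l)`!.
Proof.
have l1 := prime_gt1 l_prime.
rewrite -{1}[m %/ l]mul1n; have ->
  : m`! = \prod_(0 <= i < m) i.+1 by rewrite fact_prod big_add1.
apply: (@logn_prod id) => // i i0.
case: ifP => [/dvdnP[k ik]|li]; last by rewrite lognE l_prime i0 li.
have k0 : 0 < k by move: i0; rewrite ik muln_gt0 => /andP[].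
by rewrite ik mulnK ?(prime_gt0 l_prime) // lognM ?(prime_gt0 l_prime) // [logn l l]logn_prime // eqxx addnC.
Qed.

Lemma logn_fact_lj j : j < l -> logn l (l * j)`! = j.
Proof.
move=> jl; rewrite logn_fact_l mulKn ?prime_gt0 // logn_fact_l divn_small //.
by rewrite logn1 !addn0.
Qed.

Lemma qfact_val_mul k : qfact_val (e * k) = d * k + logn l k`!.
Proof. by rewrite qfact_valE mulKn // ltnW. Qed.

Lemma qfact_val1 : qfact_val 1 = 0.
Proof. by rewrite qfact_valE divn_small // muln0 logn1. Qed.

Definition normal_part x := x \in [:: 1; e; e * l; e * l ^ 2].

(** Valuations add up when no carry occurs: [1] can be taken off a number that [e]
    does not divide, [e] off [e * k] when [l] does not divide [k], and [e * l] off
    [e * l * j] when [1 < j < l]. *)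
Lemma part_split x : 0 < x -> x %/ e < l ^ 2 + l -> ~~ normal_part x ->
  exists y z, [/\ 0 < y, 0 < z, x = y + z & qfact_val x = qfact_val y + qfact_val z].
Proof.
have l1 := prime_gt1 l_prime.
move=> x0 xl nx; have [/dvdnP[k xk]|ex] := boolP (e %| x); last first.
  have x1 : x != 1 by apply: contraNneq nx => ->.
  exists x.-1, 1; split; [by lia|by []|by lia|].
  rewrite qfact_val1 addn0 !qfact_valE; have -> // : x %/ e = x.-1 %/ e.
  case: x x0 ex {xl nx x1} => // x _ ex; by rewrite divnS ?(ltnW e2) // (negPf ex).
have ke : x %/ e = k by rewrite xk mulnK // ltnW.
rewrite ke in xl.
have k1 : k != 1 by apply: contraNneq nx => k1; rewrite xk k1 mul1n /normal_part !inE eqxx orbT.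
have k0 : 0 < k by move: x0; rewrite xk muln_gt0 => /andP[].
have [/dvdnP[j kj]|lk] := boolP (l %| k).
  have j0 : 0 < j by move: k0; rewrite kj muln_gt0 => /andP[].
  have jl : j <= l by nia.
  have jl' : j != l.
    by apply: contraNneq nx => jl';
      rewrite xk kj jl' /normal_part !inE -mulnn [_ * e]mulnC eqxx !orbT.
  have j1 : j != 1.
    by apply: contraNneq nx => j1; rewrite xk kj j1 mul1n [_ * e]mulnC /normal_part !inE eqxx !orbT.
  have jlt : j < l by lia.
  exists (e * l), (e * (l * j.-1)); split; [by nia|by nia|by nia|].
  rewrite xk kj [_ * e]mulnC [j * l]mulnC !qfact_val_mul logn_fact_lj // logn_fact_lj;
    last by lia.
  have ll : logn l l`! = 1 by have := logn_fact_lj l1; rewrite muln1.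
  by rewrite ll; nia.
exists e, (e * k.-1); split; [by lia|by nia|by nia|].
rewrite xk [k * e]mulnC -{2}[e]muln1 !qfact_val_mul logn1.
case: k k0 lk {xk ke xl k1} => // k _ lk.
have lk0 : logn l k.+1 = 0 by rewrite lognE (negPf lk) !andbF.
by rewrite factS lognM ?fact_gt0 // lk0 /= muln1 addn0 add0n mulnS addnA.
Qed.

(** * Rearranging compositions *)

Section Lists.

(** [link] stands for mutual generation of the eigenvectors attached to two
    compositions; only the moves listed as hypotheses are used. *)
Variable link : seq nat -> seq nat -> Prop.
Hypotheses (link_refl : forall s, link s s) (link_sym : forall s t, link s t -> link t s).
Hypothesis link_trans : forall s t u, link s t -> link t u -> link s u.
Hypothesis link_swap : forall pre x y post, 0 < x -> 0 < y ->
  link (pre ++ x :: y :: post) (pre ++ y :: x :: post).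
Hypothesis link_split : forall pre x y post, 0 < x -> 0 < y ->
  qfact_val (x + y) = qfact_val x + qfact_val y ->
  link (pre ++ (x + y) :: post) (pre ++ y :: x :: post).

Lemma link_past pre x s post : 0 < x -> all (leq 1) s ->
  link (pre ++ x :: s ++ post) (pre ++ s ++ x :: post).
Proof.
move=> x0; elim: s pre => [|y s IH] pre /=; first by move=> _; exact: link_refl.
move=> /andP[y0 s0]; apply: (link_trans (link_swap _ _ x0 y0)).
by have := IH (rcons pre y) s0; rewrite !cat_rcons.
Qed.

Lemma link_cat s t post : all (leq 1) s -> all (leq 1) t ->
  link (s ++ t ++ post) (t ++ s ++ post).
Proof.
elim: s t post => [|x s IH] t post /=; first by move=> _ _; exact: link_refl.
move=> /andP[x0 s0] t0; apply: (@link_trans _ (x :: t ++ s ++ post)).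
  have -> : x :: s ++ t ++ post = [::] ++ x :: s ++ (t ++ post) by [].
  apply: (link_trans (link_past _ _ x0 s0)) => /=.
  have -> : s ++ x :: t ++ post = s ++ (x :: t) ++ post by [].
  by apply: (link_trans (IH (x :: t) post s0 _)) => /=; rewrite ?x0 //.
by have := @link_past [::] x t (s ++ post) x0 t0.
Qed.

Lemma link_perm s t : all (leq 1) s -> perm_eq s t -> link s t.
Proof.
move=> s0 st.
pose P t := all (leq 1) t -> link s t.
suff : P t by apply; rewrite -(perm_all _ st).
apply: (catCA_perm_ind _ st); last by move=> _; exact: link_refl.
move=> a b c H; rewrite /P !all_cat => /and3P[b0 a0 c0].
apply: link_trans (link_cat c a0 b0); apply: H.
by rewrite !all_cat a0 b0 c0.
Qed.

Lemma link_part x pre post : 0 < x -> x %/ e < l ^ 2 + l -> exists be,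
  [/\ all normal_part be, sumn be = x,
    \sum_(y <- be) qfact_val y = qfact_val x & link (pre ++ x :: post) (pre ++ be ++ post)].
Proof.
have [m] := ubnP x; elim: m x pre post => // m IH x pre post /ltnSE xm x0 xl.
have [nx|nx] := boolP (normal_part x).
  exists [:: x]; rewrite /= nx big_seq1 addn0; split=> //; exact: link_refl.
have [y [z [y0 z0 xyz vxyz]]] := part_split x0 xl nx.
have zx : z < x by rewrite xyz -{1}[z]add0n ltn_add2r.
have yx : y < x by rewrite xyz -{1}[y]addn0 ltn_add2l.
have small t : t < x -> t %/ e < l ^ 2 + l.
  by move=> tx; apply: leq_ltn_trans xl; apply: leq_div2r; apply: ltnW.
have [bz [bz1 bz2 bz3 bz4]] := IH z pre (y :: post) (leq_trans zx xm) z0 (small z zx).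
have [by' [by1 by2 by3 by4]] := IH y (pre ++ bz) post (leq_trans yx xm) y0 (small y yx).
exists (bz ++ by'); rewrite all_cat bz1 by1 sumn_cat bz2 by2 big_cat /= bz3 by3.
rewrite vxyz ![_ + y]addnC xyz [qfact_val z + _]addnC; split=> //.
apply: (link_trans (link_split _ _ y0 z0 _)); first by rewrite -xyz.
by apply: (link_trans bz4); rewrite catA; move: by4; rewrite -!catA.
Qed.

Lemma link_normal al pre : all (leq 1) al -> sumn al %/ e < l ^ 2 + l -> exists be,
  [/\ all normal_part be, sumn be = sumn al,
    \sum_(y <- be) qfact_val y = \sum_(y <- al) qfact_val y &
      link (pre ++ al) (pre ++ be)].
Proof.
elim: al pre => [|x al IH] pre /=.
  by exists [::]; split=> //; exact: link_refl.
move=> /andP[x0 al0] lt.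
have l1 : x %/ e <= (x + sumn al) %/ e by apply: leq_div2r; apply: leq_addr.
have l2 : sumn al %/ e <= (x + sumn al) %/ e by apply: leq_div2r; apply: leq_addl.
have [bx [b1 b2 b3 b4]] := @link_part x pre al x0 (leq_ltn_trans l1 lt).
have [ba [a1 a2 a3 a4]] := IH (pre ++ bx) al0 (leq_ltn_trans l2 lt).
exists (bx ++ ba); rewrite all_cat b1 a1 sumn_cat b2 a2 big_cat big_cons /= b3 a3; split=> //.
by apply: (link_trans b4); move: a4; rewrite -!catA.
Qed.

Lemma normal_sum (f : nat -> nat) be : all normal_part be ->
  \sum_(y <- be) f y = count_mem 1 be * f 1 + count_mem e be * f e +
    count_mem (e * l) be * f (e * l) + count_mem (e * l ^ 2) be * f (e * l ^ 2).
Proof.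
have l1 := prime_gt1 l_prime.
have n1 : (e == 1) = false by lia.
have n2 : (e * l == 1) = false by nia.
have n3 : (e * l ^ 2 == 1) = false by nia.
have n4 : (e * l == e) = false by nia.
have n5 : (e * l ^ 2 == e) = false by nia.
have n6 : (e * l ^ 2 == e * l) = false by nia.
elim: be => [|x be IH] /=; first by rewrite big_nil.
move=> /andP[nx nb]; rewrite big_cons IH //.
have flip a b : (a == b :> nat) = false -> (b == a) = false by rewrite eq_sym.
have nE := (n1, n2, n3, n4, n5, n6, flip _ _ n1, flip _ _ n2, flip _ _ n3,
  flip _ _ n4, flip _ _ n5, flip _ _ n6, eqxx).
by move: nx; rewrite /normal_part !inE => /or4P[] /eqP ->; rewrite !nE /= ; ring.
Qed.

Lemma normal_perm s t : all normal_part s -> all normal_part t ->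
  (forall x, normal_part x -> count_mem x s = count_mem x t) -> perm_eq s t.
Proof.
move=> sn tn H; apply/allP => x; rewrite mem_cat /= => /orP[xs|xt].
  by rewrite H ?eqxx // (allP sn).
by rewrite H ?eqxx // (allP tn).
Qed.

Lemma normal_part_pos s : all normal_part s -> all (leq 1) s.
Proof.
apply: sub_all => x; rewrite /normal_part !inE => /or4P[] /eqP -> //; first exact: ltnW.
  by rewrite muln_gt0 (ltnW e2) (prime_gt0 l_prime).
by rewrite muln_gt0 (ltnW e2) expn_gt0 (prime_gt0 l_prime).
Qed.

Lemma d_gt0 : 0 < d.
Proof. by rewrite /d logn_gt0 mem_primes l_prime le qint_gt0 // ltnW. Qed.

(** Both lists split into normal parts without changing the total valuation, and
    there [weights_inj] recovers the multiplicities of the parts from the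
    valuation; two lists with equal multiplicities differ by exchanges of
    neighbours. *)
Lemma link_of_val n s t :
  (d <= l /\ n %/ e <= d * l) \/ (d = l.+1 /\ n %/ e <= l ^ 2) \/
     (l.+1 < d /\ n %/ e < l ^ 2 + l) ->
  all (leq 1) s -> all (leq 1) t -> sumn s = n -> sumn t = n ->
  \sum_(y <- s) qfact_val y = \sum_(y <- t) qfact_val y -> link s t.
Proof.
move=> hN s0 t0 sn tn vst.
have l1 := prime_gt1 l_prime.
have Nb := quotient_bound l1 d_gt0 hN.
have [|bs [bs1 bs2 bs3 bs4]] := @link_normal s [::] s0; first by rewrite sn.
have [|bt [bt1 bt2 bt3 bt4]] := @link_normal t [::] t0; first by rewrite tn.
apply: (link_trans bs4); apply: link_trans (link_sym bt4); rewrite !cat0s.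
apply: link_perm; first exact: normal_part_pos.
have v_e : qfact_val e = d by rewrite -{1}[e]muln1 qfact_val_mul logn1 muln1 addn0.
have ll : logn l l`! = 1 by have := logn_fact_lj l1; rewrite muln1.
have v_el : qfact_val (e * l) = d * l + 1.
  by rewrite qfact_val_mul ll.
have v_el2 : qfact_val (e * l ^ 2) = d * l ^ 2 + l.+1.
  by rewrite qfact_val_mul logn_fact_l -mulnn mulKn ?prime_gt0 // ll addn1.
have ids u : all normal_part u -> sumn u = count_mem 1 u + e * (count_mem e u +
    l * count_mem (e * l) u + l ^ 2 * count_mem (e * l ^ 2) u).
  by move=> /(normal_sum id); rewrite sumnE => ->; ring.
have vals u : all normal_part u -> \sum_(y <- u) qfact_val y = d * count_mem e u +
    (d * l + 1) * count_mem (e * l) u + (d * l ^ 2 + l.+1) * count_mem (e * l ^ 2) u.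
  by move=> /(normal_sum qfact_val) ->; rewrite qfact_val1 v_e v_el v_el2; ring.
have bound u : all normal_part u -> sumn u = n ->
    count_mem e u + l * count_mem (e * l) u + l ^ 2 * count_mem (e * l ^ 2) u <= n %/ e.
  by move=> /ids uE un; rewrite leq_divRL ?(ltnW e2) // mulnC -un uE leq_addl.
have sN := bound _ bs1 (etrans bs2 sn); have tN := bound _ bt1 (etrans bt2 tn).
have [ce cl cl2] := weights_inj l1 d_gt0 hN sN tN
   (etrans (esym (vals _ bs1)) (etrans (etrans (etrans bs3 vst) (esym bt3)) (vals _ bt1))).
apply: (normal_perm bs1 bt1) => x; rewrite /normal_part !inE => /or4P[] /eqP -> //.
have := etrans (etrans (esym (ids _ bs1)) (etrans (etrans bs2 sn) (esym (etrans bt2 tn)))) (ids _ bt1).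
by rewrite ce cl cl2 => /addIn.
Qed.

End Lists.

End Valuation.

Local Open Scope ring_scope.

(** * The group algebra and its form *)

Section GroupAlgebraTheory.
Variables (R : comPzRingType) (gT : finGroupType).
Implicit Types (x y : galg R gT) (g h : gT) (c : R).
Local Notation gb := (@gbasis R gT).

Lemma gbasisM g h : gb g * gb h = gb (g * h)%g.
Proof.
apply/ffunP => k; rewrite !ffunE (bigD1 g) //= !ffunE eqxx mul1r.
rewrite big1 ?addr0 => [|i /negPf ig]; last by rewrite ffunE ig mul0r.
by congr (_%:R); congr (nat_of_bool _); apply/eqP/eqP=> [<-|->]; rewrite ?mulKVg ?mulKg.
Qed.

Lemma gbasis1 : gb 1%g = 1. Proof. by []. Qed.

Lemma gbasis_mulE g x h : (gb g * x) h = x (g^-1 * h)%g.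
Proof.
rewrite [LHS]ffunE (bigD1 g) //= ffunE eqxx mul1r big1 ?addr0 // => i /negPf ig.
by rewrite ffunE ig mul0r.
Qed.

(** The central embedding of the coefficients, through which they act on left
    ideals of the group algebra. *)
Definition galg_scalar c : galg R gT := [ffun h => c * (h == 1%g)%:R].
Local Notation sc := galg_scalar.

Lemma galg_scalarE c x g : (sc c * x) g = c * x g.
Proof.
rewrite [LHS]ffunE (bigD1 1%g) //= ffunE eqxx mulr1 invg1 mul1g big1 ?addr0 // => i /negPf ig.
by rewrite ffunE ig mulr0 mul0r.
Qed.

Lemma galg_scalar_comm c x : x * sc c = sc c * x.
Proof.
apply/ffunP=> g; rewrite galg_scalarE [LHS]ffunE (bigD1 g) //= ffunE mulVg eqxx mulr1 mulrC.
by rewrite big1 ?addr0 // => i /negPf ig; rewrite ffunE -eq_mulVg1 ig !mulr0.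
Qed.

Lemma galg_scalarM c d : sc (c * d) = sc c * sc d.
Proof. by apply/ffunP=> g; rewrite galg_scalarE !ffunE mulrA. Qed.

Lemma galg_scalarD c d : sc (c + d) = sc c + sc d.
Proof. by apply/ffunP=> g; rewrite !ffunE mulrDl. Qed.

Lemma galg_scalarN c : sc (- c) = - sc c.
Proof. by apply/ffunP=> g; rewrite !ffunE mulNr. Qed.

Lemma galg_scalar1 : sc 1 = 1.
Proof. by apply/ffunP=> g; rewrite !ffunE mul1r. Qed.

Lemma galg_scalarB c d : sc (c - d) = sc c - sc d.
Proof. by rewrite galg_scalarD galg_scalarN. Qed.

HB.instance Definition _ := GRing.isZmodMorphism.Build R (galg R gT) sc galg_scalarB.
HB.instance Definition _ := GRing.isMonoidMorphism.Build R (galg R gT) sc (galg_scalar1,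
  galg_scalarM).

Lemma galg_sum (a : galg R gT) : a = \sum_g sc (a g) * gb g.
Proof.
apply/ffunP=> h; rewrite sum_ffunE (bigD1 h) //= galg_scalarE ffunE eqxx mulr1.
rewrite big1 ?addr0 // => g /negPf gh.
by rewrite galg_scalarE ffunE eq_sym gh mulr0.
Qed.

Lemma gform_scalarl c x y : gform (sc c * x) y = c * gform x y.
Proof. by rewrite /gform mulr_sumr; apply: eq_bigr => g _; rewrite galg_scalarE mulrA. Qed.

Lemma gformC x y : gform x y = gform y x.
Proof. by apply: eq_bigr => g _; rewrite mulrC. Qed.

Lemma gform_scalarr c x y : gform x (sc c * y) = c * gform x y.
Proof. by rewrite gformC gform_scalarl gformC. Qed.

Lemma gform_gbasis g x y : gform (gb g * x) y = gform x (gb g^-1 * y).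
Proof.
rewrite /gform (reindex_inj (mulgI g)) /=; apply: eq_bigr => h _.
by rewrite !gbasis_mulE invgK mulKg.
Qed.

Lemma gformDl x x' y : gform (x + x') y = gform x y + gform x' y.
Proof. by rewrite /gform -big_split; apply: eq_bigr => g _; rewrite ffunE mulrDl. Qed.

Lemma gform0l y : gform (0 : galg R gT) y = 0.
Proof. by rewrite /gform big1 // => g _; rewrite ffunE mul0r. Qed.

Lemma gform_suml I (r : seq I) (P : pred I) (F : I -> galg R gT) y :
  gform (\sum_(i <- r | P i) F i) y = \sum_(i <- r | P i) gform (F i) y.
Proof.
by apply: (big_morph (fun x => gform x y)) => [a b|]; rewrite ?gformDl ?gform0l.
Qed.

Lemma gform_sumr I (r : seq I) (P : pred I) (F : I -> galg R gT) y :
  gform y (\sum_(i <- r | P i) F i) = \sum_(i <- r | P i) gform y (F i).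
Proof. by rewrite gformC gform_suml; apply: eq_bigr => i _; rewrite gformC. Qed.

End GroupAlgebraTheory.

(** * Changing one vector of a frame *)

Section Ccol.
Variables (F : fieldType) (n : nat).
Implicit Types (M : 'M[F]_n) (x y : 'cV[F]_n) (i j k : 'I_n).

(** The columns of [M] being seen as a frame, [M *m Ccol i x] is the frame whose
    [i]-th vector is replaced by the combination [M *m x] of the frame
    ([mul_Ccol]). *)
Definition Ccol i x : 'M[F]_n := \matrix_(r, c) (if c == i then x r 0 else (r == c)%:R).

Lemma mul_Ccol M i x :
  M *m Ccol i x = \matrix_(r, c) (if c == i then (M *m x) r 0 else M r c).
Proof.
apply/matrixP=> r c; rewrite !mxE; case: eqP => [->|/eqP ci].
  by apply: eq_bigr => k _; rewrite mxE eqxx.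
rewrite (bigD1 c) //= mxE (negPf ci) eqxx mulr1 big1 ?addr0 // => k /negPf kc.
by rewrite mxE (negPf ci) kc mulr0.
Qed.

Lemma det_Ccol i x : \det (Ccol i x) = x i 0.
Proof.
rewrite (expand_det_row _ i) (bigD1 i) //= big1 ?addr0 => [|j /negPf ji]; last first.
  by rewrite mxE ji eq_sym ji mul0r.
rewrite mxE eqxx /cofactor exprD -expr2 sqrr_sign mul1r.
have -> : row' i (col' i (Ccol i x)) = 1%:M.
  by apply/matrixP=> r c; rewrite !mxE eq_sym (negPf (neq_lift i c)) (inj_eq lift_inj).
by rewrite det1 mulr1.
Qed.

Lemma unit_Ccol i x : (Ccol i x \in unitmx) = (x i 0 != 0).
Proof. by rewrite unitmxE det_Ccol unitfE. Qed.

Lemma Ccol_mul i x y : Ccol i x *m y = y i 0 *: x + (y - y i 0 *: delta_mx i 0).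
Proof.
apply/matrixP=> r c; rewrite ord1 !mxE (bigD1 i) //= mxE eqxx mulrC; congr (_ + _).
rewrite eqxx andbT; have [->|ri] := eqVneq r i.
  rewrite mulr1 subrr big1 // => k ki; rewrite mxE (negPf ki) eq_sym (negPf ki) mul0r //.
rewrite mulr0 subr0 (bigD1 r) //= mxE (negPf ri) eqxx mul1r big1 ?addr0 // => k /andP[ki kr].
by rewrite mxE (negPf ki) eq_sym (negPf kr) mul0r.
Qed.

Lemma CcolCcol i x y : Ccol i x *m Ccol i y = Ccol i (Ccol i x *m y).
Proof. by rewrite mul_Ccol; apply/matrixP=> r c; rewrite !mxE; case: eqP. Qed.

Lemma Ccol_mulid i x y : y i 0 = 0 -> Ccol i x *m y = y.
Proof. by move=> yi; rewrite Ccol_mul yi !scale0r subr0 add0r. Qed.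

Lemma Ccol_mul_delta i x : Ccol i x *m delta_mx i 0 = x.
Proof. by rewrite Ccol_mul !mxE !eqxx !scale1r subrr addr0. Qed.

(** Two ways of reaching the frame that has [x] as [i]-th and [x + b e_j] as
    [j]-th vector. *)
Lemma Ccol_swap i j x b : i != j -> x j 0 = 0 ->
  Ccol i x *m Ccol j (delta_mx i 0 + b *: delta_mx j 0) =
  Ccol j (x + b *: delta_mx j 0) *m Ccol i x.
Proof.
move=> ij xj; rewrite !mul_Ccol; apply/matrixP=> r c; rewrite [LHS]mxE [RHS]mxE.
rewrite mulmxDr Ccol_mul_delta -scalemxAr !Ccol_mulid //; last by rewrite mxE (negPf ij).
have ji : (j == i) = false by rewrite eq_sym (negPf ij).
case: (eqVneq c j) => [->|cj]; first by rewrite ji [RHS]mxE eqxx.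
case: (eqVneq c i) => [->|ci]; first by rewrite mxE eqxx.
by rewrite !mxE (negPf cj) (negPf ci).
Qed.

Lemma Ccol_same i j x b : i != j ->
  Ccol i x *m Ccol i (delta_mx i 0 + b *: delta_mx j 0) =
  Ccol i (x + b *: delta_mx j 0).
Proof.
move=> ij; rewrite CcolCcol mulmxDr Ccol_mul_delta -scalemxAr Ccol_mulid //.
by rewrite mxE (negPf ij).
Qed.

End Ccol.

(** * Groups of invertible matrices and their pattern subgroups *)

(** The group of invertible matrices through its matrix values only.  [gl] is
    defined on all matrices, so that no proof of invertibility occurs inside
    terms, and the size is any [n], whereas [{'GL_n[F]}] consists of matrices of
    size [n.-1.+1]. *)
Record glgroup (n : nat) (F : finFieldType) := GLGroup {
  glcarrier : finGroupType;
  mval : glcarrier -> 'M[F]_n;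
  gl : 'M[F]_n -> glcarrier;
  mval_unit : forall g, mval g \in unitmx;
  mvalM : forall g h, mval (g * h)%g = mval g *m mval h;
  glK : forall M, M \in unitmx -> mval (gl M) = M;
  mvalK : cancel mval gl }.

Section GL.
Variables (n : nat) (F : finFieldType) (X : glgroup n F).
Local Notation G := (glcarrier X).
Local Notation mx := 'M[F]_n.
Local Notation gl := (@gl n F X).
Implicit Types (M N : mx) (g h : G) (r : rel 'I_n) (i j k : 'I_n).

Lemma mval_inj : injective (@mval n F X).
Proof. exact: can_inj (@mvalK n F X). Qed.

Lemma mval1 : mval (1%g : G) = 1%:M.
Proof.
have := mvalM (1%g : G) 1%g; rewrite mulg1 -{1}[mval 1%g]mulmx1 =>
  /(congr1 (mulmx (invmx (mval (1%g : G))))).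
by rewrite !mulKmx ?mval_unit.
Qed.

Lemma gl1 : gl 1%:M = 1%g.
Proof. by rewrite -mval1 mvalK. Qed.

Lemma glM M N : M \in unitmx -> N \in unitmx -> gl (M *m N) = (gl M * gl N)%g.
Proof. by move=> uM uN; apply: mval_inj; rewrite mvalM !glK ?unitmx_mul ?uM. Qed.

(** The matrices equal to the identity outside [r]; for transitive [r] this is a
    group ([patgroup_group_set]).  Unitriangular and Borel subgroups, unipotent
    radicals and Levi subgroups are all of this form. *)
Definition patgroup r : {set G} :=
  [set g : G | [forall i, forall j, (mval g i j != (i == j)%:R) ==> r i j]].

Lemma patgroupP r g : reflect (forall i j, ~~ r i j ->
  mval g i j = (i == j)%:R) (g \in patgroup r).
Proof.
rewrite inE; apply: (iffP idP) => [H i j rij|H].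
  by move/forallP/(_ i)/forallP/(_ j): H => /implyP; case: eqP => // _ /(_ isT);
    rewrite (negPf rij).
by apply/forallP=> i; apply/forallP=> j; apply/implyP; apply: contraR => /H ->.
Qed.

Lemma patgroup_group_set r : transitive r -> group_set (patgroup r).
Proof.
move=> rT; apply/group_setP; split; first by apply/patgroupP=> i j _; rewrite mval1 mxE.
move=> g h /patgroupP gr /patgroupP hr; apply/patgroupP=> i j rij; rewrite mvalM mxE.
have E k : (mval g i k : F) * mval h k j = (i == k)%:R * (k == j)%:R.
  case rik: (r i k).
    have rkj : ~~ r k j by apply: contra rij => /(rT _ _ _ rik).
    rewrite hr //; case: eqP => [kj|_]; last by rewrite !mulr0.
    by rewrite kj (negPf rij) in rik.
  rewrite gr ?rik //; case: eqP => [<-|_]; last by rewrite !mul0r.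
  by rewrite hr.
under eq_bigr => k _ do rewrite E.
rewrite (bigD1 i) //= eqxx mul1r big1 ?addr0 // => k /negPf ki.
by rewrite eq_sym ki mul0r.
Qed.

Definition above : rel 'I_n := fun i j => (i < j)%N.

Lemma above_trans : transitive above. Proof. by move=> i j k; apply: ltn_trans. Qed.

Lemma unitmx_upper M : (forall i j, (j < i)%N -> M i j = 0) -> (forall i, M i i != 0) ->
  M \in unitmx.
Proof.
move=> M0 Md; rewrite unitmxE -det_tr det_trig; last first.
  by apply/is_trig_mxP=> i j ij; rewrite mxE M0.
by rewrite unitfE prodf_seq_neq0; apply/allP=> i _; rewrite mxE Md.
Qed.

Lemma unitmx_lower M : (forall i j, (i < j)%N -> M i j = 0) -> (forall i, M i i != 0) ->
  M \in unitmx.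
Proof.
move=> M0 Md; rewrite -unitmx_tr; apply: unitmx_upper => [i j ij|i]; rewrite mxE //.
exact: M0.
Qed.

Definition supported r M := forall i j, ~~ r i j -> M i j = 0.

Lemma unit_supported r M : subrel r above -> supported r M -> 1%:M + M \in unitmx.
Proof.
move=> rl Mr; apply: unitmx_upper => [i j ji|i].
  rewrite !mxE Mr ?addr0; first by rewrite (gtn_eqF ji : (i == j) = false).
  by apply: contraL ji => /rl; rewrite /above -leqNgt => /ltnW.
rewrite !mxE eqxx Mr ?addr0 ?oner_eq0 //; apply/negP => /rl; by rewrite /above ltnn.
Qed.

Lemma patgroup_gl r M : subrel r above -> supported r M -> gl (1%:M + M) \in patgroup r.
Proof.
move=> rl Mr; apply/patgroupP=> i j rij; rewrite glK ?(unit_supported rl) //.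
by rewrite !mxE Mr // addr0.
Qed.

Lemma card_patgroup r : subrel r above ->
  #|patgroup r| = (#|F| ^ #|[set p : 'I_n * 'I_n | r p.1 p.2]|)%N.
Proof.
move=> rl.
pose D := [set p : 'I_n * 'I_n | r p.1 p.2].
pose phi (f : {ffun 'I_n * 'I_n -> F}) : G := gl (1%:M + \matrix_(i, j) f (i, j)).
have fs (f : {ffun 'I_n * 'I_n -> F}) : f \in pffun_on 0 D predT ->
    supported r (\matrix_(i, j) f (i, j)).
  move=> /pffun_onP [/fintype.subsetP fD _] i j rij; rewrite mxE.
  by apply: contraNeq rij => nz; have := fD (i, j); rewrite unfold_in nz inE; apply.
have <- : #|phi @: pffun_on 0 D predT| = (#|F| ^ #|D|)%N.
  rewrite card_in_imset ?card_pffun_on ?cardT -?cardE //.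
  move=> f g /fs fr /fs gr /(congr1 (@mval n F X)); rewrite !glK ?(unit_supported rl) //.
  move=> /addrI /matrixP E; apply/ffunP=> -[i j]; by have := E i j; rewrite !mxE.
apply: eq_card => g; apply/idP/imsetP => [gU|[f /fs fr ->]]; last exact: patgroup_gl.
exists [ffun p => mval g p.1 p.2 - (p.1 == p.2)%:R].
  apply/pffun_onP; split=> //; apply/fintype.subsetP=> -[i j].
  rewrite unfold_in ffunE inE /=; apply: contraR => rij.
  by move/patgroupP: gU => ->; rewrite ?subrr.
apply: mval_inj; rewrite glK; first by apply/matrixP=> i j; rewrite !mxE ffunE /= addrC subrK.
set M := \matrix_(i, j) _; suff -> : 1%:M + M = mval g by exact: mval_unit.
by apply/matrixP=> i j; rewrite !mxE ffunE /= addrC subrK.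
Qed.

Definition borelX : {set G} := patgroup (fun i j => (i <= j)%N).

Lemma borelX_group_set : group_set borelX.
Proof. by apply: patgroup_group_set => i j k; apply: leq_trans. Qed.

Canonical borelX_group := Group borelX_group_set.

Lemma borelXP g : reflect (forall i j, (j < i)%N -> mval g i j = 0) (g \in borelX).
Proof.
apply: (iffP (patgroupP _ _)) => H i j; last first.
  by rewrite -ltnNge => ji; rewrite H // (gtn_eqF ji : (i == j) = false).
by move=> ji; rewrite H -?ltnNge // (gtn_eqF ji : (i == j) = false).
Qed.

End GL.

Arguments borelX {n F} X.
Arguments borelX_group {n F} X.
Arguments patgroup {n F} X r.
Arguments above {n}.
Arguments gl {n F} _ _.
Arguments glK {n F _ M}.

(** * Flags and modular symbols *)

Section Symbols.
Variables (n : nat) (F : finFieldType) (X : glgroup n F) (R : idomainType).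
Local Notation G := (glcarrier X).
Local Notation gl := (@gl n F X).
Local Notation mx := 'M[F]_n.
Local Notation A := (galg R G).
Local Notation gb := (@gbasis R G).
Implicit Types (M N D : mx) (g h : G) (i j k : 'I_n) (s t : 'S_n) (x y : 'cV[F]_n).

Definition perm_gl s : G := gl (perm_mx s).
Local Notation PG := perm_gl.
Definition borel_sum : A := ghat R (borelX X).
Local Notation Bh := borel_sum.
Definition steinberg_gen : A := \sum_(s : 'S_n) (-1) ^+ s * (gb (PG s) * Bh).

Local Notation eps := steinberg_gen.

Lemma perm_glE s : mval (PG s) = perm_mx s :> mx.
Proof. by rewrite glK ?unitmx_perm. Qed.

Lemma perm_glM s t : PG (s * t)%g = (PG s * PG t)%g.
Proof. by rewrite /PG perm_mxM glM ?unitmx_perm. Qed.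

Lemma perm_gl1 : PG 1%g = 1%g.
Proof. by rewrite /PG perm_mx1 gl1. Qed.

Lemma perm_glV s : PG s^-1%g = (PG s)^-1%g.
Proof. by apply/eqP; rewrite eq_sym eq_invg_mul -perm_glM mulgV perm_gl1. Qed.

Lemma perm_gl_conjE s g i j : mval (PG s * g * (PG s)^-1)%g i j = mval g (s i) (s j).
Proof. by rewrite !mvalM -perm_glV !perm_glE -col_permE -row_permE !mxE. Qed.

Lemma gbasis_borel_sum g : g \in borelX X -> gb g * Bh = Bh.
Proof.
move=> gB; rewrite /Bh /ghat mulr_sumr (reindex_inj (mulgI g^-1%g)) /=.
apply: eq_big => [h|h _]; last by rewrite gbasisM mulKVg.
exact: (@groupMl _ (borelX_group X) g^-1%g h (groupVr gB)).
Qed.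

(** The coset of the Borel subgroup through [M], that is, the flag spanned by the
    successive columns of [M]. *)
Definition flag M : A := gb (gl M) * Bh.

Lemma flag_mul M D : M \in unitmx -> D \in unitmx ->
  (forall a b : 'I_n, (b < a)%N -> D a b = 0) -> flag (M *m D) = flag M.
Proof.
move=> uM uD D0; rewrite /flag glM // -gbasisM -mulrA; congr (_ * _); apply: gbasis_borel_sum.
by apply/borelXP => i j ji; rewrite glK // D0.
Qed.

(** The condition on [D] says that, in the frame reordered by [s], the matrix [D]
    is upper triangular; it therefore does not change the flag. *)
Lemma flag_perm M D s : M \in unitmx -> D \in unitmx ->
  (forall a b, (s b < s a)%N -> D a b = 0) ->
  flag (M *m D *m perm_mx s) = flag (M *m perm_mx s).
Proof.
move=> uM uD D0; have uP := unitmx_perm F s.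
have -> : M *m D *m perm_mx s = M *m perm_mx s *m (perm_mx s^-1 *m D *m perm_mx s).
  by rewrite !mulmxA -[M *m perm_mx s *m _]mulmxA -perm_mxM mulgV perm_mx1 mulmx1.
apply: flag_mul; rewrite ?unitmx_mul ?uM ?uP ?uD ?unitmx_perm // => a b ab.
rewrite -[X in _ *m perm_mx X](invgK s) -col_permE -row_permE !mxE D0 //.
by rewrite !permKV.
Qed.

(** The modular symbol of a frame: the alternating sum of the flags of its
    reorderings ([msymbol_flag]), the fundamental cycle of an apartment of the
    building.  With the value [0] on singular matrices the relations below need
    no case distinction. *)
Definition msymbol M : A := if M \in unitmx then gb (gl M) * eps else 0.
Local Notation sym := msymbol.

Lemma msymbol_gl g : sym (mval g) = gb g * eps.
Proof. by rewrite /sym mval_unit mvalK. Qed.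

Lemma msymbol1 : sym 1%:M = eps.
Proof. by rewrite /sym unitmx1 gl1 gbasis1 mul1r. Qed.

Lemma msymbolM M N : M \in unitmx -> sym (M *m N) = gb (gl M) * sym N.
Proof.
move=> uM; rewrite /sym unitmx_mul uM /=; case: ifP => [uN|_]; last by rewrite mulr0.
by rewrite glM // -gbasisM mulrA.
Qed.

Lemma msymbol_flag M : M \in unitmx ->
  sym M = \sum_(s : 'S_n) (-1) ^+ s * flag (M *m perm_mx s).
Proof.
move=> uM; rewrite /sym uM /eps mulr_sumr; apply: eq_bigr => s _.
rewrite mulrA commr_sign -mulrA; congr (_ * _).
by rewrite mulrA gbasisM -glM ?unitmx_perm.
Qed.

Lemma steinberg_gen_perm s : gb (PG s) * eps = (-1) ^+ s * eps.
Proof.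
rewrite /eps !mulr_sumr [RHS](reindex_inj (mulgI s)) /=.
apply: eq_bigr => t _; rewrite odd_permM signr_addb !mulrA -expr2 sqrr_sign mul1r.
by rewrite [_ * (-1) ^+ t]commr_sign -[_ * gb (PG s) * _]mulrA gbasisM perm_glM.
Qed.

Lemma steinberg_gen_diag g : (forall i j, i != j -> mval g i j = 0) -> gb g * eps = eps.
Proof.
move=> g0; rewrite -msymbol_gl -msymbol1 !msymbol_flag ?unitmx1 ?mval_unit //.
apply: eq_bigr => s _; congr (_ * _).
rewrite -[mval g]mul1mx; apply: flag_perm; rewrite ?unitmx1 ?mval_unit // => a b ba.
by apply: g0; apply: contraTneq ba => ->; rewrite ltnn.
Qed.

(** Three lines in a plane: the symbols of the frames that use two of them form a
    cocycle.  The flags cancel in pairs, a reordering [s] with [s i < s j] being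
    paired with [tperm i j * s]. *)
Lemma two_term_relation i j (b : F) : i != j -> b != 0 ->
  let z : 'cV[F]_n := delta_mx i 0 + b *: delta_mx j 0 in
  sym (Ccol i z) + sym (Ccol j z) = eps.
Proof.
move=> ij b0 z.
have ji : (j == i) = false by rewrite eq_sym (negPf ij).
have zi : z i 0 = 1 by rewrite !mxE !eqxx (negPf ij) mulr0 addr0.
have zj : z j 0 = b by rewrite !mxE ji !eqxx /= mulr1 add0r.
have zo k : k != i -> k != j -> z k 0 = 0.
  by move=> /negPf ki /negPf kj; rewrite !mxE ki kj /= mulr0 addr0.
have ui : Ccol i z \in unitmx by rewrite unit_Ccol zi oner_neq0.
have uj : Ccol j z \in unitmx by rewrite unit_Ccol zj.
apply/eqP; rewrite -subr_eq0 -msymbol1 !msymbol_flag ?unitmx1 //.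
rewrite -big_split -sumrB /=.
rewrite (bigID (fun s : 'S_n => s i < s j)%N) /=.
rewrite [X in _ + X](reindex_inj (mulgI (tperm i j))) /=.
under [X in _ + X]eq_bigl => s.
  rewrite !permM tpermL tpermR -leqNgt leq_eqVlt [(_ == _)](inj_eq val_inj).
  rewrite (inj_eq perm_inj) (negPf ij) /=. over.
rewrite -big_split /= big1 // => s sij.
rewrite odd_mul_tperm ij signr_addb expr1 !mulN1r !mulNr.
have e1 : flag (Ccol j z *m perm_mx s) = flag (1%:M *m perm_mx s).
  rewrite -[Ccol j z]mul1mx; apply: flag_perm; rewrite ?unitmx1 // => a c sca.
  rewrite mxE; case: eqP => [cj|_]; last by case: eqP => // ac; move: sca; rewrite ac ltnn.
  apply: zo; apply: contraTneq sca => ->; rewrite cj -leqNgt ?leqnn ?(ltnW sij) //.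
have e2 : flag (Ccol i z *m perm_mx (tperm i j * s)) = flag (1%:M *m perm_mx (tperm i j * s)).
  rewrite -[Ccol i z]mul1mx; apply: flag_perm; rewrite ?unitmx1 // => a c.
  rewrite !permM => sca.
  rewrite mxE; case: eqP => [ci|_]; last by case: eqP => // ac; move: sca; rewrite ac ltnn.
  apply: zo; apply: contraTneq sca => ->;
    rewrite ci ?tpermL ?tpermR -leqNgt ?leqnn ?(ltnW sij) //.
have e3 : flag (Ccol i z *m perm_mx s) = flag (Ccol j z *m perm_mx (tperm i j * s)).
  have -> : Ccol j z *m perm_mx (tperm i j * s) =
     Ccol i z *m Ccol j (delta_mx i 0 - b *: delta_mx j 0) *m perm_mx s.
    rewrite perm_mxM mulmxA; congr (_ *m _).
    rewrite -{1}[tperm i j]invgK -col_permE mul_Ccol tpermV.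
    rewrite mulmxBr Ccol_mul_delta -scalemxAr Ccol_mulid; last by rewrite mxE (negPf ij).
    apply/matrixP=> r c; rewrite !mxE.
    case: tpermP => [->|->|/eqP ci /eqP cj].
    - by rewrite !eqxx (negPf ij).
    - by rewrite (negPf ij) !eqxx addrK andbT.
    by rewrite (negPf ci) (negPf cj).
  symmetry; apply: flag_perm; rewrite // ?unit_Ccol.
    by rewrite !mxE ji !eqxx /= mulr1 sub0r oppr_eq0.
  move=> a c sca; rewrite mxE; case: eqP => [cj|_]; last by case: eqP => // ac; move: sca;
    rewrite ac ltnn.
  rewrite !mxE; have ai : a != i by apply: contraTneq sca => ->; rewrite cj -leqNgt ltnW.
  have aj : a != j by apply: contraTneq sca => ->; rewrite cj ltnn.
  by rewrite (negPf ai) (negPf aj) mulr0 subr0.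
by rewrite e1 e2 e3 addrK opprK addrAC addNr add0r subrr.
Qed.

End Symbols.

Arguments steinberg_gen {n F} X R.
Arguments perm_gl {n F} X s.
Arguments borel_sum {n F} X R.
Arguments msymbol {n F} X R M.

(** * Relations between modular symbols *)

Section Relation.
Variables (n : nat) (F : finFieldType) (X : glgroup n F) (R : idomainType).
Local Notation G := (glcarrier X).
Local Notation gl := (@gl n F X).
Local Notation mx := 'M[F]_n.
Local Notation A := (galg R G).
Local Notation gb := (@gbasis R G).
Local Notation eps := (steinberg_gen X R).
Local Notation sym := (@msymbol n F X R).
Local Notation PG := (perm_gl X).
Local Notation U := (patgroup X above).
Implicit Types (M N D : mx) (g h : G) (i j k : 'I_n) (s t : 'S_n) (x y : 'cV[F]_n).

Lemma msymbol_singular M : M \notin unitmx -> sym M = 0.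
Proof. by rewrite /msymbol => /negPf->. Qed.

Lemma msymbol_Ccol0 M i y : y i 0 = 0 -> sym (M *m Ccol i y) = 0.
Proof. by move=> y0; rewrite msymbol_singular // unitmx_mul unit_Ccol y0 eqxx andbF. Qed.

(** Substituting [y] for each vector of a frame in turn gives symbols that add up to
    the symbol of the frame.  By induction on the number of nonzero coordinates:
    write [y = y' + b e_j], expand the frame by [y'], and apply
    [two_term_relation] to the vectors [y'] and [e_j] of each frame obtained. *)
Lemma frame_relation y : y != 0 -> \sum_i sym (Ccol i y) = eps.
Proof.
have [m] := ubnP #|[set i | y i 0 != 0]|; elim: m y => // m IH y /ltnSE ym y0.
have [j yj] : exists j, y j 0 != 0.
  apply/existsP; apply: contra_neqT y0; rewrite negb_exists => /forallP H.
  by apply/matrixP=> r c; rewrite ord1 mxE; apply/eqP; move: (H r); rewrite negbK.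
pose b := y j 0; pose y' := y - b *: delta_mx j 0.
have y'E k : y' k 0 = if k == j then 0 else y k 0.
  rewrite !mxE andbT; case: eqP => [->|_]; first by rewrite mulr1 subrr.
  by rewrite mulr0 subr0.
have yE : y = y' + b *: delta_mx j 0 by rewrite subrK.
have [y'0|y'0] := eqVneq y' 0.
  rewrite (bigD1 j) //= big1 ?addr0 => [|i ij]; last first.
    have -> : Ccol i y = 1%:M *m Ccol i y by rewrite mul1mx.
    apply: msymbol_Ccol0; rewrite yE y'0 add0r !mxE (negPf ij) mulr0 //.
  have uj : Ccol j y \in unitmx by rewrite unit_Ccol.
  rewrite -(@glK _ _ X _ uj) msymbol_gl; apply: steinberg_gen_diag => i k ik.
  rewrite glK // mxE; case: eqP => [kj|_]; last by rewrite (negPf ik).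
  by rewrite yE y'0 add0r !mxE -kj (negPf ik) mulr0.
have S' : \sum_(i | i != j) sym (Ccol i y') = eps.
  rewrite -[RHS](IH y') // ?[RHS](bigD1 j) //=.
    by rewrite -[Ccol j _]mul1mx msymbol_Ccol0 ?add0r // y'E eqxx.
  apply: leq_trans ym; apply: proper_card; apply/properP; split.
    by apply/fintype.subsetP=> i; rewrite !inE y'E; case: (i == j); rewrite ?eqxx.
  by exists j; rewrite !inE ?y'E ?eqxx.
have E i : i != j -> sym (Ccol i y') = sym (Ccol i y) + gb (gl (Ccol j y)) * sym (Ccol i y').
  move=> ij; rewrite -[in RHS]msymbolM ?unit_Ccol //.
  have [y'i|y'i] := eqVneq (y' i 0) 0.
    have yi : y i 0 = 0 by move: y'i; rewrite y'E (negPf ij).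
    by rewrite !msymbol_Ccol0 // -[Ccol i y]mul1mx -[Ccol i y']mul1mx !msymbol_Ccol0 // addr0.
  have ui : Ccol i y' \in unitmx by rewrite unit_Ccol.
  rewrite {1}/msymbol ui -(two_term_relation X R ij yj) mulrDr -!msymbolM //.
  by rewrite Ccol_same // Ccol_swap ?y'E ?eqxx // -yE.
rewrite -[RHS]S' [LHS](bigD1 j) //= [RHS](eq_bigr _ E) big_split /= addrC; congr (_ + _).
by rewrite -mulr_sumr S' /msymbol unit_Ccol yj.
Qed.

Lemma frame_relation_at M y : M \in unitmx -> y != 0 ->
  \sum_i sym (M *m Ccol i y) = sym M.
Proof.
move=> uM y0; under eq_bigr => i _ do rewrite msymbolM //.
by rewrite -mulr_sumr frame_relation // /msymbol uM.
Qed.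

(** By [left_ideal_span] this is the whole Steinberg lattice. *)
Definition unipotent_span (x : A) :=
  exists c : G -> R, x = \sum_(u in U) galg_scalar G (c u) * (gb u * eps).

Lemma unipotent_span0 : unipotent_span 0.
Proof. by exists (fun _ => 0); rewrite big1 // => u _; rewrite rmorph0 mul0r. Qed.

Lemma unipotent_spanD (x y : A) : unipotent_span x -> unipotent_span y ->
  unipotent_span (x + y).
Proof.
move=> [c ->] [d ->]; exists (fun u => c u + d u); rewrite -big_split.
by apply: eq_bigr => u _; rewrite rmorphD mulrDl.
Qed.

Lemma unipotent_spanZ a (x : A) : unipotent_span x -> unipotent_span (galg_scalar G a * x).
Proof.
move=> [c ->]; exists (fun u => a * c u); rewrite mulr_sumr.
by apply: eq_bigr => u _; rewrite rmorphM mulrA.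
Qed.

Lemma unipotent_span_sum I (r : seq I) (P : pred I) (Z : I -> A) :
  (forall a, P a -> unipotent_span (Z a)) -> unipotent_span (\sum_(a <- r | P a) Z a).
Proof. by move=> H; apply: big_ind => //; [exact: unipotent_span0|exact: unipotent_spanD]. Qed.

Lemma unipotent_span_gen u : u \in U -> unipotent_span (gb u * eps).
Proof.
move=> uU; exists (fun v => (v == u)%:R); rewrite (bigD1 u) //= eqxx rmorph1 mul1r.
by rewrite big1 ?addr0 // => v /andP[_ /negPf ->]; rewrite rmorph0 mul0r.
Qed.

Lemma msymbol_perm M s : sym (M *m perm_mx s) = (-1) ^+ s * sym M.
Proof.
rewrite /msymbol unitmx_mul unitmx_perm andbT; case: ifP => [uM|_]; last by rewrite mulr0.
rewrite glM ?unitmx_perm // -gbasisM -[gl (perm_mx s)]/(PG s) -mulrA steinberg_gen_perm.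
by rewrite mulrA commr_sign mulrA.
Qed.

(** Straightening of a frame: once its first [k] columns have unitriangular shape,
    [frame_relation_at] for a suitable [y] replaces it by frames whose first
    [k.+1] columns, up to a transposition, have this shape. *)
Lemma msymbol_span M : unipotent_span (sym M).
Proof.
have [uM|] := boolP (M \in unitmx); last by move/msymbol_singular->; exact: unipotent_span0.
suff H m (k : nat) : (n - k <= m)%N -> forall M, M \in unitmx ->
    (forall i j : 'I_n, (j < k)%N -> (j <= i)%N -> M i j = (i == j)%:R) ->
      unipotent_span (sym M).
  by apply: (H n 0%N _ M uM); rewrite ?subn0.
elim: m k {M uM} => [|m IH] k km M uM Mk.
  have kn : (n <= k)%N by rewrite -subn_eq0 -leqn0.
  rewrite -(@glK _ _ X _ uM) msymbol_gl; apply: unipotent_span_gen; apply/patgroupP=> i j.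
  by rewrite /above -leqNgt glK // => ji; apply: Mk => //; apply: leq_trans kn.
have [kn|kn] := leqP n k; first by apply: (IH k) => //; rewrite (eqP kn).
pose kk := Ordinal kn.
pose b : 'cV[F]_n := invmx M *m delta_mx kk 0.
have Mb : M *m b = delta_mx kk 0 by rewrite mulmxA mulmxV // mul1mx.
(* the truncation of [b] still maps to [e_k] in the rows from [k] on, since the
   first [k] columns of [M] vanish there *)
pose y : 'cV[F]_n := \col_i (if (k <= i)%N then b i 0 else 0).
have My (r : 'I_n) : (k <= r)%N -> (M *m y) r 0 = (r == kk)%:R.
  move=> kr; have <- : (M *m b) r 0 = (r == kk)%:R by rewrite Mb mxE eqxx andbT.
  rewrite !mxE; apply: eq_bigr => i _; rewrite !mxE; case: leqP => // ik.
  by rewrite Mk ?(ltnW (leq_trans ik kr)) // (gtn_eqF (leq_trans ik kr) :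
    (r == i) = false) !mul0r.
have y0 : y != 0.
  apply/eqP => y0; have := My kk (leqnn _); rewrite y0 mulmx0 mxE eqxx => /eqP.
  by rewrite eq_sym oner_eq0.
rewrite -(frame_relation_at uM y0); apply: unipotent_span_sum => i _.
have [yi|yi] := eqVneq (y i 0) 0; first by rewrite msymbol_Ccol0 //; exact: unipotent_span0.
have ki : (k <= i)%N by move: yi; rewrite mxE; case: leqP => //; rewrite eqxx.
pose t := tperm kk i.
have -> : sym (M *m Ccol i y) = galg_scalar G ((-1) ^+ t) * sym (M *m Ccol i y *m perm_mx t).
  by rewrite msymbol_perm rmorph_sign mulrA -expr2 sqrr_sign mul1r.
apply: unipotent_spanZ; apply: (IH k.+1).
- by rewrite subnS -ltnS; apply: leq_trans km; rewrite prednK // subn_gt0.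
- by rewrite !unitmx_mul uM unit_Ccol yi unitmx_perm.
move=> r c; rewrite ltnS => ck cr.
rewrite -[t]invgK -col_permE mul_Ccol !mxE tpermV.
have [ckk|ckk] := eqVneq c kk.
  rewrite ckk tpermL eqxx; have := My r; rewrite mxE; apply.
  by move: cr; rewrite ckk.
have ck' : (c < k)%N by rewrite ltn_neqAle ck andbT; exact: ckk.
have ci : c != i by apply: contraTneq ck' => ->; rewrite -leqNgt.
by rewrite tpermD ?(negPf ci) ?Mk // eq_sym.
Qed.

Lemma left_ideal_span (a : A) : unipotent_span (a * eps).
Proof.
rewrite [a]galg_sum mulr_suml; apply: unipotent_span_sum => g _; rewrite -mulrA.
by apply: unipotent_spanZ; rewrite -msymbol_gl; apply: msymbol_span.
Qed.

End Relation.

(** * Averaging over a unipotent block *)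

Section Block.
Variables (n : nat) (F : finFieldType) (X : glgroup n F) (R : idomainType).
Local Notation G := (glcarrier X).
Local Notation gl := (@gl n F X).
Local Notation mx := 'M[F]_n.
Local Notation A := (galg R G).
Local Notation gb := (@gbasis R G).
Local Notation eps := (steinberg_gen X R).
Local Notation sym := (@msymbol n F X R).
Variables (S1 S2 : pred 'I_n).
Hypothesis S12 : forall i j, S1 i -> S2 j -> (i < j)%N.
Implicit Types (M N D Y : mx) (g h : G) (i j k : 'I_n).

Definition upper_block : rel 'I_n := fun i j => S1 i && S2 j.
Definition lower_block : rel 'I_n := fun i j => S2 i && S1 j.
Definition levi : rel 'I_n := fun i j => (S1 i == S1 j) && (S2 i == S2 j).

Lemma S1N2 i : S1 i -> S2 i = false.
Proof. by move=> s1; apply/negP => /(S12 s1); rewrite ltnn. Qed.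

Lemma S2N1 i : S2 i -> S1 i = false.
Proof. by move=> s2; apply/negP => /S12/(_ s2); rewrite ltnn. Qed.

Lemma upper_block_above : subrel upper_block above.
Proof. by move=> i j /andP[/S12]; apply. Qed.

Lemma levi_group_set : group_set (patgroup X levi).
Proof.
apply: patgroup_group_set => i j k /andP[/eqP a /eqP b] /andP[/eqP c /eqP d].
by rewrite /levi a c b d !eqxx.
Qed.
Canonical levi_group := Group levi_group_set.

Lemma upper_block_conj g u : g \in patgroup X levi -> u \in patgroup X upper_block ->
  (g * u * g^-1)%g \in patgroup X upper_block.
Proof.
move=> gL /patgroupP uB; have /patgroupP gL1 := gL.
have /patgroupP gL2 : (g^-1)%g \in patgroup X levi by rewrite groupV.
pose N := mval u - 1%:M.
have Ns i j : ~~ upper_block i j -> N i j = 0 by move=> ij; rewrite !mxE uB // subrr.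
apply/patgroupP=> i j ij.
have -> : mval (g * u * g^-1)%g = 1%:M + mval g *m N *m mval (g^-1)%g.
  rewrite !mvalM /N mulmxBr mulmxBl mulmx1 -[mval g *m mval g^-1]mvalM mulgV mval1.
  by rewrite addrC subrK.
rewrite !mxE big1 ?addr0 // => l _; rewrite mxE.
have [lj|lj] := boolP (levi l j); last first.
  rewrite gL2 //; case: eqP => [lj'|_]; last by rewrite mulr0.
  by rewrite lj' /levi !eqxx in lj.
rewrite big1 ?mul0r // => k _.
have [ik|ik] := boolP (levi i k); last first.
  rewrite gL1 //; case: eqP => [ik'|_]; last by rewrite mul0r.
  by rewrite ik' /levi !eqxx in ik.
rewrite Ns ?mulr0 //; apply: contra ij.
move: lj ik; rewrite /levi /upper_block => /andP[/eqP a /eqP b] /andP[/eqP c /eqP d].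
by rewrite -c b.
Qed.

Definition block_sum : A := \sum_(u in patgroup X upper_block) gb u.

Lemma upper_block_group_set : group_set (patgroup X upper_block).
Proof.
apply: patgroup_group_set => i j k /andP[_ s2] /andP[s1 _]; by rewrite (S1N2 s1) in s2.
Qed.
Definition upper_block_group : {group G} := Group upper_block_group_set.

Lemma block_sum_levi g : g \in patgroup X levi -> block_sum * gb g = gb g * block_sum.
Proof.
move=> gL; rewrite /block_sum mulr_sumr mulr_suml (reindex_inj (conjg_inj g^-1%g)) /=.
apply: eq_big => [u|u _]; last by rewrite !gbasisM conjgE invgK -!mulgA mulVg mulg1.
rewrite conjgE invgK mulgA; apply/idP/idP => [|uB]; last exact: upper_block_conj.
have gV : (g^-1)%g \in patgroup X levi by rewrite groupV.
by move/(upper_block_conj gV); rewrite invgK -!mulgA mulVg mulg1 mulKg.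
Qed.

Lemma block_sum_absorb u : u \in patgroup X upper_block -> block_sum * gb u = block_sum.
Proof.
move=> uB; rewrite /block_sum mulr_suml (reindex_inj (mulIg u^-1%g)) /=.
apply: eq_big => [v|v _]; last by rewrite gbasisM mulgKV.
exact: (@groupMr _ upper_block_group u^-1%g v (@groupVr _ upper_block_group _ uB)).
Qed.

Lemma unitmx_lower_block Y : supported lower_block Y -> 1%:M + Y \in unitmx.
Proof.
move=> Ys; apply: unitmx_lower => [i j ij|i]; rewrite !mxE Ys ?addr0.
- by rewrite (ltn_eqF ij : (i == j) = false).
- by apply: contraL ij => /andP[s2 /S12/(_ s2)]; rewrite -leqNgt => /ltnW.
- by rewrite eqxx oner_eq0.
by apply/negP=> /andP[s2 s1]; rewrite (S1N2 s1) in s2.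
Qed.

Lemma delta_mulE k i Y r c : (delta_mx k i *m Y) r c = (r == k)%:R * Y i c.
Proof.
rewrite mxE (bigD1 i) //= mxE eqxx andbT big1 ?addr0 // => j ji.
by rewrite mxE (negPf ji) andbF mul0r.
Qed.

(** Induction on the number of nonzero columns of [Y].  Let [Y'] be [Y] without its
    column [k], and [y = e_k + Y e_k].  The relation of the frame [1 + Y'] with [y]
    contains the symbol of [1 + Y]; each other term is, up to an element of the
    upper block, which the sum absorbs, a Levi translate of a symbol [1 + Yi] with
    fewer nonzero columns than [Y].  If [Y' = 0] the other terms are instead those
    of the relation with [Y e_k], whose total is [eps]. *)
Lemma block_sum_vanish Y : supported lower_block Y -> Y != 0 -> block_sum * sym (1%:M + Y) = 0.
Proof.
have [m] := ubnP #|[set j | col j Y != 0]|; elim: m Y => // m IH Y /ltnSE Ym Ys Y0.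
have [k vk] : exists k, col k Y != 0.
  apply/existsP; apply: contra_neqT Y0; rewrite negb_exists => /forallP H.
  apply/matrixP=> r c; have := H c; rewrite negbK => /eqP/matrixP/(_ r 0).
  by rewrite !mxE.
pose v := col k Y.
have kS1 : S1 k.
  apply: contraT => nk; case/eqP: vk; apply/matrixP=> r c; rewrite !mxE Ys //.
  by rewrite /lower_block (negPf nk) andbF.
have vS r : ~~ S2 r -> v r 0 = 0 by move=> nr; rewrite mxE Ys // /lower_block (negPf nr).
have vk0 : v k 0 = 0 by rewrite vS // S1N2.
pose Y' := \matrix_(r, c) (if c == k then 0 else Y r c).
have Y's : supported lower_block Y' by move=> r c rc; rewrite mxE Ys // if_same.
have Y'c (y : 'cV[F]_n) : (forall r, S1 r -> r != k -> y r 0 = 0) -> Y' *m y = 0.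
  move=> yS; apply/matrixP=> r c; rewrite !mxE big1 // => j _; rewrite ord1 mxE.
  case: eqP => [_|/eqP jk]; first by rewrite mul0r.
  have [jS|jS] := boolP (S1 j); first by rewrite yS // mulr0.
  by rewrite Ys ?mul0r // /lower_block (negPf jS) andbF.
pose y : 'cV[F]_n := delta_mx k 0 + v.
have Y'y : Y' *m y = 0.
  by apply: Y'c => r r1 rk; rewrite !mxE (negPf rk) add0r Ys // /lower_block S1N2.
have Y'v : Y' *m v = 0 by apply: Y'c => r r1 rk; rewrite vS // S1N2.
have Y'k : Y' *m delta_mx k 0 = 0 :> 'cV[F]_n.
  by apply: Y'c => r r1 rk; rewrite mxE (negPf rk).
have yk : y k 0 = 1 by rewrite !mxE !eqxx Ys ?addr0 // /lower_block S1N2.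
have y0 : y != 0.
  by apply/eqP=> /matrixP/(_ k 0); rewrite yk mxE => /eqP; rewrite oner_eq0.
have yE i : i != k -> y i 0 = v i 0 by move=> ik;
  rewrite mxE [delta_mx _ _ _ _]mxE (negPf ik) add0r.
have u' : 1%:M + Y' \in unitmx by exact: unitmx_lower_block.
(* the frame relation, with the term [i = k] set apart *)
have main : sym (1%:M + Y') = sym (1%:M + Y) + \sum_(i | i != k) sym ((1%:M + Y') *m Ccol i y).
  rewrite -(frame_relation_at X R u' y0) (bigD1 k) //=; congr (sym _ + _).
  rewrite mul_Ccol mulmxDl mul1mx Y'y addr0; apply/matrixP=> r c; rewrite !mxE.
  by case: eqP => [->|]; rewrite ?andbT.
have step i : i != k -> v i 0 != 0 ->
  block_sum * sym ((1%:M + Y') *m Ccol i y) =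
  block_sum * sym ((1%:M - (v i 0)^-1 *: (delta_mx k i *m Y')) *m Ccol i v + Y').
  move=> ik vi.
  have iS2 : S2 i by apply: contraNT vi => /vS ->.
  (* [h] clears the vector [e_k] from [y], which makes [v] the new vector of the frame *)
  pose h := 1%:M + - (v i 0)^-1 *: delta_mx k i.
  have hs : supported upper_block (- (v i 0)^-1 *: delta_mx k i).
    move=> r c rc; rewrite !mxE; case: eqP => [rk|_]; last by rewrite mulr0.
    case: eqP => [ci|_]; last by rewrite mulr0.
    by rewrite rk ci /upper_block kS1 iS2 in rc.
  have uh : h \in unitmx by exact: (unit_supported upper_block_above).
  rewrite -[in LHS](block_sum_absorb (patgroup_gl X upper_block_above hs)) -mulrA -msymbolM //; congr (_ * sym _).
  have dv : delta_mx k i *m v = v i 0 *: (delta_mx k 0 : 'cV[F]_n).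
    apply/matrixP=> r c; rewrite ord1 !mxE (bigD1 i) //= !mxE eqxx andbT big1 ?addr0.
      by rewrite mulrC.
    by move=> j ji; rewrite mxE (negPf ji) andbF mul0r.
  have dk : delta_mx k i *m delta_mx k 0 = 0 :> 'cV[F]_n.
    by rewrite mul_delta_mx_0.
  have hY : h *m (1%:M + Y') = (1%:M - (v i 0)^-1 *: (delta_mx k i *m Y')) + Y'
            - (v i 0)^-1 *: delta_mx k i.
    rewrite /h mulmxDl mul1mx mulmxDr mulmx1 -scalemxAl scaleNr scaleNr.
    by rewrite addrA addrAC; congr (_ + _); rewrite addrAC.
  rewrite mulmxA hY !mul_Ccol.
  have -> : (1%:M - (v i 0)^-1 *: (delta_mx k i *m Y') + Y' - (v i 0)^-1 *: delta_mx k i) *m y =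
            (1%:M - (v i 0)^-1 *: (delta_mx k i *m Y')) *m v.
    rewrite !mulmxBl mulmxDl !mulmxBl -!scalemxAl -!mulmxA Y'y Y'v !mulmx0 !scaler0 !subr0 addr0.
    rewrite !mul1mx /y mulmxDr dv dk add0r scalerA mulVf // scale1r.
    by rewrite addrC addKr.
  apply/matrixP=> r c; rewrite [LHS]mxE [RHS]mxE [X in _ = X + _]mxE.
  case: eqP => [->|/eqP ci].
    by rewrite [Y' r i]Y's ?addr0 // /lower_block (S2N1 iS2) andbF.
  by rewrite !mxE (negPf ci) andbF mulr0 subr0.
have [Y'0|Y'0] := eqVneq Y' 0.
  have : block_sum * sym (1%:M + Y') = block_sum * eps by rewrite Y'0 addr0 msymbol1.
  rewrite main mulrDr mulr_sumr => E.
  suff S : \sum_(i | i != k) block_sum * sym ((1%:M + Y') *m Ccol i y) = block_sum * eps.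
    by apply: (addIr (block_sum * eps)); rewrite add0r -{1}S.
  rewrite -(frame_relation X R vk) [in RHS](bigD1 k) //=.
  rewrite -[Ccol k _]mul1mx msymbol_Ccol0 // add0r mulr_sumr; apply: eq_bigr => i ik.
  have [vi|vi] := eqVneq (v i 0) 0.
    by rewrite !msymbol_Ccol0 ?yE // -[Ccol i _]mul1mx msymbol_Ccol0.
  by rewrite step // Y'0 mulmx0 scaler0 subr0 mul1mx addr0.
have Y'm : (#|[set j | col j Y' != 0%R]| < m)%N.
  apply: leq_trans Ym; apply: proper_card; apply/properP; split.
    apply/fintype.subsetP=> j; rewrite !inE; apply: contra => /eqP/matrixP E.
    apply/eqP/matrixP=> r c; have := E r c; rewrite !mxE => ->; by rewrite if_same.
  exists k; rewrite !inE // negbK; apply/eqP/matrixP=> r c; by rewrite !mxE eqxx.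
have : block_sum * sym (1%:M + Y') = 0 by apply: IH.
rewrite main mulrDr mulr_sumr big1 ?addr0 // => i ik.
have [vi|vi] := eqVneq (v i 0) 0; first by rewrite msymbol_Ccol0 ?mulr0 // yE.
have iS2 : S2 i by apply: contraNT vi => /vS ->.
rewrite step //; set m1 := 1%:M - _.
have uC : Ccol i v \in unitmx by rewrite unit_Ccol.
have CL : gl (Ccol i v) \in patgroup X levi.
  apply/patgroupP=> r c rc; rewrite glK // mxE; case: eqP => // ci; rewrite vS.
    by rewrite ci; case: eqP => // ri; rewrite ri ci /levi !eqxx in rc.
  by apply: contra rc => r2; rewrite /levi ci r2 iS2 !S2N1.
have m1m : m1 *m (1%:M + (v i 0)^-1 *: (delta_mx k i *m Y')) = 1%:M.
  rewrite /m1 mulmxBl mul1mx mulmxDr mulmx1 -scalemxAl -scalemxAr -mulmxA.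
  have -> : Y' *m (delta_mx k i *m Y') = 0.
    rewrite mulmxA; have -> : Y' *m delta_mx k i = 0.
      apply/matrixP=> r c; rewrite !mxE big1 // => j _; rewrite !mxE.
      by case: eqP => [_|_]; rewrite ?mul0r ?mulr0.
    by rewrite mul0mx.
  by rewrite mulmx0 !scaler0 addr0 addrK.
have um : m1 \in unitmx by have [] := mulmx1_unit m1m.
have mL : gl m1 \in patgroup X levi.
  apply/patgroupP=> r c rc; rewrite glK // mxE [X in X + _]mxE [X in _ + X]mxE [X in - X]mxE delta_mulE.
  case: (eqVneq r k) => [rk|_]; last by rewrite mul0r mulr0 subr0.
  rewrite Y's ?mulr0 ?subr0 //; apply: contra rc => /andP[_ c1].
  by rewrite /levi rk kS1 c1 !S1N2.
pose Yi := invmx (Ccol i v) *m Y'.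
have CY : Ccol i v *m Yi = Y' by rewrite mulmxA mulmxV // mul1mx.
have m1Y : m1 *m Y' = Y'.
  rewrite /m1 mulmxBl mul1mx -scalemxAl -mulmxA.
  have -> : Y' *m Y' = 0.
    apply/matrixP=> r c; rewrite !mxE big1 // => j _; have [j1|j1] := boolP (S1 j).
      by rewrite [Y' j c]Y's ?mulr0 // /lower_block S1N2.
    by rewrite [Y' r j]Y's ?mul0r // /lower_block (negPf j1) andbF.
  by rewrite mulmx0 scaler0 subr0.
have -> : m1 *m Ccol i v + Y' = (m1 *m Ccol i v) *m (1%:M + Yi).
  by rewrite mulmxDr mulmx1 -mulmxA CY m1Y.
rewrite msymbolM ?unitmx_mul ?um // glM // mulrA block_sum_levi ?groupM // -mulrA IH ?mulr0 //.
- apply: leq_ltn_trans Y'm; apply: subset_leq_card; apply/fintype.subsetP=> j.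
  rewrite !inE; apply: contra => /eqP E.
  by rewrite /Yi colE -mulmxA -colE E mulmx0.
- move=> r c rc; have [r2|r2] := boolP (S2 r).
    rewrite mxE big1 // => j _; rewrite [Y' j c]Y's ?mulr0 //.
    by apply: contra rc => /andP[_ c1]; rewrite /lower_block r2.
  have := congr1 (fun M => M r c) CY; rewrite mxE (bigD1 r) //= big1 ?addr0 => [|j jr].
    rewrite [Y' r c]Y's // mxE eqxx; case: eqP => [ri|_]; last by rewrite mul1r.
    by rewrite ri iS2 in r2.
  rewrite mxE; case: eqP => [->|_]; first by rewrite vS // mul0r.
  by rewrite eq_sym (negPf jr) mul0r.
by apply: contra Y'0 => /eqP Yi0; rewrite -CY Yi0 mulmx0.
Qed.

End Block.

(** * Eigenvectors of the unitriangular group *)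

Section Characters.
Variables (n : nat) (F : finFieldType) (X : glgroup n F) (R : idomainType).
Local Notation G := (glcarrier X).
Local Notation gl := (@gl n F X).
Local Notation mx := 'M[F]_n.
Local Notation A := (galg R G).
Local Notation gb := (@gbasis R G).
Local Notation sc := (@galg_scalar R G).
Local Notation eps := (steinberg_gen X R).
Local Notation Bh := (borel_sum X R).
Local Notation sym := (@msymbol n F X R).
Local Notation PG := (perm_gl X).
Local Notation U := (patgroup X above).
Variable psi : F -> R.
Hypothesis psi0 : psi 0 = 1.
Hypothesis psiD : forall a b, psi (a + b) = psi a * psi b.
Hypothesis psi_nt : exists t, psi t != 1.
Hypothesis R0 : forall m, m.+1%:R != 0 :> R.
Implicit Types (M N D Y B : mx) (g h u v : G) (i j k : 'I_n) (s t : 'S_n).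

Definition superdiag : rel 'I_n := fun i j => j == i.+1 :> nat.
Definition superdiag_supp B := supported superdiag B.
Local Notation sd := superdiag_supp.

(** The linear characters of the unitriangular group: only the entries next to the
    diagonal are additive under multiplication, so [B] is to be supported there. *)
Definition superdiag_char B g : R := psi (\sum_i \sum_j B i j * mval g i j).

Local Notation chi := superdiag_char.

Definition unitri : {group G} := Group (patgroup_group_set X (@above_trans n)).

Local Notation UG := unitri.

Lemma unitriE u : u \in U -> forall i j, (j <= i)%N -> mval u i j = (i == j)%:R.
Proof. by move/patgroupP => H i j ji; rewrite H // /above -leqNgt. Qed.

Lemma superdiag_sumM B u v : sd B -> u \in U -> v \in U ->
  \sum_i \sum_j B i j * mval (u * v)%g i j =
  \sum_i \sum_j B i j * mval u i j + \sum_i \sum_j B i j * mval v i j.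
Proof.
move=> Bs /unitriE uU /unitriE vU; rewrite -big_split; apply: eq_bigr => i _.
rewrite -big_split; apply: eq_bigr => j _ /=.
have [/eqP ij|ij] := boolP (superdiag i j); last by rewrite Bs // !mul0r addr0.
rewrite -mulrDr mvalM mxE; congr (_ * _).
have ji : j != i by apply/eqP=> E; move: ij; rewrite E => /eqP;
  rewrite -{1}[nat_of_ord i]addn0 -addn1 eqn_add2l.
rewrite (bigD1 i) //= (bigD1 j) //= big1 ?addr0 => [|k /andP[ki kj]]; last first.
  have [lik|lki] := leqP k i.
    by rewrite uU // eq_sym (negPf ki) mul0r.
  rewrite vU ?(negPf kj) ?mulr0 //; by rewrite ij.
by rewrite (uU i i) // (vU j j) // !eqxx mul1r mulr1 addrC.
Qed.

Lemma superdiag_charM B u v : sd B -> u \in U -> v \in U -> chi B (u * v)%g = chi B u * chi B v.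
Proof. by move=> Bs uU vU; rewrite /chi superdiag_sumM // psiD. Qed.

Lemma superdiag_char1 B : sd B -> chi B 1%g = 1.
Proof.
move=> Bs; rewrite /chi mval1 big1 ?psi0 // => i _; rewrite big1 // => j _.
rewrite mxE; case: eqP => [<-|_]; last by rewrite mulr0.
by rewrite Bs ?mul0r // /superdiag neq_ltn ltnSn.
Qed.

Lemma superdiag_charV B u : sd B -> u \in U -> chi B u^-1%g * chi B u = 1.
Proof. by move=> Bs uU; rewrite -superdiag_charM ?(@groupV _ UG) // mulVg superdiag_char1. Qed.

Lemma superdiag_char_neq0 B u : sd B -> u \in U -> chi B u != 0.
Proof. by move=> Bs uU; apply/eqP=> E; have := superdiag_charV Bs uU; rewrite E mulr0 => /eqP;
  rewrite eq_sym oner_eq0. Qed.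

Lemma superdiag_suppN B : sd B -> sd (- B).
Proof. by move=> Bs i j ij; rewrite mxE Bs // oppr0. Qed.

Lemma superdiag_charN B u : sd B -> u \in U -> chi (- B) u = chi B u^-1%g.
Proof.
move=> Bs uU; apply: (mulIf (superdiag_char_neq0 Bs uU));
  rewrite superdiag_charV // -psiD -big_split big1 ?psi0 // => i _.
by rewrite -big_split big1 // => j _ /=; rewrite mxE mulNr addNr.
Qed.

(** Up to the factor [#|U|], the idempotent of the character. *)
Definition char_sum B : A := \sum_(u in U) sc (chi B u^-1%g) * gb u.
Local Notation eA := char_sum.
Definition char_vec B : A := eA B * eps.
Local Notation E := char_vec.

Lemma gbasis_char_sum B u : sd B -> u \in U -> gb u * eA B = sc (chi B u) * eA B.
Proof.
move=> Bs uU; rewrite /eA !mulr_sumr [RHS](reindex_inj (mulgI u)) /=.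
apply: eq_big => [v|v vU]; first by rewrite (@groupMl _ UG).
rewrite [LHS]mulrA (galg_scalar_comm _ (gb u)) -[LHS]mulrA gbasisM [in RHS]mulrA -rmorphM invMg superdiag_charM ?(@groupV _ UG) //.
by rewrite mulrC -mulrA superdiag_charV // mulr1.
Qed.

Lemma char_sum_gbasis B u : sd B -> u \in U -> eA B * gb u = sc (chi B u) * eA B.
Proof.
move=> Bs uU; rewrite /eA mulr_suml mulr_sumr [RHS](reindex_inj (mulIg u)) /=.
apply: eq_big => [v|v vU]; first by rewrite (@groupMr _ UG).
rewrite -[LHS]mulrA gbasisM [in RHS]mulrA -rmorphM invMg superdiag_charM ?(@groupV _ UG) //.
by rewrite mulrA [chi B u * _]mulrC superdiag_charV // mul1r.
Qed.

Lemma gbasis_char_vec B u : sd B -> u \in U -> gb u * E B = sc (chi B u) * E B.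
Proof. by move=> Bs uU; rewrite /E mulrA gbasis_char_sum // mulrA. Qed.

(** The translates of [eps] by the unitriangular group span the lattice, and the
    character sum sends each of them to a multiple of one vector: each character
    occurs with multiplicity one. *)
Lemma char_sum_span B x : sd B -> unipotent_span x -> exists a, eA B * x = sc a * E B.
Proof.
move=> Bs [c ->]; exists (\sum_(u in U) c u * chi B u).
rewrite mulr_sumr rmorph_sum mulr_suml; apply: eq_bigr => u uU.
by rewrite [LHS]mulrA (galg_scalar_comm _ (eA B)) -[LHS]mulrA [eA B * _]mulrA char_sum_gbasis // /E rmorphM !mulrA.
Qed.

Lemma char_sum_weight B y : sd B -> (forall u, u \in U -> gb u * y = sc (chi B u) * y) ->
  eA B * y = y *+ #|U|.
Proof.
move=> Bs H; rewrite /eA mulr_suml -sumr_const; apply: eq_bigr => u uU.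
by rewrite -mulrA H // mulrA -rmorphM superdiag_charV // rmorph1 mul1r.
Qed.

(** The form is invariant under the group, so the adjoint of [char_sum B] is the sum
    for the inverse character. *)
Lemma gform_char_vecN B x : sd B -> gform x (E (- B)) = gform (eA B * x) eps.
Proof.
move=> Bs; rewrite /E /eA !mulr_suml gform_sumr gform_suml.
rewrite [RHS](reindex_inj invg_inj) /=.
apply: eq_big => [u|u uU]; first by rewrite (@groupV _ UG).
rewrite -!mulrA gform_scalarl gform_scalarr gform_gbasis invgK superdiag_charN ?invgK //.
by rewrite (@groupV _ UG).
Qed.

Section Factor.
Variables (r1 r2 : rel 'I_n).
Hypotheses (r1T : transitive r1) (r2T : transitive r2).
Hypothesis r12 : forall i j, (i < j)%N = r1 i j (+) r2 i j.
Hypothesis r1u : subrel r1 above.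
Hypothesis r2u : subrel r2 above.

(** The two pattern groups meet trivially and the product of their orders is that
    of [U], because [r1] and [r2] partition the positions above the diagonal. *)
Lemma big_patgroup_factor (V : nmodType) (f : G -> V) :
  \sum_(u in U) f u = \sum_(u in patgroup X r1) \sum_(v in patgroup X r2) f (u * v)%g.
Proof.
pose H := Group (patgroup_group_set X r1T); pose K := Group (patgroup_group_set X r2T).
have sHU : H \subset U by apply/fintype.subsetP => u /patgroupP Hu; apply/patgroupP=> i j ij;
  apply: Hu; apply: contra ij => /r1u.
have sKU : K \subset U by apply/fintype.subsetP => u /patgroupP Hu; apply/patgroupP=> i j ij;
  apply: Hu; apply: contra ij => /r2u.
have HK1 : H :&: K = 1%g.
  apply/trivgP/fintype.subsetP=> u /finset.setIP[/patgroupP h1 /patgroupP h2];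
    apply/finset.set1P.
  apply: mval_inj; rewrite mval1; apply/matrixP=> i j; rewrite mxE.
  have [r1ij|] := boolP (r1 i j); last by move/h1.
  apply: h2; have := r1u r1ij; rewrite /above r12 r1ij; by case: (r2 i j).
have cHK : (#|patgroup X r1| * #|patgroup X r2|)%N = #|U|.
  rewrite !card_patgroup // -expnD; congr (_ ^ _)%N.
  rewrite -cardsUI; have -> : [set p | r1 p.1 p.2] :&: [set p | r2 p.1 p.2] = finset.set0.
    apply/setP=> p; rewrite !inE; have := r12 p.1 p.2; case r1p: (r1 _ _) => //=.
    have := r1u r1p; rewrite /above => ->; by case: (r2 _ _).
  rewrite cards0 addn0; apply: eq_card => p; rewrite !inE /above r12.
  have := r12 p.1 p.2; case r1p: (r1 _ _) => //=.
  have := r1u r1p; rewrite /above => ->; by case: (r2 _ _).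
have HKU : (H * K)%g = U.
  apply/eqP; rewrite eqEcard (mul_subG (G := UG)) //=.
  by rewrite -cHK -(TI_cardMg HK1) leqnn.
pose h (p : G * G) := (p.1 * p.2)%g.
have -> : U = [set h p | p in finset.setX (patgroup X r1) (patgroup X r2)].
  rewrite -HKU; apply/setP=> u; apply/mulsgP/imsetP => [[a b aH bK ->]|[[a b]]].
    by exists (a, b) => //; apply/finset.setXP.
  by case/finset.setXP => aH bK ->; exists a b.
rewrite big_imset /=.
  rewrite pair_big_dep /=; apply: eq_bigl => -[a b].
  by rewrite finset.in_setX.
move=> [a b] [c d] /finset.setXP[aH bK] /finset.setXP[cH dK]; rewrite /h /= => abcd.
have Ecd : (c^-1 * a = d * b^-1)%g by apply: (mulgI c); rewrite mulKVg mulgA -abcd mulgK.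
have : (c^-1 * a)%g \in H :&: K.
  apply/finset.setIP; split; first by rewrite (@groupM _ H) ?(@groupV _ H).
  by rewrite Ecd (@groupM _ K) // (@groupV _ K).
rewrite HK1 => /finset.set1P Eca; have ac : a = c by rewrite -(mulKVg c a) Eca mulg1.
by move: abcd; rewrite ac => /mulgI ->.
Qed.
End Factor.

Lemma galg_scalar_eq0 c (x : A) : c != 0 -> sc c * x = 0 -> x = 0.
Proof.
move=> c0 /ffunP H; apply/ffunP=> g; have := H g; rewrite galg_scalarE !ffunE => /eqP.
by rewrite mulf_eq0 (negPf c0) => /eqP.
Qed.

Lemma nat_neq0 m : (0 < m)%N -> m%:R != 0 :> R.
Proof. by case: m => // m _; apply: R0. Qed.

Lemma q_gt0 : (0 < #|F|)%N.
Proof. by apply/card_gt0P; exists 0. Qed.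

(** * Permuting the coordinates *)

Section Relabel.
Variables (s : 'S_n) (S1 S2 : pred 'I_n) (B : mx).
Hypothesis S12 : forall i j, S1 i -> S2 j -> (i < j)%N /\ (s j < s i)%N.
Hypothesis inv : forall i j, (j < i)%N -> (s i < s j)%N -> S2 i /\ S1 j.

(** The character [B] transported by the permutation matrix of [s], as far as the
    result still concerns the unitriangular group.  The hypotheses on [S1] and
    [S2] say that [s] moves the indices of [S2] in front of those of [S1] and
    changes no other relative order. *)
Definition relabel : mx := \matrix_(i, j) if (i < j)%N then B (s i) (s j) else 0.
Hypotheses (Bs : sd B) (B's : sd relabel).

Let rho1 : rel 'I_n := fun a b => ((a < b) && (s^-1%g a < s^-1%g b))%N.
Let rho2 : rel 'I_n := fun a b => ((a < b) && (s^-1%g b < s^-1%g a))%N.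

Lemma rho1T : transitive rho1.
Proof.
by move=> b a c /andP[ab sab] /andP[bc sbc]; apply/andP; split;
  [apply: ltn_trans bc|apply: ltn_trans sbc].
Qed.

Lemma rho2T : transitive rho2.
Proof.
by move=> b a c /andP[ab sab] /andP[bc sbc]; apply/andP; split;
  [apply: ltn_trans bc|apply: ltn_trans sab].
Qed.

Lemma rho12 i j : (i < j)%N = rho1 i j (+) rho2 i j.
Proof.
rewrite /rho1 /rho2; case: ltnP => //= ij.
case: ltngtP => // /val_inj /perm_inj E; by rewrite E ltnn in ij.
Qed.

Definition relabel_card := #|patgroup X rho1|.

Lemma superdiag_char_relabel u : u \in patgroup X rho1 ->
  (PG s * u * (PG s)^-1)%g \in U /\ chi relabel (PG s * u * (PG s)^-1)%g = chi B u.
Proof.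
move/patgroupP=> uH; split.
  apply/patgroupP=> i j; rewrite /above -leqNgt => ji;
    rewrite perm_gl_conjE uH ?(inj_eq perm_inj) //.
  by rewrite /rho1 !permK negb_and -!leqNgt ji orbT.
congr psi; rewrite (reindex_inj (@perm_inj _ s)) /=.
rewrite [RHS](reindex_inj (@perm_inj _ s)) /= [LHS](reindex_inj (@perm_inj _ s^-1%g)) /=.
apply: eq_bigr => i _; rewrite permKV.
rewrite [RHS](reindex_inj (@perm_inj _ s)) /=.
apply: eq_bigr => j _; rewrite perm_gl_conjE mxE.
case: ltnP => // ji; rewrite mul0r.
have [/eqP sij|sij] := boolP (superdiag (s i) (s j)); last by rewrite Bs ?mul0r.
rewrite uH; last by rewrite /rho1 !permK negb_and -!leqNgt ji orbT.
by rewrite -val_eqE /= sij -[_ == _](eqn_add2l 0) ltn_eqF ?mulr0.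
Qed.

Lemma char_sum_relabel u : u \in patgroup X rho1 ->
  eA relabel * gb (PG s) * gb u = sc (chi B u) * (eA relabel * gb (PG s)).
Proof.
move=> uH; have [uU chiE] := superdiag_char_relabel uH.
have -> : eA relabel * gb (PG s) * gb u = eA relabel * gb (PG s * u * (PG s)^-1)%g * gb (PG s).
  by rewrite -!mulrA !gbasisM mulgKV.
by rewrite char_sum_gbasis // chiE mulrA.
Qed.

Lemma char_sum_block : eA relabel * block_sum X R S1 S2 = eA relabel *+ #|patgroup X (upper_block S1 S2)|.
Proof.
rewrite /block_sum mulr_sumr -sumr_const; apply: eq_bigr => u /patgroupP uH.
rewrite char_sum_gbasis //; last first.
  apply/patgroupP=> i j; rewrite /above => ij; apply: uH; apply: contra ij.
  by case/andP => a b; case: (S12 a b).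
suff -> : chi relabel u = 1 by rewrite rmorph1 mul1r.
rewrite /chi big1 ?psi0 // => i _; rewrite big1 // => j _; rewrite mxE.
case: ltnP => ij; last by rewrite mul0r.
have [bij|] := boolP (upper_block S1 S2 i j); last first.
  by move/uH=> ->; case: eqP => [E'|]; rewrite ?mulr0 // E' ltnn in ij *.
case/andP: bij => a b; have [_ ji] := S12 a b.
by rewrite Bs ?mul0r // /superdiag neq_ltn (ltn_trans ji (ltnSn _)).
Qed.

(** The permutation sends the positions of [rho2] below the diagonal, into the
    block that [block_sum_vanish] kills; the transported character is trivial on
    the opposite block, so [char_sum relabel] absorbs the block sum up to its number of
    terms. *)
Lemma char_sum_vanish v : v \in patgroup X rho2 -> v != 1%g ->
  eA relabel * gb (PG s) * (gb v * eps) = 0.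
Proof.
move=> /patgroupP vH v1; pose w := (PG s * v * (PG s)^-1)%g; pose Y := mval w - 1%:M.
have S12' i j : S1 i -> S2 j -> (i < j)%N by move=> a b; case: (S12 a b).
have Ys : supported (lower_block S1 S2) Y.
  move=> i j ij; rewrite !mxE perm_gl_conjE vH ?(inj_eq perm_inj) ?subrr //.
  apply: contra ij => /andP[]; rewrite !permK => sij ji.
  by have [a b] := inv ji sij; rewrite /lower_block a b.
have Y0 : Y != 0.
  apply: contra_neq v1 => /eqP; rewrite subr_eq0 -(@mval1 _ _ X) => /eqP/mval_inj.
  by rewrite /w => /eqP; rewrite -eq_mulgV1 -[X in _ == X]mulg1 => /eqP/mulgI.
have -> : eA relabel * gb (PG s) * (gb v * eps) = sc ((-1) ^+ s) * (eA relabel * sym (1%:M + Y)).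
  rewrite addrC subrK msymbol_gl mulrA -[eA _ * _ * _]mulrA gbasisM.
  rewrite (_ : (PG s * v = w * PG s)%g); last by rewrite mulgKV.
  rewrite -gbasisM -!mulrA steinberg_gen_perm rmorph_sign.
  by rewrite !mulrA !commr_sign !mulrA.
suff -> : eA relabel * sym (1%:M + Y) = 0 by rewrite mulr0.
apply: (@galg_scalar_eq0 #|patgroup X (upper_block S1 S2)|%:R).
  by apply: nat_neq0; apply/card_gt0P; exists 1%g; apply/patgroupP=> i j _; rewrite mval1 mxE.
rewrite rmorph_nat mulr_natl -mulrnAl -char_sum_block -mulrA block_sum_vanish ?mulr0 //.
Qed.

(** Factor [U] along [rho1] and [rho2].  On the first factor the two characters
    correspond under the permutation, so each element contributes the same term;
    on the second factor only the identity survives [char_sum_vanish]. *)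
Lemma char_vec_relabel : eA relabel * (gb (PG s) * E B) = sc ((-1) ^+ s * relabel_card%:R) * E relabel.
Proof.
have -> : E B = \sum_(u in U) sc (chi B u^-1%g) * (gb u * eps).
  by rewrite /E /eA mulr_suml; apply: eq_bigr => u _; rewrite mulrA.
pose t := eA relabel * gb (PG s) * eps.
rewrite mulrA mulr_sumr (big_patgroup_factor rho1T rho2T rho12); last 2 first.
- by move=> i j /andP[].
- by move=> i j /andP[].
have UH u : u \in patgroup X rho1 -> u \in U.
  by move/patgroupP=> uH; apply/patgroupP=> i j ij; apply: uH; apply: contra ij => /andP[].
transitivity (\sum_(u in patgroup X rho1) t).
  apply: eq_bigr => u uH.
  have K v : eA relabel * gb (PG s) * (sc (chi B (u * v)^-1%g) * (gb (u * v)%g * eps)) =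
      sc (chi B (u * v)^-1%g) * (sc (chi B u) * (eA relabel * gb (PG s) * (gb v * eps))).
    rewrite [LHS]mulrA (galg_scalar_comm _ (eA relabel * gb (PG s))) -[LHS]mulrA; congr (_ * _).
    rewrite -gbasisM -[gb u * _ * _]mulrA [LHS]mulrA char_sum_relabel //.
      exact: (esym (mulrA _ _ _)).
  under eq_bigr => v _ do rewrite K.
  rewrite (bigD1 1%g) /=; last by apply/patgroupP=> i j _; rewrite mval1 mxE.
  rewrite big1 ?addr0 => [|v /andP[vH v1]]; last by rewrite char_sum_vanish // !mulr0.
  by rewrite mulg1 mulrA -rmorphM superdiag_charV ?UH // rmorph1 gbasis1 !mul1r.
rewrite sumr_const /t -mulrA steinberg_gen_perm rmorphM rmorph_nat rmorph_sign.
by rewrite -/relabel_card mulrA commr_sign -!mulrA -/(E relabel) mulr_natl -mulrnAr.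
Qed.

End Relabel.

(** * The form on eigenvectors *)

Lemma borel_sumE g : Bh g = (g \in borelX X)%:R.
Proof.
rewrite /borel_sum /ghat sum_ffunE; have [gB|gB] := boolP (g \in borelX X).
  rewrite (bigD1 g) //= ffunE eqxx big1 ?addr0 // => h /andP[_ /negPf hg].
  by rewrite ffunE eq_sym hg.
by rewrite big1 // => h hB; rewrite ffunE; case: eqP => // gh; rewrite gh hB in gB.
Qed.

Lemma gform_flag g h : gform (gb g * Bh) (gb h * Bh) = (#|borelX X| * ((g^-1 * h)%g \in borelX X))%:R.
Proof.
rewrite gform_gbasis mulrA gbasisM; set b := (g^-1 * h)%g.
have [bB|bB] := boolP (b \in borelX X).
  rewrite gbasis_borel_sum // muln1 -sum1_card natr_sum /gform [RHS]big_mkcond /=.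
  by apply: eq_bigr => k _; rewrite borel_sumE; case: (k \in borelX X); rewrite ?mulr1 ?mulr0.
rewrite muln0 /gform big1 // => k _; rewrite gbasis_mulE !borel_sumE.
have [kB|] := boolP (k \in borelX X); last by rewrite mul0r.
have [bkB|] := boolP (_ \in borelX X); last by rewrite mulr0.
case/negP: bB; have := @groupM _ (borelX_group X) _ _ kB (@groupVr _ (borelX_group X) _ bkB).
by rewrite invMg invgK mulKVg.
Qed.

Definition noninv s : rel 'I_n := fun a b => ((a < b) && (s a < s b))%N.

Lemma noninv_above s : subrel (noninv s) above. Proof. by move=> a b /andP[]. Qed.

Lemma noninv_trans s : transitive (noninv s).
Proof.
by move=> b a c /andP[ab sab] /andP[bc sbc]; apply/andP; split;
  [apply: ltn_trans bc|apply: ltn_trans sbc].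
Qed.

Lemma borelX_diag g i : g \in borelX X -> mval g i i != 0.
Proof.
move=> /borelXP gB; have := mval_unit g; rewrite unitmxE -det_tr det_trig; last first.
  by apply/is_trig_mxP=> a b ab; rewrite mxE gB.
by rewrite unitfE prodf_seq_neq0 => /allP/(_ i (mem_index_enum _)); rewrite mxE.
Qed.

Lemma perm_le_eq s t : (forall i, s i <= t i)%N -> s = t.
Proof.
move=> st; apply/permP=> i; apply: val_inj.
have E' : (\sum_j (t j : nat) = \sum_j (s j : nat))%N.
  transitivity (\sum_(j < n) (j : nat))%N.
    by rewrite [RHS](reindex_inj (@perm_inj _ t)).
  by rewrite [LHS](reindex_inj (@perm_inj _ s)).
have [ts|lt] := leqP (t i) (s i); first by apply/eqP; rewrite eqn_leq st.
have : (\sum_j (s j : nat) < \sum_j (t j : nat))%N.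
  rewrite (bigD1 i) //= [X in (_ < X)%N](bigD1 i) //= -addSn leq_add //.
  by apply: leq_sum => j _; apply: st.
by rewrite E' ltnn.
Qed.

(** Uniqueness in the Bruhat decomposition: the diagonal entries of an element of
    the Borel subgroup are nonzero, and here they are entries of the unitriangular
    [v], so that [s^-1 <= t^-1] pointwise, hence [s = t]. *)
Lemma perm_gl_borelX s t v : v \in U ->
  (((PG s)^-1 * v * PG t)%g \in borelX X) = (s == t) && (v \in patgroup X (noninv s)).
Proof.
move=> vU.
have entry i j : mval ((PG s)^-1 * v * PG t)%g i j = mval v (s^-1%g i) (t^-1%g j).
  by rewrite -perm_glV -{1}(invgK t) perm_glV !mvalM -perm_glV !perm_glE -col_permE -row_permE !mxE.
apply/idP/andP => [H|[/eqP st /patgroupP vs]].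
  have st : s = t.
    apply: invg_inj; apply: perm_le_eq => i; have := borelX_diag i H; rewrite entry.
    apply: contraNT; rewrite -ltnNge => ts; rewrite unitriE ?(ltnW ts) //.
    by rewrite (gtn_eqF ts : (s^-1%g i == t^-1%g i) = false).
  split; first by rewrite st.
  apply/patgroupP=> a b; rewrite /noninv negb_and -!leqNgt => /orP[ba|sba];
    first exact: unitriE.
  have [->|ab] := eqVneq a b; first by rewrite unitriE // eqxx.
  move/borelXP: H => /(_ (s a) (s b)); rewrite entry -st !permK; apply.
  by rewrite ltn_neqAle sba andbT (inj_eq val_inj) (inj_eq perm_inj) eq_sym.
apply/borelXP => i j ji; rewrite entry -st vs.
  by rewrite (inj_eq perm_inj) (gtn_eqF ji : (i == j) = false).
by rewrite /noninv !permKV negb_and -!leqNgt (ltnW ji) orbT.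
Qed.

Lemma gform_unipotent_gen u : u \in U ->
  gform (gb u * eps) eps = (#|borelX X| * \sum_(s : 'S_n) (u \in patgroup X (noninv s)))%:R.
Proof.
move=> uU; rewrite /steinberg_gen mulr_sumr gform_suml big_distrr /= natr_sum.
apply: eq_bigr => s _; rewrite gform_sumr (bigD1 s) //=.
have sg (t : 'S_n) (x y : A) : gform ((-1) ^+ s * x) ((-1) ^+ t * y) =
    (-1) ^+ s * (-1) ^+ t * gform x y.
  have -> : (-1) ^+ s * x = sc ((-1) ^+ s) * x by rewrite rmorph_sign.
  have -> : (-1) ^+ t * y = sc ((-1) ^+ t) * y by rewrite rmorph_sign.
  by rewrite gform_scalarl gform_scalarr mulrA.
have T t : gform (gb u * ((-1) ^+ s * (gb (PG s) * Bh))) ((-1) ^+ t * (gb (PG t) * Bh)) =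
   (-1) ^+ s * (-1) ^+ t * (#|borelX X| * ((s == t) && (u \in patgroup X (noninv s))))%:R.
  have -> : gb u * ((-1) ^+ s * (gb (PG s) * Bh)) = (-1) ^+ s * (gb (u * PG s)%g * Bh).
    by rewrite mulrA commr_sign -mulrA [gb u * _]mulrA gbasisM.
  rewrite sg gform_flag.
  rewrite invMg perm_gl_borelX ?(@groupV _ UG) //.
  by rewrite (@groupV _ (Group (patgroup_group_set X (@noninv_trans s)))).
rewrite T -expr2 sqrr_sign mul1r eqxx big1 ?addr0 // => t /negPf ts.
by rewrite T eq_sym ts muln0 mulr0.
Qed.

(** With [B] on the superdiagonal, [s] has a descent at each position where [B] does
    not vanish. *)
Definition avoids B s := [forall i, forall j, (B i j != 0) ==> ~~ noninv s i j].

(** The value of the form on [E B] and [eps], divided by the order of the Borel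
    subgroup ([gform_char_vec_gen]). *)
Definition gram_num B : nat :=
  \sum_(s : 'S_n | avoids B s)
     #|F| ^ #|[set p : 'I_n * 'I_n | noninv s p.1 p.2]|.

Local Notation Tnum := gram_num.

(** The character is trivial on the pattern group of the noninversions of [s]
    exactly when [s] avoids [B]; otherwise its sum vanishes. *)
Lemma superdiag_char_sum B s : sd B ->
  \sum_(u in patgroup X (noninv s)) chi B u^-1%g =
   (if avoids B s then
     #|F| ^ #|[set p : 'I_n * 'I_n | noninv s p.1 p.2]| else 0)%N%:R.
Proof.
move=> Bs; pose H := Group (patgroup_group_set X (@noninv_trans s)).
have HU u : u \in H -> u \in U.
  by move/patgroupP => Hu; apply/patgroupP=> i j ij; apply: Hu;
    apply: contra ij => /noninv_above.
rewrite (reindex_inj invg_inj) /=.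
have -> : \sum_(u | u^-1%g \in patgroup X (noninv s)) chi B u^-1^-1%g = \sum_(u in H) chi B u.
  by apply: eq_big => [u|u _]; rewrite ?(@groupV _ H) // invgK.
case: ifPn => [/forallP H1|].
  rewrite -(@card_patgroup _ _ X); last exact: noninv_above.
  rewrite -sum1_card natr_sum; apply: eq_bigr => u /patgroupP uH.
  rewrite /chi big1 ?psi0 // => i _; rewrite big1 // => j _.
  have [->|Bij] := eqVneq (B i j) 0; first by rewrite mul0r.
  have := H1 i => /forallP/(_ j); rewrite Bij /= => /uH ->.
  case: eqP => [ij|]; last by rewrite mulr0.
  by move: Bij; rewrite Bs ?eqxx // ij /superdiag neq_ltn ltnSn.
rewrite negb_forall => /existsP[i]; rewrite negb_forall => /existsP[j].
rewrite negb_imply negbK => /andP[Bij nij].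
have [t t1] := psi_nt.
pose Y : mx := (t / B i j) *: delta_mx i j.
have Ys : supported (noninv s) Y.
  move=> a b ab; rewrite !mxE; case: eqP => [ai|_]; last by rewrite mulr0.
  by case: eqP => [bj|_]; rewrite ?mulr0 //; move: ab; rewrite ai bj nij.
pose w := gl (1%:M + Y).
have wH : w \in H by exact: (patgroup_gl X (@noninv_above s) Ys).
have cw : chi B w = psi t.
  congr psi; rewrite glK ?(unit_supported (@noninv_above s)) // (bigD1 i) //= (bigD1 j) //=.
  have ij : i != j by case/andP: nij; rewrite ltn_neqAle => /andP[].
  rewrite big1 => [|b bj]; last first.
    rewrite !mxE (negPf bj) andbF mulr0 addr0; case: eqP => [ib|]; rewrite ?mulr0 //.
    by rewrite -ib Bs ?mul0r // /superdiag neq_ltn ltnSn.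
  rewrite big1 ?addr0 => [|a ai].
    by rewrite !mxE !eqxx (negPf ij) add0r mulr1 mulrC divfK.
  apply: big1 => b _; rewrite !mxE (negPf ai) mulr0 addr0; case: eqP => [->|];
    rewrite ?mulr0 //.
  by rewrite Bs ?mul0r // /superdiag neq_ltn ltnSn.
apply/eqP; have /eqP : (1 - psi t) * \sum_(u in H) chi B u = 0.
  rewrite mulrBl mul1r mulr_sumr [X in X - _](reindex_inj (mulgI w)) /=.
  apply/eqP; rewrite subr_eq0; apply/eqP; apply: eq_big => [u|u];
    rewrite (@groupMl _ H w u wH) // => uH.
  by rewrite superdiag_charM ?HU // cw.
by rewrite mulf_eq0 subr_eq0 eq_sym (negPf t1).
Qed.

(** Expand [E B] over [U] and apply [gform_unipotent_gen]: each permutation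
    contributes a character sum over the pattern group of its noninversions. *)
Lemma gform_char_vec_gen B : sd B -> gform (E B) eps = (#|borelX X| * Tnum B)%:R.
Proof.
move=> Bs; rewrite /E /eA mulr_suml gform_suml.
have K u : u \in U -> gform (sc (chi B u^-1%g) * gb u * eps) eps =
    #|borelX X|%:R * \sum_(s : 'S_n) (if u \in patgroup X (noninv s) then chi B u^-1%g else 0).
  move=> uU; rewrite -mulrA gform_scalarl gform_unipotent_gen // natrM mulrCA natr_sum mulr_sumr.
  by congr (_ * _); apply: eq_bigr => s _; case: ifP; rewrite ?mulr1 ?mulr0.
rewrite (eq_bigr _ K) -mulr_sumr natrM; congr (_ * _).
rewrite exchange_big /= /Tnum natr_sum [RHS]big_mkcond.
apply: eq_bigr => s _; transitivity (\sum_(u in patgroup X (noninv s)) chi B u^-1%g).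
  rewrite -big_mkcondr /=; apply: eq_bigl => u.
  rewrite andb_idl // => /patgroupP uH; apply/patgroupP=> i j ij; apply: uH.
  by apply: contra ij => /noninv_above.
by rewrite superdiag_char_sum //; case: ifP.
Qed.

Lemma char_sum_vec B : sd B -> eA B * E B = E B *+ #|U|.
Proof. by move=> Bs; apply: char_sum_weight => // u uU; rewrite gbasis_char_vec. Qed.

Lemma gformMn (x y : A) m : gform (x *+ m) y = m%:R * gform x y.
Proof.
elim: m => [|m IH]; first by rewrite mulr0n gform0l mul0r.
by rewrite mulrS gformDl IH -addn1 addnC natrD mulrDl mul1r.
Qed.

Lemma gform_char_vec_sum B x : sd B -> gform (E B) (eA (- B) * x) = #|U|%:R * gform (E B) x.
Proof.
move=> Bs; rewrite /eA mulr_suml gform_sumr -sum1_card natr_sum mulr_suml.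
apply: eq_bigr => u uU; rewrite mul1r -mulrA gform_scalarr -[X in gb X](invgK u) -gform_gbasis.
rewrite gbasis_char_vec ?(@groupV _ UG) // gform_scalarl mulrA superdiag_charN ?(@groupV _ UG) // invgK.
by rewrite mulrC [chi B u * _]mulrC superdiag_charV // mulr1.
Qed.

Lemma relabelN s B : relabel s (- B) = - relabel s B.
Proof. by apply/matrixP=> i j; rewrite !mxE; case: ifP; rewrite ?mxE ?oppr0. Qed.

Lemma card_U_gt0 : (0 < #|U|)%N.
Proof. by apply/card_gt0P; exists 1%g; rewrite (@group1 _ UG). Qed.

Lemma card_borelX_gt0 : (0 < #|borelX X|)%N.
Proof. by apply/card_gt0P; exists 1%g; rewrite (@group1 _ (borelX_group X)). Qed.

(** The way back from [relabel s B] to [B] also multiplies by a scalar, since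
    [char_sum_span] leaves no choice; adjointness of the form and
    [char_vec_relabel] for the inverse characters evaluate it as the quotient of
    the two Gram numbers, up to the factor of the direct move. *)
Lemma char_vec_relabel_back s (S1 S2 : pred 'I_n) B :
  (forall i j, S1 i -> S2 j -> (i < j)%N /\ (s j < s i)%N) ->
  (forall i j, (j < i)%N -> (s i < s j)%N -> S2 i /\ S1 j) ->
  sd B -> sd (relabel s B) ->
  exists a, eA B * (gb (PG s)^-1%g * E (relabel s B)) = sc a * E B /\
            a * (Tnum B)%:R = (-1) ^+ s * (relabel_card s)%:R * (Tnum (relabel s B))%:R.
Proof.
move=> S12 inv Bs B's.
have [a aE] : exists a, eA B * (gb (PG s)^-1%g * E (relabel s B)) = sc a * E B.
  by apply: char_sum_span => //; rewrite /E mulrA; apply: left_ideal_span.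
exists a; split=> //.
have mE := char_vec_relabel S12 inv (superdiag_suppN Bs); rewrite relabelN in mE.
have {mE} := congr1 (gform (E (relabel s B))) (mE (superdiag_suppN B's)).
rewrite gform_char_vec_sum // -[X in gb X](invgK (PG s)) -gform_gbasis gform_char_vecN // aE gform_scalarl.
rewrite gform_scalarr gform_char_vecN // char_sum_vec // gformMn !gform_char_vec_gen // !natrM.
set b := #|borelX X|%:R; set c := #|U|%:R => H.
have b0 : b != 0 by exact: nat_neq0 card_borelX_gt0.
have c0 : c != 0 by exact: nat_neq0 card_U_gt0.
apply: (mulfI b0); apply: (mulfI c0).
by rewrite [b * (a * _)]mulrCA H [b * (_ * _ * _)]mulrCA [RHS]mulrCA.
Qed.

Lemma eq_gram_num B (C : mx) : (forall i j, (B i j == 0) = (C i j == 0)) -> Tnum B = Tnum C.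
Proof.
move=> BC; apply: eq_bigl => s; apply: eq_forallb => i; apply: eq_forallb => j.
by rewrite BC.
Qed.

Lemma gram_num_gt0 B : (0 < Tnum B)%N.
Proof.
(* the order-reversing permutation has a descent everywhere *)
pose s : 'S_n := perm (@rev_ord_inj n).
rewrite /Tnum (bigD1 s) /=; first by rewrite addn_gt0 expn_gt0 q_gt0.
apply/forallP=> i; apply/forallP=> j; apply/implyP=> _.
rewrite /noninv !permE /= negb_and -!leqNgt; case: leqP => //= ij.
by apply: leq_sub2l; apply: ltnW.
Qed.

(** A diagonal matrix fixes [eps], and conjugation by it rescales the superdiagonal
    entries by the independent quotients of consecutive diagonal entries. *)
Lemma torus_char_vec B (C : mx) : sd B -> sd C -> (forall i j, (B i j == 0) = (C i j == 0)) ->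
  exists h, gb h * E B = E C.
Proof.
move=> Bs Cs BC.
(* the ratio demanded between the diagonal entries [k.+1] and [k]; the products
   have at most one factor *)
pose r (k : nat) : F := \prod_(i : 'I_n | i == k :> nat) \prod_(j : 'I_n | j == k.+1 :> nat)
   (if B i j == 0 then 1 else C i j / B i j).
have rE i j : superdiag i j -> r i = if B i j == 0 then 1 else C i j / B i j.
  move=> /eqP ij; rewrite /r (bigD1 i) //= [X in _ * X]big1 ?mulr1; last first.
    by move=> i' /andP[/eqP i'i /eqP []]; apply: val_inj.
  rewrite (bigD1 j) ?ij //= big1 ?mulr1 // => j' /andP[/eqP j'i /eqP []].
  by apply: val_inj; rewrite /= ij.
have r0 (k : nat) : r k != 0.
  rewrite /r prodf_seq_neq0; apply/allP=> i _; apply/implyP=> _.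
  rewrite prodf_seq_neq0; apply/allP=> j _; apply/implyP=> _.
  case: ifPn => [_|B0]; first exact: oner_neq0.
  by rewrite mulf_neq0 ?invr_eq0 // -BC.
pose d (i : nat) : F := \prod_(0 <= k < i) r k.
have d0 i : d i != 0.
  by rewrite /d prodf_seq_neq0; apply/allP=> k _; apply/implyP=> _; apply: r0.
pose D : mx := diag_mx (\row_i d i).
have uD : D \in unitmx.
  by rewrite unitmxE det_diag unitfE prodf_seq_neq0; apply/allP=> k _; rewrite mxE /= d0.
pose h := gl D; exists h.
have heps : gb h * eps = eps.
  by apply: steinberg_gen_diag => i j ij; rewrite glK // !mxE (negPf ij).
have conjE u i j : mval (h^-1 * u * h)%g i j = mval u i j * d j / d i.
  have : (h * (h^-1 * u * h) = u * h)%g by rewrite !mulgA mulgV mul1g.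
  move: (h^-1 * u * h)%g => v /(congr1 (fun g => mval g i j)).
  rewrite !mvalM !glK // mul_diag_mx mul_mx_diag !mxE => E'.
  by apply: (mulfI (d0 i)); rewrite E' [RHS]mulrC divfK.
have UC u : ((h^-1 * u * h)%g \in U) = (u \in U).
  apply/patgroupP/patgroupP=> H i j ij; have := H i j ij; rewrite conjE.
    case: eqP => [->|_]; first by rewrite mulfK.
    by move/eqP; rewrite !mulf_eq0 invr_eq0 !(negPf (d0 _)) !orbF => /eqP.
  move=> ->; case: eqP => [->|_]; first by rewrite mul1r divff.
  by rewrite !mul0r.
rewrite /E /eA !mulr_suml mulr_sumr (reindex (fun u => h^-1 * u * h)%g) /=; last first.
  exists (fun u => h * u * h^-1)%g => u _.
    by rewrite !mulgA mulgV mul1g mulgK.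
  by rewrite !mulgA mulVg mul1g mulgKV.
apply: eq_big => u; rewrite UC // => uU.
have -> : chi B (h^-1 * u * h)^-1%g = chi C u^-1%g.
  rewrite -!superdiag_charN ?UC //; congr psi; apply: eq_bigr => i _; apply: eq_bigr => j _.
  have [ij|ij] := boolP (superdiag i j); last by rewrite !mxE Bs // Cs // oppr0 !mul0r.
  rewrite conjE !mxE (eqP ij) /d big_nat_recr //= (rE i j ij).
  have [B0|B0] := eqVneq (B i j) 0.
    by have := BC i j; rewrite B0 eqxx => /esym/eqP ->; rewrite oppr0 !mul0r.
  have := d0 i; rewrite /d; move: (\prod_(0 <= k < i) r k) => P P0; field; by rewrite B0 P0.
rewrite [LHS]mulrA [gb h * _]mulrA (galg_scalar_comm _ (gb h)) -!mulrA; congr (_ * _).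
by rewrite -[in RHS]heps !mulrA !gbasisM !mulgA mulgV mul1g.
Qed.

(** * Links between eigenvectors *)

(** Satisfied by the preimages in the group algebra of the submodules of the
    lattice and of its reduction. *)
Definition left_closed (Z : A -> Prop) := Z 0 /\ forall a x y, Z x -> Z y -> Z (a * x + y).

Lemma left_closedM Z a x : left_closed Z -> Z x -> Z (a * x).
Proof. by case=> Z0 ZM Zx; rewrite -[a * x]addr0; apply: ZM. Qed.

Definition linked B C := forall Z, left_closed Z -> Z (E B) -> Z (E C).

Lemma linked_trans B C D : linked B C -> linked C D -> linked B D.
Proof. by move=> BC CD Z ZL /(BC Z ZL)/(CD Z ZL). Qed.

Lemma linked_refl B : linked B B. Proof. by []. Qed.

Lemma linked_torus B (C : mx) : sd B -> sd C ->
  (forall i j, (B i j == 0) = (C i j == 0)) -> linked B C.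
Proof.
move=> Bs Cs /(torus_char_vec Bs Cs)[h hE] Z ZL ZB.
by rewrite -hE; apply: left_closedM.
Qed.

Section Link.
Variable l : nat.
Hypothesis l_prime : prime l.
Hypothesis natU : forall m, ~~ (l %| m)%N -> m%:R \is a @GRing.unit R.
Hypothesis lq : ~~ (l %| #|F|)%N.

Lemma relabel_card_unit s : (relabel_card s)%:R \is a @GRing.unit R.
Proof.
rewrite /relabel_card card_patgroup; last by move=> i j /andP[].
apply: natU; rewrite Euclid_dvdX // negb_and lq //.
Qed.

Lemma left_closed_unit c Z x : c \is a GRing.unit -> left_closed Z -> Z (sc c * x) -> Z x.
Proof.
move=> cU ZL /(left_closedM (sc c^-1) ZL).
by rewrite mulrA -rmorphM mulVr // rmorph1 mul1r.
Qed.

(** The direct move multiplies by a power of [q], a unit; the move back multiplies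
    by a quotient of Gram numbers, a unit if these have equal valuations. *)
Lemma linked_relabel s (S1 S2 : pred 'I_n) B :
  (forall i j, S1 i -> S2 j -> (i < j)%N /\ (s j < s i)%N) ->
  (forall i j, (j < i)%N -> (s i < s j)%N -> S2 i /\ S1 j) ->
  sd B -> sd (relabel s B) -> linked B (relabel s B) /\
  (logn l (Tnum B) = logn l (Tnum (relabel s B)) -> linked (relabel s B) B).
Proof.
move=> S12 inv Bs B's; split=> [Z ZL ZB|Tl Z ZL ZB].
  apply: (@left_closed_unit ((-1) ^+ s * (relabel_card s)%:R)) => //.
    by rewrite unitrM relabel_card_unit unitrX // unitrN1.
  rewrite -(char_vec_relabel S12 inv Bs B's); apply: left_closedM => //; exact: left_closedM.
have [a [aE aT]] := char_vec_relabel_back S12 inv Bs B's.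
apply: (@left_closed_unit a) => //; last first.
  by rewrite -aE; apply: left_closedM => //; exact: left_closedM.
have [m mU Tm] := pfactor_coprime l_prime (gram_num_gt0 B).
have [m' m'U Tm'] := pfactor_coprime l_prime (gram_num_gt0 (relabel s B)).
have lm : ~~ (l %| m)%N by rewrite -prime_coprime // coprime_sym coprime_sym.
have lm' : ~~ (l %| m')%N by rewrite -prime_coprime // coprime_sym coprime_sym.
move: aT; rewrite Tm Tm' -Tl !natrM !mulrA => /mulIf aT.
have : a * m%:R \is a GRing.unit.
  rewrite aT; last by apply: nat_neq0; rewrite expn_gt0 prime_gt0.
  by rewrite !unitrM (natU lm') relabel_card_unit unitrX // unitrN1.
by rewrite unitrM => /andP[].
Qed.

Definition pattern_mx (J : nat -> bool) : mx := \matrix_(i, j) (superdiag i j && J i)%:R.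

Lemma pattern_mx_supp J : sd (pattern_mx J).
Proof. by move=> i j ij; rewrite mxE (negPf ij). Qed.

Lemma eq_pattern_mx (J J' : nat -> bool) : (forall i : nat, (i.+1 < n)%N -> J i = J' i) ->
  pattern_mx J = pattern_mx J'.
Proof.
move=> JJ; apply/matrixP=> i j; rewrite !mxE /superdiag; case: eqP => //= ij.
by rewrite JJ // -ij.
Qed.

(** Only the support of [B] matters, by [linked_torus]. *)
Lemma linked_pattern_mx B : sd B -> exists J, linked B (pattern_mx J) /\
  linked (pattern_mx J) B /\ Tnum B = Tnum (pattern_mx J).
Proof.
move=> Bs; pose J (k : nat) := [exists i : 'I_n, [exists j : 'I_n, (i == k :> nat) &&
  (B i j != 0)]].
have S i j : (B i j == 0) = (pattern_mx J i j == 0).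
  rewrite mxE; have [ij|ij] := boolP (superdiag i j); last by rewrite Bs // !eqxx.
  have -> : J i = (B i j != 0).
    apply/existsP/idP => [[i' /existsP[j' /andP[/eqP/val_inj ->]]]|Bij].
      move=> Bij'; have : superdiag i j' by apply: contraNT Bij' => /Bs ->.
      by move=> /eqP ij'; suff -> : j = j' by []; apply: val_inj; rewrite /= ij' (eqP ij).
    by exists i; apply/existsP; exists j; rewrite eqxx.
  by case: eqP; rewrite ?eqxx // oner_eq0.
exists J; split; last split.
- exact: (linked_torus Bs (pattern_mx_supp J) S).
- by apply: (linked_torus (pattern_mx_supp J) Bs) => i j; rewrite S.
exact: eq_gram_num.
Qed.

Section Swap.
Variables (a x y : nat) (J : nat -> bool).
Hypotheses (x0 : (0 < x)%N) (y0 : (0 < y)%N) (axy : (a + (x + y) <= n)%N).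
Hypothesis Ja : forall i : nat, i.+1 = a -> J i = false.
Hypothesis Jaxy : forall i : nat, i.+1 = (a + (x + y))%N -> J i = false.

(** The exchange of the adjacent intervals of lengths [x] and [y] that start at
    [a].  A descent required between the two intervals is lost, so that a part
    [x + y] of a composition is split into [y] and [x], while two neighbouring
    parts [x], [y] are exchanged. *)
Definition swap_pattern (i : nat) : bool :=
  if (a <= i < a + y)%N then (i.+1 < a + y)%N && J (i + x)%N
  else if (a + y <= i < a + (x + y))%N then (i.+1 < a + (x + y))%N && J (i - y)%N
  else J i.

Definition swap_fun (i : nat) : nat :=
  if (a <= i < a + y)%N then (i + x)%N
  else if (a + y <= i < a + (x + y))%N then (i - y)%N else i.

Lemma swap_fun_lt (i : nat) : (i < n)%N -> (swap_fun i < n)%N.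
Proof. by rewrite /swap_fun; do ?[case: ifP => ?]; lia. Qed.

Lemma swap_fun_inj : injective swap_fun.
Proof. move=> i j; rewrite /swap_fun; do ?[case: ifP => ?]; lia. Qed.

Definition swap_ord (i : 'I_n) : 'I_n := Ordinal (swap_fun_lt (ltn_ord i)).

Lemma swap_ord_inj : injective swap_ord.
Proof. by move=> i j H; apply: val_inj; exact: (@swap_fun_inj i j (congr1 (@nat_of_ord n) H)).
  Qed.

Definition swap_perm : 'S_n := perm swap_ord_inj.

Lemma swap_permE i : swap_perm i = swap_fun i :> nat.
Proof. by rewrite permE. Qed.

Lemma relabel_swap : relabel swap_perm (pattern_mx J) = pattern_mx swap_pattern.
Proof.
apply/matrixP=> i j; rewrite !mxE /superdiag !swap_permE; case: ltnP => ij; last first.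
  by case: eqP => //= E'; rewrite E' ltnn in ij.
congr (nat_of_bool _)%:R.
move: (i : nat) (j : nat) (ltn_ord i) (ltn_ord j) ij => {i j} i j ilt jlt ij.
rewrite /swap_pattern /swap_fun.
have [C1|C1] := boolP (a <= i < a + y)%N.
  have [C2|C2] := boolP (a <= j < a + y)%N; first by congr (_ && _); lia.
  have [C3|C3] := boolP (a + y <= j < a + (x + y))%N; first by lia.
  case: eqP => [E'|_] /=; last by lia.
  by rewrite Jaxy //; lia.
have [C2|C2] := boolP (a + y <= i < a + (x + y))%N.
  have [C3|C3] := boolP (a <= j < a + y)%N; first by lia.
  have [C4|C4] := boolP (a + y <= j < a + (x + y))%N; first by lia.
  by lia.
have [C3|C3] := boolP (a <= j < a + y)%N.
  case: eqP => [E'|_] /=; last by case: eqP => // E'; rewrite Ja //; lia.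
  by lia.
have [C4|C4] := boolP (a + y <= j < a + (x + y))%N; last by [].
case: eqP => [E'|_] /=; first by rewrite Ja //; lia.
by lia.
Qed.

Lemma linked_swap : linked (pattern_mx J) (pattern_mx swap_pattern) /\
  (logn l (Tnum (pattern_mx J)) = logn l (Tnum (pattern_mx swap_pattern)) ->
    linked (pattern_mx swap_pattern) (pattern_mx J)).
Proof.
rewrite -relabel_swap.
apply: (@linked_relabel swap_perm (fun i => (a <= i < a + y)%N) (fun i =>
  (a + y <= i < a + (x + y))%N)).
- by move=> i j; rewrite !swap_permE /swap_fun => C1 C2; rewrite C1; case: ifP; rewrite ?C2;
  lia.
- by move=> i j; rewrite !swap_permE /swap_fun; do ?[case: ifP => ?]; lia.
- exact: pattern_mx_supp.
by rewrite relabel_swap; exact: pattern_mx_supp.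
Qed.

End Swap.

Lemma gram_numE J : Tnum (pattern_mx J) = descent_enum #|F| J n.
Proof.
have Ea s : #|[set p : 'I_n * 'I_n | noninv s p.1 p.2]| = noninversions s.
  rewrite /noninversions pair_bigA /= -sum1_card big_mkcond /=; apply: eq_bigr => p _.
  by rewrite inE /noninv; case: (_ && _).
rewrite /Tnum /descent_enum; apply: eq_big => [s|s _]; last by rewrite Ea.
apply: eq_forallb => i; apply: eq_forallb => j; rewrite mxE /superdiag /noninv.
case: (eqVneq (j : nat) i.+1) => [ij|_] /=; last by rewrite eqxx.
case: (J i); rewrite ?eqxx // oner_neq0 /= ij ltnSn /= -leqNgt leq_eqVlt.
rewrite (inj_eq val_inj) (inj_eq perm_inj); case: eqP => //= ji.
by move: ij; rewrite ji; lia.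
Qed.

Definition valid (al : seq nat) := all (leq 1) al && (sumn al == n).

(** The Gram number is the q-multinomial coefficient of [al]. *)
Lemma logn_gram_num al : valid al ->
  (logn l (Tnum (pattern_mx (comp_desc al))) + \sum_(x <- al) qfact_val #|F| l x = qfact_val #|F| l n)%N.
Proof.
move=> /andP[al0 /eqP aln]; rewrite gram_numE.
have := descent_enum_composition #|F| al0; rewrite aln => HT.
have g0 m : (0 < qfact #|F| m)%N.
  by rewrite /qfact prodn_gt0 // => i; apply: qint_gt0.
rewrite /qfact_val -HT lognM.
- congr (_ + _)%N; elim: (al) => [|x be IH]; first by rewrite !big_nil logn1.
  rewrite !big_cons lognM ?IH // prodn_cond_gt0 //.
- by rewrite -gram_numE gram_num_gt0.
by rewrite prodn_cond_gt0.
Qed.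

(** Mutual generation; it relates all lists, valid or not, so as to be an equivalence
    relation. *)
Definition linked_seq al be := valid al = valid be /\
  (valid al -> linked (pattern_mx (comp_desc al)) (pattern_mx (comp_desc be)) /\
    linked (pattern_mx (comp_desc be)) (pattern_mx (comp_desc al))).

Lemma linked_seq_refl al : linked_seq al al. Proof. by split=> // _; split;
  apply: linked_refl. Qed.

Lemma linked_seq_sym al be : linked_seq al be -> linked_seq be al.
Proof. by case=> E' H; split=> // v; have [] := H (etrans E' v). Qed.

Lemma linked_seq_trans al be ga : linked_seq al be -> linked_seq be ga -> linked_seq al ga.
Proof.
move=> [E1 H1] [E2 H2]; split; first by rewrite E1.
move=> v; have [h1 h2] := H1 v; have [h3 h4] := H2 (etrans (esym E1) v).
by split; [apply: linked_trans h3|apply: linked_trans h2].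
Qed.

(** [mid] is either the part [x + y], to be split, or the neighbours [x] and [y], to
    be exchanged; in both cases [swap_pattern] gives the pattern of the result. *)
Lemma linked_seq_swap pre (mid : seq nat) x y post : (0 < x)%N -> (0 < y)%N ->
  mid = [:: x; y] \/ mid = [:: (x + y)%N] ->
  (\sum_(z <- mid) qfact_val #|F| l z = qfact_val #|F| l x + qfact_val #|F| l y)%N ->
  linked_seq (pre ++ mid ++ post) (pre ++ y :: x :: post).
Proof.
move=> x0 y0 mE vE.
have summ : sumn mid = (x + y)%N by case: mE => ->; rewrite /= ?addn0.
have vv : valid (pre ++ mid ++ post) = valid (pre ++ y :: x :: post).
  rewrite /valid !all_cat !sumn_cat summ /= x0 y0; congr (_ && _).
    by case: mE => -> /=; rewrite ?x0 ?y0 ?addn_gt0 ?x0.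
  by congr (_ == _); lia.
split=> // v; have [al0 /eqP aln] := andP v.
have v' := v; rewrite vv in v'.
pose J := comp_desc (pre ++ mid ++ post).
have axy : (sumn pre + (x + y) <= n)%N.
  by rewrite -aln !sumn_cat summ; lia.
have Jmid (i : nat) : (i < x + y)%N -> comp_desc mid i = (i.+1 < x + y)%N && ((mid == [:: x;
  y]) ==> (i.+1 != x)).
  case: mE => -> /= iq.
    rewrite eqxx /=; case: ltnP => ix; first by lia.
    have -> : (i - x < y)%N by lia.
    lia.
  by rewrite iq eqseq_cons andbF andbT.
have Ja (i : nat) : i.+1 = sumn pre -> J i = false.
  by move=> E'; rewrite /J comp_desc_cat -E' ltnSn comp_desc_last // E'.
have Jaxy (i : nat) : i.+1 = (sumn pre + (x + y))%N -> J i = false.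
  move=> E'; rewrite /J comp_desc_cat; case: ltnP => H; first by lia.
  rewrite comp_desc_cat summ; case: ltnP => H'; last by lia.
  by rewrite Jmid //; lia.
have cutE : pattern_mx (swap_pattern (sumn pre) x y J) = pattern_mx (comp_desc (pre ++ y :: x :: post)).
  apply: eq_pattern_mx => i _; rewrite /swap_pattern /J !comp_desc_cat summ /=.
  have [C1|C1] := boolP (sumn pre <= i < sumn pre + y)%N.
    have [H|H] := ltnP i (sumn pre); first by lia.
    have [H2|H2] := ltnP (i + x) (sumn pre); first by lia.
    have [H3|H3] := ltnP (i - sumn pre) y; last by lia.
    have [H4|H4] := ltnP (i + x - sumn pre) (x + y); last by lia.
    rewrite Jmid //; case: (mid == _) => /=; lia.
  have [C2|C2] := boolP (sumn pre + y <= i < sumn pre + (x + y))%N.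
    have [H|H] := ltnP i (sumn pre); first by lia.
    have [H2|H2] := ltnP (i - y) (sumn pre); first by lia.
    have [H3|H3] := ltnP (i - sumn pre) y; first by lia.
    have [H4|H4] := ltnP (i - y - sumn pre) (x + y); last by lia.
    have [H5|H5] := ltnP (i - sumn pre - y) x; last by lia.
    rewrite Jmid //; case: (mid == _) => /=; lia.
  have [H|H] := ltnP i (sumn pre); first by [].
  have [H3|H3] := ltnP (i - sumn pre) y; first by lia.
  have [H4|H4] := ltnP (i - sumn pre) (x + y); first by lia.
  have [H5|H5] := ltnP (i - sumn pre - y) x; first by lia.
  by congr comp_desc; lia.
have [h1 h2] := linked_swap x0 y0 axy Ja Jaxy; rewrite cutE in h1 h2.
split=> //; apply: h2.
have := logn_gram_num v; rewrite -(logn_gram_num v') !big_cat !big_cons /= vE.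
by rewrite [(qfact_val #|F| l x + _)%N]addnC -[(qfact_val #|F| l y + _ + _)%N]addnA => /addIn.
Qed.

Variable e : nat.
Hypotheses (q1 : (1 < #|F|)%N) (e2 : (1 < e)%N) (le : (l %| qint #|F| e)%N).
Hypothesis emin : forall i : nat, (1 < i)%N -> (l %| qint #|F| i)%N -> (e <= i)%N.
Let d := logn l (qint #|F| e).
Hypothesis hN : (d <= l /\ n %/ e <= d * l)%N \/ (d = l.+1 /\ n %/ e <= l ^ 2)%N \/
     (l.+1 < d /\ n %/ e < l ^ 2 + l)%N.

(** The moves of [linked_seq_swap] are reversible when they preserve the valuation
    of the Gram number, which is the case for all exchanges of neighbours and for
    the splittings without carry; [link_of_val] concludes. *)
Lemma linked_of_val B C : sd B -> sd C -> logn l (Tnum B) = logn l (Tnum C) -> linked B C.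
Proof.
move=> Bs Cs TBC.
have [J1 [B1 [B2 TB]]] := linked_pattern_mx Bs; have [J2 [C1 [C2 TC]]] := linked_pattern_mx Cs.
have [al [al0 aln alJ]] := comp_desc_surj n J1; have [be [be0 ben beJ]] := comp_desc_surj n J2.
have EB : pattern_mx J1 = pattern_mx (comp_desc al) by apply: eq_pattern_mx => i ilt;
  rewrite alJ.
have EC : pattern_mx J2 = pattern_mx (comp_desc be) by apply: eq_pattern_mx => i ilt;
  rewrite beJ.
have va : valid al by rewrite /valid al0 aln eqxx.
have vb : valid be by rewrite /valid be0 ben eqxx.
apply: (linked_trans B1); apply: linked_trans C2; rewrite EB EC.
suff [_ H] : linked_seq al be by have [] := H va.
have Lswap pre x y post : (0 < x)%N -> (0 < y)%N ->
    linked_seq (pre ++ x :: y :: post) (pre ++ y :: x :: post).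
  move=> x0 y0; apply: (linked_seq_swap (mid := [:: x; y]) pre post x0 y0); first by left.
  by rewrite !big_cons big_nil addn0.
have Lsplit pre x y post : (0 < x)%N -> (0 < y)%N ->
    qfact_val #|F| l (x + y) = (qfact_val #|F| l x + qfact_val #|F| l y)%N ->
    linked_seq (pre ++ (x + y)%N :: post) (pre ++ y :: x :: post).
  move=> x0 y0 vxy.
  apply: (linked_seq_swap (mid := [:: (x + y)%N]) pre post x0 y0); first by right.
  by rewrite big_seq1.
apply: (link_of_val l_prime lq q1 e2 le emin linked_seq_refl linked_seq_sym linked_seq_trans Lswap Lsplit hN al0 be0 aln ben).
have := logn_gram_num va; have := logn_gram_num vb.
rewrite -EB -EC -TB -TC TBC; lia.
Qed.

End Link.

(** * Eigenvectors in subquotients *)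

Section Weight.
Hypothesis card_field_unit : #|F|%:R \is a @GRing.unit R.

Definition cols_from (k : nat) : rel 'I_n := fun i j => ((i < j) && (k <= j))%N.
Definition col_at (k : 'I_n) : rel 'I_n := fun i j => ((i < j)%N && (j == k)).
Definition top_block (k : nat) : rel 'I_n := fun i j => ((i < k) && (j < k))%N.

Lemma cols_from_above (k : nat) : subrel (cols_from k) above. Proof. by move=> i j /andP[]. Qed.
Lemma col_at_above k : subrel (col_at k) above. Proof. by move=> i j /andP[]. Qed.

Lemma sub_patgroup r r' u : subrel r r' -> u \in patgroup X r -> u \in patgroup X r'.
Proof. by move=> rr /patgroupP uH; apply/patgroupP=> i j ij; apply: uH; apply: contra ij;
  apply: rr. Qed.

Lemma top_block_group_set (k : nat) : group_set (patgroup X (top_block k)).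
Proof.
by apply: patgroup_group_set => j i m /andP[ik _] /andP[_ mk]; apply/andP.
Qed.

Lemma character_sum (k : nat) (c : 'I_n -> F) :
  \sum_(b : 'cV[F]_n) psi (- \sum_(i : 'I_n | (i < k)%N) b i 0 * c i) =
  if [forall i : 'I_n, (i < k)%N ==> (c i == 0)] then (#|F| ^ n)%N%:R else 0.
Proof.
case: ifPn => [/forallP H|].
  under eq_bigr => b _.
    rewrite big1 ?oppr0 ?psi0 => [|i ik]; last first.
      by have := H i; rewrite ik => /eqP ->; rewrite mulr0.
    over.
  by rewrite sumr_const card_mx muln1.
rewrite negb_forall => /existsP[i0]; rewrite negb_imply => /andP[ik ci].
have [t t1] := psi_nt.
(* translation by [b0] multiplies the sum by [psi t], which is not [1] *)
pose b0 : 'cV[F]_n := - (t / c i0) *: delta_mx i0 0.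
have bE : - \sum_(i : 'I_n | (i < k)%N) b0 i 0 * c i = t.
  rewrite (bigD1 i0) //= big1 ?addr0 => [|i /andP[_ ii]].
    by rewrite !mxE !eqxx mulr1 mulNr opprK divfK.
  by rewrite !mxE (negPf ii) mulr0 mul0r.
apply/eqP; set S := \sum_b _; have /eqP : (1 - psi t) * S = 0.
  rewrite mulrBl mul1r {1}/S (reindex_inj (addrI b0)) /= /S mulr_sumr.
  apply/eqP; rewrite subr_eq0; apply/eqP; apply: eq_bigr => b _.
  rewrite -psiD -bE -opprD -big_split; congr (psi (- _)); apply: eq_bigr => i _.
  by rewrite mxE mulrDl.
by rewrite mulf_eq0 subr_eq0 eq_sym (negPf t1).
Qed.

Variables Z1 Z2 : A -> Prop.
Hypotheses (Z1L : left_closed Z1) (Z2L : left_closed Z2).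

Lemma left_closed_sum (Z : A -> Prop) I (r : seq I) (P : pred I) (f : I -> A) :
  left_closed Z -> (forall a, P a -> Z (f a)) -> Z (\sum_(a <- r | P a) f a).
Proof.
move=> ZL Zf; apply: big_ind => //; first by case: ZL.
by move=> x y Zx Zy; case: ZL => _ H; rewrite -[x]mul1r; apply: H.
Qed.

Lemma mval_mul_fix (u g : G) i j :
  (forall l, mval g l j != 0 -> mval u i l = (i == l)%:R) ->
  mval (u * g)%g i j = mval g i j.
Proof.
move=> H; rewrite mvalM mxE (bigD1 i) //= big1 ?addr0 => [|l li].
  have [g0|/H ->] := eqVneq (mval g i j) 0; first by rewrite g0 mulr0.
  by rewrite eqxx mul1r.
have [g0|/H ->] := eqVneq (mval g l j) 0; first by rewrite g0 mulr0.
by rewrite eq_sym (negPf li) mul0r.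
Qed.

Lemma conj_fix (u g : G) i j :
  (forall i l, mval g l j != 0 -> mval u i l = (i == l)%:R) ->
  mval (g^-1 * u * g)%g i j = (i == j)%:R.
Proof.
move=> H; rewrite -mulgA mvalM mxE.
under eq_bigr => l _ do rewrite (@mval_mul_fix u g l j (H l)).
by have := congr1 (fun h => mval h i j) (mulVg g); rewrite /= mvalM mval1 !mxE => ->.
Qed.

Lemma top_block_col (k : nat) (g : G) i j : g \in patgroup X (top_block k) -> (k <= j)%N ->
  mval g i j = (i == j)%:R.
Proof. by move=> /patgroupP gH kj; apply: gH; rewrite /top_block [(j < k)%N]ltnNge kj andbF.
  Qed.

Lemma top_block_row (k : nat) (g : G) i j : g \in patgroup X (top_block k) -> (k <= i)%N ->
  mval g i j = (i == j)%:R.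
Proof. by move=> /patgroupP gH ki; apply: gH; rewrite /top_block [(i < k)%N]ltnNge ki. Qed.

Lemma top_blockV (k : nat) (g : G) : g \in patgroup X (top_block k) ->
  (g^-1)%g \in patgroup X (top_block k).
Proof. by move=> gH; exact: (@groupVr _ (Group (top_block_group_set k)) g gH). Qed.

Lemma top_block_conj (k : nat) (g u : G) i j : g \in patgroup X (top_block k) -> (k <= i)%N ->
  (k <= j)%N ->
  mval (g^-1 * u * g)%g i j = mval u i j.
Proof.
move=> gH ki kj; rewrite mvalM mxE (bigD1 j) //= big1 ?addr0 => [|m mj]; last first.
  by rewrite (top_block_col _ gH) // (negPf mj) mulr0.
rewrite (top_block_col _ gH) // eqxx mulr1 mvalM mxE (bigD1 i) //= big1 ?addr0 => [|m mi].
  by rewrite (top_block_row _ (top_blockV gH)) // eqxx mul1r.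
by rewrite (top_block_row _ (top_blockV gH)) // eq_sym (negPf mi) mul0r.
Qed.

Lemma cols_fromE (k : nat) u i j : u \in patgroup X (cols_from k) -> (j < k)%N ->
  mval u i j = (i == j)%:R.
Proof. by move=> /patgroupP uH jk; apply: uH; rewrite /cols_from [(k <= j)%N]leqNgt jk andbF.
  Qed.

Lemma cols_from_conj (k : 'I_n) (g u : G) : g \in patgroup X (top_block k) ->
  u \in patgroup X (cols_from k.+1) ->
  (g^-1 * u * g)%g \in patgroup X (cols_from k.+1).
Proof.
move=> gH uH; apply/patgroupP=> i j ij; have [jk|kj] := leqP j k.
  apply: conj_fix => a b; have [kb|bk] := leqP b k; first by move=> _; apply: (cols_fromE _ uH).
  by rewrite (top_block_row _ gH) ?(ltnW bk) // (gtn_eqF (leq_ltn_trans jk bk) :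
    (b == j) = false) eqxx.
have ji : (j <= i)%N by move: ij; rewrite /cols_from kj andbT -leqNgt.
have ki := leq_trans kj ji.
by rewrite (top_block_conj _ gH) ?(ltnW kj) ?(ltnW ki) // unitriE // (sub_patgroup (@cols_from_above _) uH).
Qed.

Lemma superdiag_char_top_block (k : 'I_n) (g u : G) B : sd B ->
  g \in patgroup X (top_block k) -> u \in patgroup X (cols_from k.+1) ->
  chi B (g^-1 * u * g)%g = chi B u.
Proof.
move=> Bs gH uH; congr psi; apply: eq_bigr => i _; apply: eq_bigr => j _.
have [/eqP ij|ij] := boolP (superdiag i j); last by rewrite Bs // !mul0r.
congr (_ * _); have [jk|kj] := leqP j k.
  by rewrite (cols_fromE _ uH) // (cols_fromE _ (cols_from_conj gH uH)).
by apply: (top_block_conj _ gH); rewrite ?(ltnW kj) //; move: kj; rewrite ij ltnS.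
Qed.

Lemma cols_from_conjU (k : nat) (v u : G) : v \in U -> u \in patgroup X (cols_from k) ->
  (v^-1 * u * v)%g \in patgroup X (cols_from k).
Proof.
move=> vU uH; have uU := sub_patgroup (@cols_from_above _) uH.
have wU : (v^-1 * u * v)%g \in U by rewrite !(@groupM _ UG) ?(@groupV _ UG).
apply/patgroupP=> i j ij; have [jk|kj] := ltnP j k.
  apply: conj_fix => a b; have [kb|bk] := ltnP b k; first by move=> _; apply: (cols_fromE _ uH).
  by rewrite (unitriE vU) ?(ltnW (leq_trans jk bk)) // (gtn_eqF (leq_trans jk bk) :
    (b == j) = false) eqxx.
by apply: (unitriE wU); move: ij; rewrite /cols_from kj andbT -leqNgt.
Qed.

Lemma superdiag_char_conjU u v B : sd B -> v \in U -> u \in U ->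
  chi B (v^-1 * u * v)%g = chi B u.
Proof.
move=> Bs vU uU; rewrite !superdiag_charM ?(@groupM _ UG) ?(@groupV _ UG) //.
by rewrite mulrAC superdiag_charV // mul1r.
Qed.

Lemma col_at_trans k : transitive (col_at k).
Proof. by move=> b a c /andP[ab /eqP bk] /andP[bc /eqP ck]; rewrite bk ck ltnn in bc. Qed.

Lemma col_at_mul (k : 'I_n) u v i : u \in patgroup X (col_at k) ->
  v \in patgroup X (col_at k) -> (i < k)%N ->
  mval (u * v)%g i k = mval u i k + mval v i k.
Proof.
move=> /patgroupP uH /patgroupP vH ik; rewrite mvalM mxE (bigD1 k) //= (bigD1 i) /=; last first.
  by apply: contraTneq ik => ->; rewrite ltnn.
rewrite big1 ?addr0 => [|m /andP[mk mi]].
  rewrite (vH k k) ?(uH i i) ?eqxx ?mulr1 ?mul1r // /col_at ltnn //.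
by rewrite (uH i m) ?[i == m]eq_sym ?(negPf mi) ?mul0r // /col_at (negPf mk) andbF.
Qed.

Definition eigen_on (r : rel 'I_n) B (y : A) := forall u, u \in patgroup X r ->
  gb u * y = sc (chi B u) * y.

Lemma col_at_decomp (k : 'I_n) u : u \in patgroup X (cols_from k) -> exists a v,
  [/\ a \in patgroup X (col_at k), v \in patgroup X (cols_from k.+1) & u = (a * v)%g].
Proof.
move=> uH; pose N : mx := \matrix_(i, j) (if (i < j)%N && (j == k) then mval u i j else 0).
have Ns : supported (col_at k) N by move=> i j ij; rewrite mxE; move: ij;
  rewrite /col_at => /negPf ->.
pose a := gl (1%:M + N).
have aH : a \in patgroup X (col_at k) by apply: patgroup_gl => //; apply: col_at_above.
have aU : a \in U by apply: sub_patgroup aH; apply: col_at_above.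
have aE i j : mval a i j = (i == j)%:R + N i j.
  by rewrite glK ?(unit_supported (@col_at_above k)) // !mxE.
have uU : u \in U := sub_patgroup (@cols_from_above _) uH.
have ak i : mval u i k = mval a i k.
  rewrite aE mxE eqxx andbT; case: ltnP => [ik|ki].
    by rewrite (ltn_eqF ik : (i == k) = false) add0r.
  by rewrite addr0 (unitriE uU).
exists a, (a^-1 * u)%g; split=> //; last by rewrite mulKVg.
have vU : (a^-1 * u)%g \in U by rewrite (@groupM _ UG) ?(@groupV _ UG).
apply/patgroupP=> i j ij; have [kj|jk] := ltnP k j.
  by apply: (unitriE vU); move: ij; rewrite /cols_from kj andbT -leqNgt.
have col_eq l : mval u l j = mval a l j.
  have [jk'|jk'] := eqVneq j k; first by rewrite jk' ak.
  rewrite (cols_fromE _ uH); last by rewrite ltn_neqAle jk andbT.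
  by rewrite aE mxE (negPf jk') andbF addr0.
rewrite mvalM mxE; under eq_bigr => l _ do rewrite col_eq.
by have := congr1 (fun h => mval h i j) (mulVg a); rewrite /= mvalM mval1 !mxE => ->.
Qed.

(** An eigenvector for the columns after [k] that is also one for column [k], with a
    character of that column that concerns only the entry next to the diagonal:
    the two characters combine into a superdiagonal one. *)
Lemma eigen_on_glue (k : 'I_n) B (c : F) (y : A) :
  sd B -> (c != 0 -> (0 < k)%N) -> eigen_on (cols_from k.+1) B y ->
  (forall u, u \in patgroup X (col_at k) ->
     gb u * y = sc (psi (c * \sum_(i : 'I_n | i.+1 == k :> nat) mval u i k)) * y) ->
  exists B', sd B' /\ eigen_on (cols_from k) B' y.
Proof.
move=> Bs ck yE yA.
pose B' : mx := \matrix_(i, j) if j == k then c *+ (i.+1 == k :> nat) else B i j.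
have B's : sd B'.
  move=> i j ij; rewrite mxE; case: eqP => [jk|_]; last exact: Bs.
  by move: ij; rewrite /superdiag jk eq_sym => /negPf ->; rewrite mulr0n.
exists B'; split=> // u uH; have [a [v [aH vH ->]]] := col_at_decomp uH.
have aU := sub_patgroup (@col_at_above k) aH; have vU := sub_patgroup (@cols_from_above _) vH.
have cv : chi B' v = chi B v.
  congr psi; apply: eq_bigr => i _; apply: eq_bigr => j _; rewrite mxE.
  case: eqP => [->|//]; rewrite (cols_fromE _ vH) //.
  case: (eqVneq i k) => [->|_]; last by rewrite !mulr0.
  rewrite [B k k]Bs; last by rewrite /superdiag neq_ltn ltnSn.
  by rewrite (gtn_eqF (ltnSn k)) mulr0n.
have ca : chi B' a = psi (c * \sum_(i : 'I_n | i.+1 == k :> nat) mval a i k).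
  congr psi; rewrite mulr_sumr [RHS]big_mkcond; apply: eq_bigr => i _.
  rewrite (bigD1 k) //= big1 ?addr0 => [|j jk]; last first.
    move/patgroupP: aH => ->; last by rewrite /col_at (negPf jk) andbF.
    case: eqP => [->|_]; last by rewrite mulr0.
    by rewrite B's ?mul0r // /superdiag neq_ltn ltnSn.
  by rewrite mxE eqxx; case: eqP => _; rewrite ?mulr1n // mulr0n mul0r.
rewrite -gbasisM -mulrA yE // mulrA (galg_scalar_comm _ (gb a)) -mulrA yA // superdiag_charM // mulrA -rmorphM.
by rewrite ca cv mulrC.
Qed.

(** The positions above the diagonal in column [k] form an abelian group; as [q] is a
    unit, [y] is a combination of its components [z b] for the characters of this
    group, and one of them stays outside [Z1].  If the character [b] is not
    trivial, an element of the block of the first [k] coordinates carries it to the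
    one that reads the entry next to the diagonal, and commutes with what was
    achieved on the later columns. *)
Lemma weight_step (k : 'I_n) B y : sd B -> Z2 y -> ~ Z1 y -> eigen_on (cols_from k.+1) B y ->
  exists B' y', [/\ sd B', Z2 y', ~ Z1 y' & eigen_on (cols_from k) B' y'].
Proof.
move=> Bs y2 y1 yE.
pose pair (b : 'cV[F]_n) u := \sum_(i : 'I_n | (i < k)%N) b i 0 * mval u i k.
pose z b := \sum_(u in patgroup X (col_at k)) sc (psi (- pair b u)) * (gb u * y).
have AU u : u \in patgroup X (col_at k) -> u \in U by apply: sub_patgroup; apply: col_at_above.
pose AG := Group (patgroup_group_set X (@col_at_trans k)).
have z2 b : Z2 (z b).
  by apply: left_closed_sum => // u _; apply: left_closedM => //; apply: left_closedM.
have [b zb] : exists b, ~ Z1 (z b).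
  apply: contrapT => H; apply: y1.
  apply: (@left_closed_unit (#|F| ^ n)%N%:R) => //; first by rewrite natrX unitrX.
  have <- : \sum_b z b = sc (#|F| ^ n)%N%:R * y.
    rewrite /z exchange_big /=; under eq_bigr =>
      u _ do rewrite -mulr_suml -rmorph_sum character_sum.
    rewrite (bigD1 1%g) /=; last exact: (@group1 _ AG).
    rewrite big1 ?addr0 => [|u /andP[uH u1]].
      case: ifPn => [_|/negP[]]; first by rewrite gbasis1 mul1r.
      apply/forallP=> i; apply/implyP=> ik; rewrite mval1 mxE.
      by rewrite (ltn_eqF ik : (i == k) = false).
    case: ifPn => [/forallP H0|_]; last by rewrite rmorph0 mul0r.
    case/eqP: u1; apply: mval_inj; rewrite mval1; apply/matrixP=> i j; rewrite mxE.
    have [ij|ij] := boolP (col_at k i j); last by move/patgroupP: uH => ->.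
    case/andP: ij => ij /eqP jk; have := H0 i; rewrite -jk ij => /eqP ->.
    by rewrite (ltn_eqF ij : (i == j) = false).
  by apply: left_closed_sum => // b _; apply: contrapT => zb; apply: H; exists b.
have zE : eigen_on (cols_from k.+1) B (z b).
  move=> u uH; rewrite /z !mulr_sumr; apply: eq_bigr => a aH.
  have Eua : gb u * (gb a * y) = sc (chi B u) * (gb a * y).
    have conj_a : (u * a = a * (a^-1 * u * a))%g by rewrite !mulgA mulgV mul1g.
    have wH := cols_from_conjU (AU _ aH) uH.
    rewrite mulrA gbasisM conj_a -gbasisM -[LHS]mulrA (yE _ wH).
    by rewrite superdiag_char_conjU ?(AU _ aH) ?(sub_patgroup (@cols_from_above _) uH) // mulrA (galg_scalar_comm _ (gb a)) -mulrA.
  rewrite [LHS]mulrA (galg_scalar_comm _ (gb u)) -[LHS]mulrA Eua [LHS]mulrA [RHS]mulrA -!rmorphM.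
  by rewrite mulrC.
have zA w : w \in patgroup X (col_at k) -> gb w * z b = sc (psi (pair b w)) * z b.
  move=> wH; rewrite /z !mulr_sumr [RHS](reindex_inj (mulgI w)) /=.
  apply: eq_big => [a|a aH]; first by rewrite (@groupMl _ AG w a wH).
  have -> : pair b (w * a)%g = pair b w + pair b a.
    by rewrite /pair -big_split; apply: eq_bigr => i ik; rewrite col_at_mul // mulrDr.
  rewrite [LHS]mulrA (galg_scalar_comm _ (gb w)) -[LHS]mulrA [gb w * _]mulrA gbasisM [RHS]mulrA -rmorphM -psiD.
  by rewrite opprD addNKr.
have [/forallP b0|] := boolP [forall i : 'I_n, (i < k)%N ==> (b i 0 == 0)].
  have [||B' [B's zE']] := @eigen_on_glue k B 0 (z b) Bs _ zE; first by rewrite eqxx.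
    move=> u uH; rewrite zA // mul0r /pair big1 // => i ik.
    by have := b0 i; rewrite ik => /eqP ->; rewrite mul0r.
  by exists B', (z b).
rewrite negb_forall => /existsP[i0]; rewrite negb_imply => /andP[ik bi].
have kp0 : (k.-1 < n)%N by apply: leq_ltn_trans (leq_pred _) (ltn_ord k).
pose kp := Ordinal kp0; have kpk : kp.+1 = k by rewrite /= prednK // (leq_ltn_trans _ ik).
pose b' : 'cV[F]_n := \col_i (if (i < k)%N then b i 0 else 0).
(* [M] is invertible and its row [k-1] is [b] cut to the first [k] entries; conjugation by it turns the
   pairing with [b] into the reading of the entry [(k-1, k)] *)
pose M : mx := row_perm (tperm i0 kp) (Ccol i0 b')^T.
have uM : M \in unitmx.
  by rewrite /M row_permE unitmx_mul unitmx_perm unitmx_tr unit_Ccol mxE ik.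
have ME i j : M i j = if tperm i0 kp i == i0 then b' j 0 else (tperm i0 kp i == j)%:R.
  by rewrite /M !mxE; case: eqP => // _; rewrite eq_sym.
pose g := gl M; have gE : mval g = M by rewrite glK.
have gH : g \in patgroup X (top_block k).
  apply/patgroupP=> i j; rewrite gE ME /top_block negb_and -!leqNgt => ij.
  have kpl : (kp < k)%N by rewrite -kpk.
  have tk : (tperm i0 kp i < k)%N = (i < k)%N.
    by case: tpermP => [->|->|//]; rewrite ?ik ?kpl.
  have [ti|ti] := eqVneq (tperm i0 kp i) i0.
    have ilt : (i < k)%N by rewrite -tk ti.
    move: ij; rewrite leqNgt ilt /= => kj; rewrite mxE ltnNge kj /=.
    by rewrite (ltn_eqF (leq_trans ilt kj) : (i == j) = false).
  have [ki|ilt] := leqP k i.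
    rewrite tpermD //; first by apply: contraTneq ki => <-; rewrite -ltnNge.
    by apply: contraTneq ki => <-; rewrite -ltnNge.
  move: ij; rewrite leqNgt ilt /= => kj.
  rewrite -tk in ilt.
  rewrite (ltn_eqF (leq_trans ilt kj) : (tperm i0 kp i == j) = false).
  by rewrite tk in ilt; rewrite (ltn_eqF (leq_trans ilt kj) : (i == j) = false).
have gkp j : mval g kp j = if (j < k)%N then b j 0 else 0.
  by rewrite gE ME tpermR eqxx mxE.
have conjg_g u : (u * g = g * (g^-1 * u * g))%g by rewrite !mulgA mulgV mul1g.
have [|||B' [B's zE']] := @eigen_on_glue k B 1 (gb g * z b) Bs.
- by move=> _; rewrite -kpk.
- move=> u uH; rewrite mulrA gbasisM conjg_g -gbasisM -[LHS]mulrA (zE _ (cols_from_conj gH uH)).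
  by rewrite (superdiag_char_top_block Bs gH uH) mulrA (galg_scalar_comm _ (gb g)) mulrA.
- move=> u uH; rewrite mul1r (big_pred1 kp); last first.
    by move=> i; rewrite -kpk eqSS.
  have wH : (g^-1 * u * g)%g \in patgroup X (col_at k).
    apply/patgroupP=> i j ij; have uP := patgroupP _ _ uH.
    have [jk|jk] := eqVneq j k.
      have ki : (k <= i)%N by move: ij; rewrite /col_at jk eqxx andbT -leqNgt.
      rewrite (top_block_conj _ gH) ?jk // uP // /col_at eqxx andbT -leqNgt //.
    apply: conj_fix => a m gm; apply: uP; rewrite /col_at.
    suff /negPf -> : m != k by rewrite andbF.
    by apply: contraNneq gm => ->; rewrite (top_block_row _ gH) // [k == j]eq_sym (negPf jk) ?eqxx.
  rewrite mulrA gbasisM conjg_g -gbasisM -[LHS]mulrA (zA _ wH) mulrA (galg_scalar_comm _ (gb g)) mulrA.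
  congr (sc (psi _) * _ * _).
  have := congr1 (fun h => mval h kp k) (conjg_g u); rewrite /= mvalM.
  rewrite mxE (bigD1 k) //= big1 ?addr0 => [|m mk]; last first.
    by rewrite (top_block_col _ gH) // (negPf mk) mulr0.
  rewrite (top_block_col _ gH) // eqxx mulr1 => ->.
  rewrite mvalM mxE /pair big_mkcond; apply: eq_bigr => i _; rewrite gkp.
  by case: ifP; rewrite ?mul0r.
exists B', (gb g * z b); split=> //; first exact: left_closedM.
move=> /(left_closedM (gb g^-1%g) Z1L); rewrite mulrA gbasisM mulVg gbasis1 mul1r.
exact: zb.
Qed.

(** The columns are treated from the last to the first by [weight_step]. *)
Lemma weight_exists y : Z2 y -> ~ Z1 y -> exists B y',
  [/\ sd B, Z2 y', ~ Z1 y' & forall u, u \in U -> gb u * y' = sc (chi B u) * y'].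
Proof.
move=> y2 y1.
suff H (m : nat) : (m <= n)%N -> exists B y', [/\ sd B, Z2 y',
  ~ Z1 y' & eigen_on (cols_from (n - m)) B y'].
  have [B [y' [Bs y'2 y'1 yE]]] := H n (leqnn n).
  exists B, y'; split=> // u uU; apply: yE; apply: sub_patgroup uU => i j.
  by rewrite /above /cols_from subnn andbT.
elim: m => [|m IH] mn.
  exists 0, y; split=> //; first by move=> i j _; rewrite mxE.
  move=> u /patgroupP uH; have -> : u = 1%g.
    apply: mval_inj; rewrite mval1; apply/matrixP=> i j; rewrite mxE; apply: uH.
    by rewrite /cols_from subn0 [(n <= j)%N]leqNgt ltn_ord andbF.
  rewrite gbasis1 /superdiag_char big1 ?psi0 ?rmorph1 // => i _; rewrite big1 // => j _.
  by rewrite mxE mul0r.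
have [B [y' [Bs y'2 y'1 yE]]] := IH (ltnW mn).
have kn : (n - m.+1 < n)%N by lia.
apply: (@weight_step (Ordinal kn) B y') => //=.
by have -> : (n - m.+1).+1 = (n - m)%N by lia.
Qed.

End Weight.

End Characters.

(** * Roots of unity and units in the coefficient ring *)

(** Any nonzero linear form to the prime field, followed by exponentiation of the
    root of unity. *)
Lemma additive_character (F : finFieldType) (R : idomainType) (p : nat) (z : R) :
  p \in [pchar F] -> p.-primitive_root z ->
  exists psi : F -> R, [/\ psi 0 = 1, forall a b, psi (a + b) = psi a * psi b &
     exists t, psi t != 1].
Proof.
move=> chF pz; have pp := pcharf_prime chF.
pose L : fieldExtType 'F_p := pPrimeCharType chF.
have d0 : (0 < \dim {:L})%N by rewrite adim_gt0.
pose i0 := Ordinal d0.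
pose phi (x : F) : 'F_p := coord (vbasis {:L}) i0 (x : L).
pose psi (x : F) : R := z ^+ (phi x : nat).
exists psi; split.
- by rewrite /psi /phi (linear0 (coord (vbasis {:L}) i0)).
- move=> a b; rewrite /psi /phi (linearD (coord (vbasis {:L}) i0)) -exprD.
  rewrite -[RHS](prim_expr_mod pz); congr (z ^+ _).
  by rewrite /=; congr (_ %% _)%N; apply: Fp_cast.
exists ((vbasis {:L})`_i0 : F).
rewrite /psi /phi coord_free ?eqxx; last exact: (basis_free (vbasisP _)).
rewrite /= modn_small; last by rewrite Fp_cast // prime_gt1.
rewrite expr1; apply/eqP => z1; have := eq_prim_root_expr pz 1 0; rewrite z1 !expr1n eqxx.
by rewrite eqn_mod_dvd // subn0 dvdn1 => /esym/eqP p1; rewrite p1 in pp.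
Qed.

Lemma is_submoduleP (A : pzRingType) (V : lmodType A) (X : set V) :
  is_submodule X <-> (X 0 /\ forall a x y, X x -> X y -> X (a *: x + y)).
Proof.
split=> [[X0 XM]|[X0 XM]]; split.
- by move: X0; rewrite inE.
- by move=> a x y Xx Xy; have := XM a x y; rewrite !inE; apply.
- by rewrite inE.
by move=> a x y; rewrite !inE => Xx Xy; apply: XM.
Qed.

Section Local.
Variables (R : idomainType) (l : nat).
Hypothesis Rloc : local_with_maximal_ideal [set l%:R * r | r in [set: R]]%classic.
Local Open Scope classical_set_scope.

Lemma one_notin_max r : (1 : R) <> l%:R * r.
Proof.
move=> E; have [/is_submoduleP[_ XM] [_ X1] _] := (Rloc _).2 erefl.
apply: X1 => x _; exists (x * r) => //.
by rewrite mulrCA -E mulr1.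
Qed.

(** A nonunit lies in a maximal ideal, obtained from the Zorn lemma, which is
    [l R]. *)
Lemma local_unit (b : R) : (forall r, b <> l%:R * r) -> b \is a GRing.unit.
Proof.
move=> bl; apply: contrapT => bU.
(* the union with [b R] keeps the empty chain within [P] *)
pose bR : set R^o := [set y | exists r, y = r * b].
pose P (J : set R^o) := is_submodule (J `|` bR) /\ ~ (J `|` bR) 1.
have b1 : ~ bR 1 by move=> [r E]; apply: bU; apply/unitrP; exists r; split; [|rewrite mulrC];
  exact: (esym E).
have bRs : is_submodule bR.
  apply/is_submoduleP; split; first by exists 0; rewrite mul0r.
  by move=> a _ _ [r ->] [s ->]; exists (a * r + s); rewrite mulrDl -mulrA.
have [|J [[Js J1] Jmax]] := @Zorn_bigcup _ P.
  move=> FF FP tot; have [[X0 FX0]|F0] := pselect (exists X, FF X); last first.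
    have -> : \bigcup_(X in FF) X = set0.
      by apply/seteqP; split=> // x [X FX _]; apply: F0; exists X.
    by rewrite /P set0U.
  split; last first.
    move=> [[X FX X1]|//]; have [_] := FP _ FX; apply; by left.
  have up x : (\bigcup_(X in FF) X `|` bR) x -> exists2 X, FF X & (X `|` bR) x.
    by move=> [[X FX Xx]|bx]; [exists X => //; left|exists X0 => //; right].
  apply/is_submoduleP; split; first by right; have /is_submoduleP[] := bRs.
  move=> a x y /up[X FX Xx] /up[Y FY Yy].
  suff [W FW [Wx Wy]] : exists2 W, FF W & (W `|` bR) x /\ (W `|` bR) y.
    have [/is_submoduleP[_ /(_ a x y Wx Wy) [h|h]] _] := FP _ FW; last by right.
    by left; exists W.
  case: (tot _ _ FX FY) => s.
    by exists Y => //; split=> //; case: Xx => [/s|]; [left|right].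
  by exists X => //; split=> //; case: Yy => [/s|]; [left|right].
suff JE : J `|` bR = [set l%:R * r | r in [set: R]].
  have : (J `|` bR) b by right; exists 1; rewrite mul1r.
  by rewrite JE => -[r _ E]; apply: (bl r).
apply/Rloc; split=> //.
  by split=> // H; apply: J1; apply: H.
move=> Z Zs JZ _; have [Z1|Z1] := pselect (Z 1).
  right; apply/seteqP; split=> // x _.
  have /is_submoduleP[Z0 ZM] := Zs; have := ZM x 1 0 Z1 Z0.
  by rewrite addr0 /GRing.scale /= mulr1.
left; have ZbR : Z `|` bR = Z by apply/setUidPl => x bx; apply: JZ; right.
apply/seteqP; split=> //; apply: contrapT => ZJ.
apply: (Jmax Z); last by rewrite /P ZbR.
split; first by move=> x Jx; apply: JZ; left.
by move=> H; apply: ZJ => x /H; left.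
Qed.

(** Bezout: [m] is invertible modulo [l], so it cannot lie in [l R]. *)
Lemma nat_unit (m : nat) : prime l -> ~~ (l %| m)%N -> m%:R \is a @GRing.unit R.
Proof.
move=> lp lm; apply: local_unit => r mr.
have m0 : (0 < m)%N by rewrite lt0n; apply: contraNneq lm => ->.
have cml : coprime m l by rewrite coprime_sym prime_coprime.
have [u v E _] := egcdnP l m0; rewrite (eqP cml) in E.
apply: (@one_notin_max (u%:R * r - v%:R)).
rewrite mulrBr mulrCA -mr -!natrM E natrD mulnC addrC addKr //.
Qed.

End Local.

Local Open Scope classical_set_scope.

(** * The Jantzen filtration *)

Lemma composition_series_of_steps (A : pzRingType) (V : lmodType A)
    (D : nat -> set V) (N : nat) :
  D 0%N = setT -> (forall c, D c.+1 `<=` D c) -> (forall c, (N <= c)%N -> D c = [set 0]) ->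
  (forall c, D c.+1 = D c \/ is_maximal_submodule (D c.+1) (D c)) ->
  composition_series_up_to_repetition D.
Proof.
move=> D0 Dd DN Ds; split=> //.
suff H k : exists m (M : nat -> set V), [/\ M 0%N = setT, M m = D k,
    forall i, (i < m)%N -> is_maximal_submodule (M i.+1) (M i) &
    forall Y, (exists2 i, (i <= m)%N & M i = Y) <-> exists2 i, (i <= k)%N & D i = Y].
  have [m [M [M0 Mm Ms MD]]] := H N; exists m, M; split.
    by split=> //; rewrite Mm DN.
  apply/seteqP; split=> Y.
    move=> [i /= im MY]; have [|j _ DY] := (MD Y).1; first by exists i.
    by exists j.
  move=> [j _ DY]; have [|i im MY] := (MD Y).2; last by exists i.
  case: (leqP j N) => jN; first by exists j.
  by exists N => //; rewrite -DY !DN // ltnW.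
elim: k => [|k [m [M [M0 Mm Ms MD]]]].
  exists 0%N, D; split=> //.
have [Dk|Dk] := Ds k.
  exists m, M; rewrite Dk; split=> // Y; split=> [/MD[i ik <-]|[i ik <-]].
    by exists i => //; rewrite (leq_trans ik).
  apply/MD; move: ik; rewrite leq_eqVlt => /orP[/eqP ->|ik]; last by exists i.
  by exists k => //; rewrite Dk.
exists m.+1, (fun i => if (i <= m)%N then M i else D k.+1); split.
- by [].
- by rewrite ltnn.
- move=> i im; rewrite -[(i <= m)%N]ltnS im; have [{}im|mi] := ltnP i m; first exact: Ms.
  have -> : i = m by apply/eqP; rewrite eqn_leq mi -ltnS im.
  by rewrite Mm.
move=> Y; split=> [[i]|[i]].
  rewrite leq_eqVlt => /orP[/eqP -> |im]; first by rewrite ltnn => <-; exists k.+1.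
  rewrite -ltnS im => MY; have [|j jk DY] := (MD Y).1; first by exists i.
  by exists j => //; rewrite (leq_trans jk).
rewrite leq_eqVlt => /orP[/eqP ->|ik] <-; first by exists m.+1 => //; rewrite ltnn.
have [|j jm MY] := (MD (D i)).2; first by exists i.
by exists j; rewrite ?jm // ltnW.
Qed.

Section ScaledJantzen.
Variables (gT : finGroupType) (R : idomainType) (eps : galg R gT) (b l c : nat).

(** The filtration for the form multiplied by [b]; with [b] the order of the Borel
    subgroup it avoids fractions ([jantzen_scaled]). *)
Definition scaled_jantzen : set (left_ideal_type eps) :=
  [set x | forall y : left_ideal_type eps, exists r,
     gform (left_ideal_val x) (left_ideal_val y) = b%:R * (l%:R ^+ c * r)].

Definition scaled_jantzen_mod : set (modl (left_ideal_type eps) l) :=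
  [set to_modl l (x + y *+ l) | x in scaled_jantzen & y in setT].

End ScaledJantzen.

Section Jantzen.
Variables (n : nat) (F : finFieldType) (X : glgroup n F) (R : idomainType).
Local Notation G := (glcarrier X).
Local Notation mx := 'M[F]_n.
Local Notation A := (galg R G).
Local Notation gb := (@gbasis R G).
Local Notation sc := (@galg_scalar R G).
Local Notation eps := (steinberg_gen X R).
Local Notation U := (patgroup X above).
Variable psi : F -> R.
Hypothesis psi0 : psi 0 = 1.
Hypothesis psiD : forall a b, psi (a + b) = psi a * psi b.
Hypothesis psi_nt : exists t, psi t != 1.
Hypothesis R0 : forall m, m.+1%:R != 0 :> R.
Variable l : nat.
Hypothesis l_prime : prime l.
Hypothesis Rloc : local_with_maximal_ideal [set l%:R * r | r in [set: R]].
Hypothesis lq : ~~ (l %| #|F|)%N.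
Variable e : nat.
Hypotheses (q1 : (1 < #|F|)%N) (e2 : (1 < e)%N) (le : (l %| qint #|F| e)%N).
Hypothesis emin : forall i : nat, (1 < i)%N -> (l %| qint #|F| i)%N -> (e <= i)%N.
Let d := logn l (qint #|F| e).
Hypothesis hN : (d <= l /\ n %/ e <= d * l)%N \/ (d = l.+1 /\ n %/ e <= l ^ 2)%N \/
     (l.+1 < d /\ n %/ e < l ^ 2 + l)%N.
Implicit Types (B C : mx).
Local Notation sd := (@superdiag_supp n F).
Local Notation chi := (@superdiag_char n F X R psi).
Local Notation E := (@char_vec n F X R psi).
Local Notation eA := (@char_sum n F X R psi).
Local Notation Tnum := (@gram_num n F).

Local Notation I := (left_ideal_type eps).
Local Notation L := (modl I l).
Local Notation val := (@left_ideal_val _ eps).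

Local Notation jant := (@scaled_jantzen G R eps #|borelX X| l).
Local Notation jmod := (@scaled_jantzen_mod G R eps #|borelX X| l).

Definition lifted (S : set L) : A ->
  Prop := fun a => exists2 x : I, val x = a & S (to_modl l x).

Lemma ideal_valD (x y : I) : val (x + y) = val x + val y. Proof. by []. Qed.
Lemma ideal_valZ (a : A) (x : I) : val (a *: x) = a * val x. Proof. by []. Qed.
Lemma ideal_valMn (x : I) m : val (x *+ m) = val x *+ m.
Proof. by elim: m => [|m IH]; rewrite ?mulr0n // !mulrS ideal_valD IH. Qed.

Lemma ideal_val_span (x : I) : unipotent_span (val x).
Proof. by case: x => x /= /asboolP[a ->]; apply: left_ideal_span. Qed.

Lemma mem_ideal (a : A) : exists x : I, val x = a * eps.
Proof. by have H : a * eps \in left_ideal eps; [apply/asboolP; exists a|exists (LeftIdeal H)].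
  Qed.

Lemma lifted_closed S : is_submodule S -> left_closed (lifted S).
Proof.
move=> /is_submoduleP[S0 SM]; split; first by exists 0; rewrite ?raddf0.
move=> a _ _ [x <- Sx] [y <- Sy]; exists (a *: x + y); first by rewrite ideal_valD ideal_valZ.
by have := SM (gred l a) _ _ Sx Sy; rewrite [gred l a *: _](@to_modl_scale R G l I a x) -raddfD.
Qed.

Lemma lifted_val S (x : I) : lifted S (val x) -> S (to_modl l x).
Proof. by case=> y /val_inj ->. Qed.

Lemma lifted_mul_l S (x : I) : is_submodule S -> lifted S (val x *+ l).
Proof.
move=> /is_submoduleP[S0 _]; exists (x *+ l); first exact: ideal_valMn.
suff -> : to_modl l (x *+ l) = 0 by [].
by rewrite -(raddf0 (to_modl l)); apply/eqP/modlP; exists x; rewrite subr0.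
Qed.

Lemma card_field_unit : #|F|%:R \is a @GRing.unit R.
Proof. exact: nat_unit Rloc _ l_prime lq. Qed.

Lemma card_unitri_unit : #|U|%:R \is a @GRing.unit R.
Proof. by rewrite card_patgroup // natrX unitrX // card_field_unit. Qed.

(** The eigenvector [y'] given by [weight_exists] satisfies
    [#|U| y' = char_sum B * y' = a E B].  Here [a] is a unit: otherwise [l] divides
    [a], hence [y'] is a multiple of [l] in the lattice, and lies in every lifted
    submodule. *)
Lemma char_vec_separates (S1 S2 : set L) v : is_submodule S1 -> is_submodule S2 ->
  S2 v -> ~ S1 v -> exists B, [/\ sd B, lifted S2 (E B) & ~ lifted S1 (E B)].
Proof.
move=> H1 H2; have [x ->] := to_modl_surj v => S2x S1x.
have L1 := lifted_closed H1; have L2 := lifted_closed H2.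
have [||B [y' [Bs [y y'E S2y] S1y yE]]] :=
  weight_exists psi0 psiD psi_nt card_field_unit L1 L2 (y := val x).
- by exists x.
- by move/lifted_val.
subst y'; have wE := char_sum_weight psi0 psiD Bs yE.
have [a aE] := char_sum_span psi0 psiD Bs (ideal_val_span y).
have scMn m (z : A) : z *+ m = sc m%:R * z by rewrite rmorph_nat mulr_natl.
have aU : a \is a GRing.unit.
  apply: (local_unit Rloc) => r ar; apply: S1y.
  apply: (left_closed_unit card_unitri_unit L1); rewrite -scMn -wE aE ar rmorphM rmorph_nat.
  have [z zE] := mem_ideal (sc r * eA B).
  rewrite -mulrA mulr_natl /char_vec mulrA -zE; exact: lifted_mul_l.
exists B; split=> //.
  apply: (left_closed_unit aU L2); rewrite -aE wE scMn; apply: left_closedM => //.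
  by exists y.
move=> /(left_closedM (sc a) L1); rewrite -aE wE scMn.
by move/(left_closed_unit card_unitri_unit L1).
Qed.

(** On the spanning set of translates [u * eps], the form with [E B] takes the value
    [gram_num B] up to a unit and the order of the Borel subgroup, which gives one
    direction.  Conversely, applying [char_sum B] to [E B = x + l y] with [x] in
    the filtration term makes [gram_num B] times a unit divisible by [l ^ c]. *)
Lemma char_vec_jantzen c B : sd B -> lifted (jmod c) (E B) <-> (l ^ c %| Tnum B)%N.
Proof.
have b0 : #|borelX X|%:R != 0 :> R by apply: nat_neq0 => //; apply: card_borelX_gt0.
have l0 : l%:R != 0 :> R by apply: nat_neq0 => //; apply: prime_gt0.
move=> Bs; split.
  case=> x0 x0E [x xc [y _ xyE]].
  have /eqP/modlP[z zE] := xyE.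
  have [a aE] := char_sum_span psi0 psiD Bs (ideal_val_span (y - z)).
  have [w wE] := mem_ideal (eA (- B)).
  have [r rE] := xc w.
  have EE : E B = val x + val (y - z) *+ l.
    by rewrite -ideal_valMn -ideal_valD mulrnBl -zE -x0E; congr (val _); rewrite addrA subKr.
  have TE : (#|U|%:R - l%:R * a) * (Tnum B)%:R = l%:R ^+ c * r.
    apply: (mulfI b0); rewrite -rE wE gform_char_vecN // mulrCA -natrM -(@gform_char_vec_gen n F X R psi) //.
    have := congr1 (fun z => gform (eA B * z) eps) EE.
    rewrite mulrDr gformDl char_sum_vec // mulrnAr !gformMn aE gform_scalarl => /eqP.
    by rewrite -subr_eq => /eqP <-; rewrite mulrBl mulrA.
  have uU : #|U|%:R - l%:R * a \is a GRing.unit.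
    apply: (local_unit Rloc) => s /eqP; rewrite subr_eq -mulrDr => /eqP sE.
    apply: (@one_notin_max _ _ Rloc ((s + a) * #|U|%:R^-1)).
    by rewrite mulrA -sE mulrV // card_unitri_unit.
  have {TE} TE : (Tnum B)%:R = l%:R ^+ c * (#|U|%:R - l%:R * a)^-1 * r.
    by rewrite mulrAC -TE mulrAC mulrV // mul1r.
  have T0 := gram_num_gt0 B.
  rewrite pfactor_dvdn // leqNgt; apply/negP => kc.
  have [m lm Tm] := pfactor_coprime l_prime T0; move: TE.
  rewrite {1}Tm mulnC natrM natrX -(subnKC (ltnW kc)) exprD -!mulrA =>
    /(mulfI (expf_neq0 _ l0)).
  rewrite -(prednK (n := c - _)) ?subn_gt0 // exprS -mulrA => mE.
  have mU : m%:R \is a @GRing.unit R.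
    by apply: (nat_unit Rloc) => //; rewrite -prime_coprime // coprime_sym.
  set r' := _ * (_ * r) in mE.
  apply: (@one_notin_max _ _ Rloc (r' * m%:R^-1)).
  by rewrite mulrA -mE mulrV.
move=> /dvdnP[t tE]; have [x xE] := mem_ideal (eA B); exists x => //.
exists x; last by exists 0 => //; rewrite mul0rn addr0.
move=> y; have [f ->] := ideal_val_span y; rewrite xE -/(E B).
exists (\sum_(u in U) f u * (chi B u^-1%g * t%:R)).
rewrite gform_sumr !mulr_sumr; apply: eq_bigr => u uU.
rewrite gform_scalarr -[X in gb X](invgK u) -gform_gbasis gbasis_char_vec ?(@groupV _ (unitri X)) //.
rewrite gform_scalarl gform_char_vec_gen // tE !natrM natrX; ring.
Qed.

Lemma scaled_jantzen_linear c a x y : jant c x -> jant c y -> jant c (a *: x + y).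
Proof.
move=> xc yc z; have [s sE] := yc z.
have gz g : exists w : I, val w = gb g^-1%g * val z.
  by exists (gb g^-1%g *: z).
have H g : exists t, gform (val x) (gb g^-1%g * val z) = #|borelX X|%:R * (l%:R ^+ c * t).
  by have [w <-] := gz g; apply: xc.
have [r rE] := boolp.choice H.
exists (\sum_g a g * r g + s).
rewrite ideal_valD ideal_valZ gformDl sE !mulrDr; congr (_ + _).
rewrite {1}(galg_sum a) mulr_suml gform_suml !mulr_sumr; apply: eq_bigr => g _.
rewrite -mulrA gform_scalarl gform_gbasis rE; ring.
Qed.

Lemma jantzen_submodule c : is_submodule (jmod c).
Proof.
apply/is_submoduleP; split.
  exists 0; last by exists 0 => //; rewrite mul0rn addr0 raddf0.
  by move=> y; exists 0; rewrite gform0l !mulr0.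
have red (x y : I) : to_modl l (x + y *+ l) = to_modl l x.
  by apply/eqP/modlP; exists y; rewrite addrAC subrr add0r.
move=> a _ _ [x xc [x' _ <-]] [y yc [y' _ <-]].
exists (glift a *: x + y); first exact: scaled_jantzen_linear.
exists 0 => //; rewrite !red raddfD -[in RHS](gredK a); congr (_ + _).
by rewrite [RHS](@to_modl_scale R G l I).
Qed.

Lemma jantzen_desc c : jmod c.+1 `<=` jmod c.
Proof.
move=> _ [x xc [y _ <-]]; exists x; last by exists y.
by move=> z; have [r rE] := xc z; exists (l%:R * r); rewrite rE exprSr -mulrA.
Qed.

(** The form takes values divisible by the order of the Borel subgroup, by
    [gform_unipotent_gen]. *)
Lemma jantzen_mod0 : jmod 0 = setT.
Proof.
apply/seteqP; split=> // v _; have [x ->] := to_modl_surj v.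
exists x; last by exists 0 => //; rewrite mul0rn addr0.
move=> y; have [f fE] := ideal_val_span x.
have yg g : exists r, gform eps (gb g * val y) = #|borelX X|%:R * r.
  have := ideal_val_span (gb g *: y); rewrite ideal_valZ => -[f' ->].
  exists (\sum_(u in U) f' u * (\sum_(s : 'S_n) (u \in patgroup X (noninv s)))%:R).
  rewrite gform_sumr mulr_sumr; apply: eq_bigr => u uU.
  by rewrite gform_scalarr gformC gform_unipotent_gen // natrM mulrCA.
have [r rE] := boolp.choice yg.
exists (\sum_(u in U) f u * r u^-1%g); rewrite fE gform_suml expr0 mul1r mulr_sumr.
apply: eq_bigr => u uU; rewrite gform_scalarl gform_gbasis rE; ring.
Qed.

Lemma zero_submodule : is_submodule ([set 0] : set L).
Proof. by apply/is_submoduleP; split=> // a _ _ -> ->; rewrite scaler0 addr0. Qed.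

(** A nonzero term contains some [E B] with [l ^ c] dividing [gram_num B], which is
    at most [gram_num 0]. *)
Lemma jantzen_mod_eventually0 c : (Tnum 0 <= c)%N -> jmod c = [set 0].
Proof.
move=> Tc; have /is_submoduleP[J0 _] := jantzen_submodule c.
apply/seteqP; split=> [v vc|_ ->//]; apply: contrapT => v0.
have [B [Bs /(char_vec_jantzen c Bs) Bc _]] := char_vec_separates zero_submodule (jantzen_submodule c) vc v0.
have := dvdn_leq (gram_num_gt0 B) Bc; rewrite leqNgt => /negP; apply.
apply: leq_ltn_trans (ltn_expl c (prime_gt1 l_prime)); apply: leq_trans Tc.
rewrite /gram_num [leqRHS](bigID (avoids B)) /=; apply: leq_trans (leq_addr _ _).
rewrite leq_eqVlt; apply/orP; left; apply/eqP; apply: eq_bigl => s.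
rewrite andb_idl // => _; apply/forallP=> i; apply/forallP=> j.
by rewrite mxE eqxx.
Qed.

(** A submodule [Z] strictly between the two terms would give an eigenvector [E B] in
    [Z] and an eigenvector [E C] outside, both with Gram number of valuation
    exactly [c]; but these generate each other by [linked_of_val]. *)
Lemma jantzen_mod_step c : jmod c.+1 = jmod c \/ is_maximal_submodule (jmod c.+1) (jmod c).
Proof.
have [->|ne] := pselect (jmod c.+1 = jmod c); [by left|right; split].
- exact: jantzen_submodule.
- by split; [exact: jantzen_desc|move=> s; apply: ne; apply/seteqP; split;
  [exact: jantzen_desc|]].
move=> Z Zs DZ ZD; apply: contrapT => H.
have [v Zv Dv] : exists2 v, Z v & ~ jmod c.+1 v.
  apply: contrapT => K; apply: H; left; apply/seteqP; split=> // v Zv.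
  by apply: contrapT => nv; apply: K; exists v.
have [w Dw Zw] : exists2 w, jmod c w & ~ Z w.
  apply: contrapT => K; apply: H; right; apply/seteqP; split=> // w Dw.
  by apply: contrapT => nw; apply: K; exists w.
have val_c B (S1 S2 : set L) : sd B -> S2 `<=` jmod c -> jmod c.+1 `<=` S1 ->
   lifted S2 (E B) -> ~ lifted S1 (E B) -> logn l (Tnum B) = c.
  move=> Bs S2c S1c [y yE /S2c yc] nS1.
  have : (l ^ c %| Tnum B)%N by apply/(char_vec_jantzen _ Bs); exists y.
  rewrite pfactor_dvdn ?gram_num_gt0 // => ck; apply/eqP; rewrite eqn_leq ck andbT leqNgt.
  apply/negP => kc; apply: nS1.
  have : lifted (jmod c.+1) (E B) by apply/(char_vec_jantzen _ Bs);
    rewrite pfactor_dvdn ?gram_num_gt0.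
  by case=> x <- /S1c S1x; exists x.
have [B [Bs ZB DB]] := char_vec_separates (jantzen_submodule _) Zs Zv Dv.
have [C [Cs DC ZC]] := char_vec_separates Zs (jantzen_submodule _) Dw Zw.
apply: (ZC).
apply: (linked_of_val psi0 psiD psi_nt R0 l_prime _ lq q1 e2 le emin hN Bs Cs) => //.
- by move=> m lm; apply: (nat_unit Rloc).
- have Bc := val_c B _ _ Bs ZD (@subset_refl _ _) ZB DB.
  by rewrite Bc (val_c C _ _ Cs (@subset_refl _ _) DZ DC ZC).
exact: lifted_closed.
Qed.

Lemma jantzen_composition : composition_series_up_to_repetition jmod.
Proof.
apply: (composition_series_of_steps (N := Tnum 0)) jantzen_mod0 jantzen_desc _ jantzen_mod_step.
exact: jantzen_mod_eventually0.
Qed.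

End Jantzen.

(** * The general linear group *)

Section GLn.
Variables (n : nat) (F : finFieldType).
Local Notation G := {'GL_n.+1[F]}.

Definition mat_of_GL (g : G) : 'M[F]_n.+1 := GLval g.
Definition GL_of_mat (M : 'M[F]_n.+1) : G :=
  if @idP (M \in unitmx) is ReflectT uM then FinRing.unit 'M[F]_n.+1 uM else 1%g.

Fact mat_of_GL_unit g : mat_of_GL g \in unitmx.
Proof. exact: (valP g). Qed.

Fact mat_of_GLM g h : mat_of_GL (g * h)%g = mat_of_GL g *m mat_of_GL h.
Proof. by []. Qed.

Fact GL_of_matK M : M \in unitmx -> mat_of_GL (GL_of_mat M) = M.
Proof. by rewrite /GL_of_mat; case: {-}_ / idP => // uM _. Qed.

Fact mat_of_GLK : cancel mat_of_GL GL_of_mat.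
Proof. by move=> g; apply: val_inj; apply: GL_of_matK; apply: mat_of_GL_unit. Qed.

Definition GLn : glgroup n.+1 F :=
  GLGroup mat_of_GL_unit mat_of_GLM GL_of_matK mat_of_GLK.

Lemma borel_borelX : borel n.+1 F = borelX GLn.
Proof.
apply/setP=> g; rewrite [LHS]inE; apply/is_trig_mxP/(borelXP (X := GLn)) => H i j ij.
  by have := H j i ij; rewrite mxE.
by rewrite mxE; apply: H.
Qed.

Lemma perm_GL_perm_gl s : @perm_GL n.+1 F s = perm_gl GLn s.
Proof. by apply: val_inj; apply/esym/GL_of_matK/unitmx_perm. Qed.

Lemma steinberg_eltE (R : idomainType) : @steinberg_elt n.+1 F R = steinberg_gen GLn R.
Proof.
rewrite /steinberg_elt /steinberg_gen /borel_sum -borel_borelX.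
by apply: eq_bigr => s _; rewrite perm_GL_perm_gl.
Qed.
End GLn.

Lemma jantzen_scaled (n : nat) (F : finFieldType) (R : idomainType) (l c : nat) :
  (forall m, m.+1%:R != 0 :> R) ->
  jantzen n.+1 F R l c = scaled_jantzen (eps := @steinberg_elt n.+1 F R) #|borel n.+1 F| l c.
Proof.
move=> R0; have b0 : #|borel n.+1 F|%:R != 0 :> {fraction R}.
  rewrite -(rmorph_nat (@tofrac R)) tofrac_eq0 (nat_neq0 R0) // borel_borelX.
  exact: (card_borelX_gt0 (GLn n F)).
have formE (g z : R) : tofrac g / #|borel n.+1 F|%:R = tofrac z <-> g = #|borel n.+1 F|%:R * z.
  rewrite -(rmorph_nat (@tofrac R)) in b0 *.
  split=> [/(canRL (divfK b0))/eqP|->]; last by rewrite tofracM mulrAC mulfV ?mul1r.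
  by rewrite -tofracM tofrac_eq mulrC => /eqP.
by apply/seteqP; split=> x xc y; have [r /formE rE] := xc y; exists r => //; apply/formE.
Qed.

Theorem theorem8p1 (n q p l : nat) (F : finFieldType) (R : idomainType)
    (hn : (2 <= n)%N) (hq : #|F| = q) (hp : p \in [pchar F])
    (hl : prime l) (hlp : l <> p)
    (R_pid : is_pid R)
    (R_local : local_with_maximal_ideal [set l%:R * r | r in [set: R]])
    (R_char0 : [pchar R] =i pred0)
    (R_root : exists z : R, p.-primitive_root z)
    (e : nat)
    (he : [/\ (2 <= e)%N, (l %| (q ^ e - 1) %/ (q - 1))%N &
              forall i : nat, (2 <= i)%N ->
                (l %| (q ^ i - 1) %/ (q - 1))%N -> (e <= i)%N]) :
  let d := logn l ((q ^ e - 1) %/ (q - 1))%N in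
  let K := modl R l in
  let KG := galg K {'GL_n[F]} in
  let L : lmodType KG := steinberg_mod n F R l in
  let L_series_is_composition_series :=
    @composition_series_up_to_repetition KG L (jantzen_mod n F R l) in
  [/\ (d <= l)%N -> (n %/ e <= d * l)%N -> L_series_is_composition_series,
      d = l.+1 -> (n %/ e <= l ^ 2)%N -> L_series_is_composition_series &
      (l.+1 < d)%N -> (n %/ e < l ^ 2 + l)%N ->
        L_series_is_composition_series].
Proof.
case: n hn => [//|n] hn d K KG L series.
have R0 m : m.+1%:R != 0 :> R by rewrite (pcharf0P R).1.
have q1 : (1 < #|F|)%N by apply: finNzRing_gt1.
have lq : ~~ (l %| #|F|)%N.
  rewrite (card_pprimeChar hp) Euclid_dvdX // dvdn_prime2 ?(pcharf_prime hp) //.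
  by apply/negP => /andP[/eqP /hlp].
have [z pz] := R_root.
have [psi [psi0 psiD psi_nt]] := additive_character hp pz.
case: he => e2; rewrite {}/d {}/series -hq qintE // => le emin.
have {}emin i : (1 < i)%N -> (l %| qint #|F| i)%N -> (e <= i)%N.
  by move=> i1 li; apply: emin => //; rewrite qintE //.
set d := logn l _.
suff H : (d <= l /\ n.+1 %/ e <= d * l)%N \/ (d = l.+1 /\ n.+1 %/ e <= l ^ 2)%N \/
     (l.+1 < d /\ n.+1 %/ e < l ^ 2 + l)%N ->
   @composition_series_up_to_repetition KG L (jantzen_mod n.+1 F R l).
  by split=> h1 h2; apply: H; [left|right; left|right; right].
move=> hN.
have JE : jantzen_mod n.+1 F R l =
    @scaled_jantzen_mod _ R (@steinberg_elt n.+1 F R) #|borel n.+1 F| l.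
  by apply: funext => c; rewrite /jantzen_mod jantzen_scaled.
rewrite {}JE borel_borelX.
have gen (eps0 : galg R {'GL_n.+1[F]}) : eps0 = steinberg_gen (GLn n F) R ->
    @composition_series_up_to_repetition KG (modl (left_ideal_type eps0) l)
      (@scaled_jantzen_mod _ R eps0 #|borelX (GLn n F)| l).
  move=> ->; have J := jantzen_composition (GLn n F) psi0 psiD psi_nt R0 hl R_local lq q1 e2 le emin hN.
  exact: J.
exact: (gen _ (steinberg_eltE n F R)).
Qed.
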